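(* Let $(P,\omega)$ be a $2m$-dimensional symplectic manifold equipped with a Poisson connection $D$. Let $\{e_1,\dots,e_{2m}\}$ be a local frame field on some local chart $U$ and $\{\theta^1,\dots,\theta^{2m}\}$ its dual coframe field. If the torsion of $D$ is vanishing, then the $k$-th curl operator $\mathfrak{C}_\mu^k$ with respect to the volume form $\mu=\frac{1}{m!}\wedge^m\omega$ on $P$ can be written on $U$ in the form \[ \mathfrak{C}_\mu^k|_U=-\sum_{i=1}^{2m}i(\flat(e_i))\,D_{\theta^i}. \]
   Context: $\mathfrak{X}^k(P)=\Gamma^\infty(\wedge^kTP)$ and $\Omega^k(P)=\Gamma^\infty(\wedge^kT^*P)$; the pairing is $\langle\alpha_1\wedge\cdots\wedge\alpha_k,X_1\wedge\cdots\wedge X_k\rangle=\det(\alpha_i(X_j))$. Symplectic conventions: $\flat:\mathfrak{X}^1(P)\to\Omega^1(P)$, $\flat(X)=\omega(X,\cdot)$, is invertible with inverse $\sharp$; the Poisson bivector $\Pi$ of $\omega$ is defined by $\langle\beta\wedge\alpha,\Pi\rangle=\beta(\sharp\alpha)$ for 1-forms $\alpha,\beta$. Interior products: for $A\in\mathfrak{X}^a(P)$, $\eta\in\Omega^p(P)$: if $p\ge a$, $i(A)\eta\in\Omega^{p-a}(P)$ is given by $\langle i(A)\eta,B\rangle=\langle\eta,A\wedge B\rangle$ for all $(p-a)$-vector fields $B$; if $a\ge p$, $i(\eta)A\in\mathfrak{X}^{a-p}(P)$ is given by $\langle\tau,i(\eta)A\rangle=\langle\tau\wedge\eta,A\rangle$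 for all $(a-p)$-forms $\tau$; they are $0$ in the remaining cases. Curl operator: $\mu^\flat(A)=i(A)\mu$ is an isomorphism $\mathfrak{X}^k(P)\to\Omega^{2m-k}(P)$ with inverse $\mu^\sharp$, and $\mathfrak{C}_\mu^k=\mu^\sharp\circ d\circ\mu^\flat:\mathfrak{X}^k(P)\to\mathfrak{X}^{k-1}(P)$; $\mathfrak{C}_\mu^k|_U$ is its restriction to $U$. A contravariant derivative $D$ assigns to 1-forms $\eta,\alpha$ a 1-form $D_\eta\alpha$, $\mathbb{R}$-linearly in $\alpha$, $C^\infty(P)$-linearly in $\eta$, with $D_\eta(f\alpha)=fD_\eta\alpha+((\sharp\eta)f)\alpha$. It extends to multivector fields by $\langle\alpha_1\wedge\cdots\wedge\alpha_a,D_\eta A\rangle=(\sharp\eta)\langle\alpha_1\wedge\cdots\wedge\alpha_a,A\rangle-\sum_{i=1}^a\langle\alpha_1\wedge\cdots\wedge D_\eta\alpha_i\wedge\cdots\wedge\alpha_a,A\rangle$ (and $D_\eta f=(\sharp\eta)f$ on functions). $D$ is a Poisson connection if $D\Pi=0$. With $[\alpha,\beta]_\Pi=\mathcal{L}_{\sharp\alpha}\beta-\mathcal{L}_{\sharp\beta}\alpha+d\langle\alpha\wedge\beta,\Pi\rangle$, the torsion is $T_D(\alpha,\beta)=D_\alpha\beta-D_\beta\alpha-[\alpha,\beta]_\Pi$; it is vanishing if $T_D(\alpha,\beta)=0$ for all 1-forms $\alpha,\beta$. *)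

(* Defs.v *)
From HB Require Import structures.
From mathcomp Require Import all_boot all_order all_algebra.
From mathcomp Require Import all_classical all_reals all_analysis.
Set Implicit Arguments.
Unset Strict Implicit.
Unset Printing Implicit Defensive.
Import Order.TTheory GRing.Theory Num.Theory.
Import numFieldNormedType.Exports.
Local Open Scope classical_set_scope.
Local Open Scope ring_scope.

(* An element of the exterior algebra is the family of its coefficients on the
   basis e_S = e_{i1} /\ ... /\ e_{ik}, where S = {i1 < ... < ik}. The same type
   serves for the exterior algebra of a vector space with a chosen basis and for
   that of its dual, with the dual basis. *)

Definition ext (R : realType) (n : nat) := {ffun {set 'I_n} -> R^o}.

Definition ebase {R : realType} {n : nat} (S : {set 'I_n}) : ext R n :=
  [ffun T => (T == S)%:R].

Definition eone {R : realType} {n : nat} : ext R n := ebase (finset.set0 : {set _}).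

Definition egen {R : realType} {n : nat} (i : 'I_n) : ext R n := ebase [set i]%SET.

Definition homog {R : realType} {n : nat} (k : nat) (a : ext R n) : Prop :=
  forall S : {set 'I_n}, #|S| != k -> a S = 0.

(* For disjoint S and T, e_S /\ e_T = wsign S T * e_(S :|: T): the sign counts the
   inversions of the concatenation of S and T. *)
Definition wsign {R : realType} {n : nat} (S T : {set 'I_n}) : R :=
  (-1) ^+ #|[set p : 'I_n * 'I_n | [&& p.1 \in S, p.2 \in T & (p.2 < p.1)%N]]%SET|.

Definition wedge {R : realType} {n : nat} (a b : ext R n) : ext R n :=
  [ffun U : {set 'I_n} => \sum_(S : {set 'I_n} | S \subset U)
     (wsign S (U :\: S)%SET * a S * b (U :\: S)%SET : R^o)].

Definition wedge_pow {R : realType} {n : nat} (k : nat) (a : ext R n) : ext R n :=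
  iter k (wedge a) eone.

Definition wedge_fam {R : realType} {n k : nat} (a : 'I_k -> ext R n) : ext R n :=
  \big[wedge/eone]_(i <- enum 'I_k) a i.

(* Since the e_S and the e^S are dual bases for the determinant convention, this is
   the pairing with <a_1 /\ ... /\ a_k, X_1 /\ ... /\ X_k> = det (a_i (X_j)). *)
Definition pairing {R : realType} {n : nat} (a X : ext R n) : R :=
  \sum_(S : {set 'I_n}) (a S * X S : R).

(* i(A) eta, the form determined by <i(A) eta, B> = <eta, A /\ B>; it vanishes
   when the degree of A exceeds that of eta. *)
Definition iprodl {R : realType} {n : nat} (A eta : ext R n) : ext R n :=
  [ffun S => (pairing eta (wedge A (ebase S)) : R^o)].

(* i(eta) A, the multivector determined by <tau, i(eta) A> = <tau /\ eta, A>. *)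
Definition iprodr {R : realType} {n : nat} (eta A : ext R n) : ext R n :=
  [ffun S => (pairing (wedge (ebase S) eta) A : R^o)].

(* C^k functions on an open subset V of R^n, in the sense of Frechet. *)
Fixpoint Ck {R : realType} {n : nat} (k : nat) (V : set 'rV[R]_n)
    (f : 'rV[R]_n -> R) : Prop :=
  match k with
  | 0%N => forall u, V u -> {for u, continuous f}
  | j.+1 => (forall u, V u -> differentiable f u) /\
            forall i : 'I_n, Ck j V (fun u => 'D_(delta_mx 0 i) f u)
  end.

Definition Cinfty {R : realType} {n : nat} (V : set 'rV[R]_n)
  (f : 'rV[R]_n -> R) : Prop := forall k, Ck k V f.

(* A homeomorphism from the open set cdom onto an open subset of R^n; the values of
   cmap outside cdom and of cinv outside the image are irrelevant. *)
Record chart (R : realType) (T : topologicalType) (n : nat) := Chart {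
  cdom : set T;
  cmap : T -> 'rV[R]_n;
  cinv : 'rV[R]_n -> T;
  cdom_open : open cdom;
  cimg_open : open (cmap @` cdom);
  cmapK : forall x, cdom x -> cinv (cmap x) = x;
  cmap_continuous : forall x, cdom x -> {for x, continuous cmap};
  cinv_continuous : forall u, (cmap @` cdom) u -> {for u, continuous cinv} }.

Definition compatible {R : realType} {T : topologicalType} {n : nat}
    (c c' : chart R T n) : Prop :=
  forall j : 'I_n, Cinfty (cmap c @` (cdom c `&` cdom c'))
    (fun u => cmap c' (cinv c u) 0 j).

(* chart_at selects a chart around each point; the coordinate basis of this chart
   is the one used to describe the tangent space at that point. *)
Record manifold (R : realType) (n : nat) := Manifold {
  mcarrier :> topologicalType;
  manifold_hausdorff : hausdorff_space mcarrier;
  manifold_second_countable : @second_countable mcarrier;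
  atlas : set (chart R mcarrier n);
  atlas_compatible : forall c c', atlas c -> atlas c' -> compatible c c';
  chart_at : mcarrier -> chart R mcarrier n;
  chart_at_atlas : forall x, atlas (chart_at x);
  chart_at_dom : forall x, cdom (chart_at x) x }.

(* Membership in the maximal atlas. *)
Definition smooth_chart {R : realType} {n : nat} (M : manifold R n)
    (c : chart R M n) : Prop :=
  forall c', atlas c' -> compatible c c' /\ compatible c' c.

Definition smooth_fun {R : realType} {n : nat} (M : manifold R n) (f : M -> R) : Prop :=
  forall c, @atlas R n M c -> Cinfty (cmap c @` cdom c) (f \o cinv c).

(* The tangent space at x is R^n, with the coordinate basis of chart_at x; the
   value at x of a multivector field (resp. form) is its family of coefficients on
   the basis of the exterior powers of the tangent (resp. cotangent) space. *)

Definition mvfield {R : realType} {n : nat} (M : manifold R n) := M -> ext R n.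
Definition dform {R : realType} {n : nat} (M : manifold R n) := M -> ext R n.

(* d/dx^i of f at x, in the coordinates of c. *)
Definition pderiv {R : realType} {n : nat} {M : manifold R n} (c : chart R M n)
    (i : 'I_n) (f : M -> R) (x : M) : R :=
  'D_(delta_mx 0 i) (f \o cinv c) (cmap c x).

(* Jacobian matrix at y of the change of coordinates from c to c', acting on the
   right on row vectors. *)
Definition transition {R : realType} {n : nat} {M : manifold R n} (c c' : chart R M n)
    (y : M) : 'M[R]_n :=
  'J (cmap c' \o cinv c) (cmap c y).

(* The i-th coordinate vector field and coordinate 1-form of c, at y. *)
Definition coordv {R : realType} {n : nat} {M : manifold R n} (c : chart R M n)
    (i : 'I_n) : mvfield M :=
  fun y => \sum_(j < n) transition c (chart_at y) y i j *: egen j.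
Definition coordf {R : realType} {n : nat} {M : manifold R n} (c : chart R M n)
    (i : 'I_n) : dform M :=
  fun y => \sum_(j < n) transition (chart_at y) c y j i *: egen j.

(* Components in the coordinates of c, on the increasing multi-index S. *)
Definition mvcomp {R : realType} {n : nat} {M : manifold R n} (c : chart R M n)
    (A : mvfield M) (S : {set 'I_n}) : M -> R :=
  fun y => pairing (\big[wedge/eone]_(i <- enum S) coordf c i y) (A y).
Definition fcomp {R : realType} {n : nat} {M : manifold R n} (c : chart R M n)
    (eta : dform M) (S : {set 'I_n}) : M -> R :=
  fun y => pairing (eta y) (\big[wedge/eone]_(i <- enum S) coordv c i y).

(* Smooth k-vector fields and k-forms on an open subset W; values outside W are
   irrelevant. *)
Definition is_mvfield {R : realType} {n : nat} {M : manifold R n} (k : nat)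
    (W : set M) (A : mvfield M) : Prop :=
  (forall x, W x -> homog k (A x)) /\
  forall c S, @atlas R n M c ->
    Cinfty (cmap c @` (W `&` cdom c)) (mvcomp c A S \o cinv c).
Definition is_form {R : realType} {n : nat} {M : manifold R n} (k : nat)
    (W : set M) (eta : dform M) : Prop :=
  (forall x, W x -> homog k (eta x)) /\
  forall c S, @atlas R n M c ->
    Cinfty (cmap c @` (W `&` cdom c)) (fcomp c eta S \o cinv c).

Definition vderiv {R : realType} {n : nat} {M : manifold R n} (X : mvfield M)
    (f : M -> R) (x : M) : R :=
  \sum_(i < n) X x [set i]%SET * pderiv (chart_at x) i f x.

(* d eta = sum over i and S of (d eta_S / dx^i) dx^i /\ dx^S. *)
Definition dext {R : realType} {n : nat} {M : manifold R n} (eta : dform M) : dform M :=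
  fun x => \sum_(i < n) wedge (egen i)
    [ffun S => (pderiv (chart_at x) i (fcomp (chart_at x) eta S) x : R^o)].

Definition form_of_fun {R : realType} {n : nat} {M : manifold R n} (f : M -> R) : dform M :=
  fun x => f x *: eone.

(* L_X of a 1-form: (L_X b)_i = X (b_i) + sum_j b_j (d X^j / dx^i). *)
Definition lie1 {R : realType} {n : nat} {M : manifold R n} (X : mvfield M)
    (b : dform M) : dform M :=
  fun x => let c := chart_at x in
    \sum_(i < n) (vderiv X (fcomp c b [set i]%SET) x
      + \sum_(j < n) b x [set j]%SET * pderiv c i (mvcomp c X [set j]%SET) x) *: egen i.

Record symplectic (R : realType) (m : nat) := Symplectic {
  sbase :> manifold R (2 * m)%N;
  omega : dform sbase;
  omega_form : is_form 2 setT omega;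
  omega_closed : forall x, dext omega x = 0;
  omega_nondegenerate : forall x v, homog 1 v -> iprodl v (omega x) = 0 -> v = 0 }.

Definition flat {R : realType} {m : nat} {P : symplectic R m} (X : mvfield P) : dform P :=
  fun x => iprodl (X x) (omega x).

(* The inverse of flat at the point x. *)
Definition sharp_at {R : realType} {m : nat} {P : symplectic R m} (x : P)
    (a : ext R (2 * m)%N) : ext R (2 * m)%N :=
  xget 0 [set v | homog 1 v /\ iprodl v (omega x) = a].

Definition sharp {R : realType} {m : nat} {P : symplectic R m} (a : dform P) : mvfield P :=
  fun x => sharp_at x (a x).

Definition poisson_bivector {R : realType} {m : nat} (P : symplectic R m) : mvfield P :=
  fun x => xget 0 [set B | homog 2 B /\
    forall a b, homog 1 a -> homog 1 b -> pairing (wedge b a) B = pairing b (sharp_at x a)].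
Arguments poisson_bivector {R m} P _.

Definition liouville {R : realType} {m : nat} (P : symplectic R m) : dform P :=
  fun x => (m`!)%:R^-1 *: wedge_pow m (omega x).
Arguments liouville {R m} P _.

Definition mflat {R : realType} {n : nat} {M : manifold R n} (mu : dform M)
    (A : mvfield M) : dform M :=
  fun x => iprodl (A x) (mu x).

(* The inverse of mflat mu, for a volume form mu. *)
Definition msharp {R : realType} {n : nat} {M : manifold R n} (mu : dform M)
    (eta : dform M) : mvfield M :=
  fun x => xget 0 [set A | iprodl A (mu x) = eta x].

(* The curl operators of all degrees at once; the k-th one is the restriction to
   k-vector fields. *)
Definition curl {R : realType} {n : nat} {M : manifold R n} (mu : dform M)
    (A : mvfield M) : mvfield M :=
  msharp mu (dext (mflat mu A)).

Record contravariant (R : realType) (m : nat) (P : symplectic R m) := Contravariant {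
  cder :> dform P -> dform P -> dform P;
  cder_form : forall eta a, is_form 1 setT eta -> is_form 1 setT a ->
    is_form 1 setT (cder eta a);
  cder_linear : forall (r : R) eta a b,
    is_form 1 setT eta -> is_form 1 setT a -> is_form 1 setT b -> forall x,
    cder eta (fun y => r *: a y + b y) x = r *: cder eta a x + cder eta b x;
  cder_Cinfty_linear : forall (f : P -> R) eta eta' a, smooth_fun f ->
    is_form 1 setT eta -> is_form 1 setT eta' -> is_form 1 setT a -> forall x,
    cder (fun y => f y *: eta y + eta' y) a x = f x *: cder eta a x + cder eta' a x;
  cder_leibniz : forall (f : P -> R) eta a, smooth_fun f ->
    is_form 1 setT eta -> is_form 1 setT a -> forall x,
    cder eta (fun y => f y *: a y) x
      = f x *: cder eta a x + vderiv (sharp eta) f x *: a x }.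

(* D_eta A for a k-vector field A on P: the k-vector field whose pairings with the
   products of k 1-forms on P are given by the product rule. *)
Definition cder_mv {R : realType} {m : nat} {P : symplectic R m} (D : contravariant P)
    (k : nat) (eta : dform P) (A : mvfield P) : mvfield P :=
  fun x => xget 0 [set B | homog k B /\
    forall a : 'I_k -> dform P, (forall i, is_form 1 setT (a i)) ->
      pairing (wedge_fam (fun i => a i x)) B
      = vderiv (sharp eta) (fun y => pairing (wedge_fam (fun i => a i y)) (A y)) x
        - \sum_(i < k)
            pairing (wedge_fam (fun j => if j == i then D eta (a j) x else a j x)) (A x)].

(* D_eta A for a 1-form eta and a k-vector field A that are only defined around x:
   the value at x of D_eta' A', for any global eta' and A' that coincide with eta
   and A around x. *)
Definition cder_loc {R : realType} {m : nat} {P : symplectic R m} (D : contravariant P)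
    (k : nat) (eta : dform P) (A : mvfield P) : mvfield P :=
  fun x => xget 0 [set B | exists (eta' : dform P) (A' : mvfield P),
    [/\ is_form 1 setT eta', is_mvfield k setT A',
        (\forall y \near x, eta' y = eta y),
        (\forall y \near x, A' y = A y)
      & B = cder_mv D k eta' A' x]].

Definition poisson_connection {R : realType} {m : nat} {P : symplectic R m}
    (D : contravariant P) : Prop :=
  forall eta, is_form 1 setT eta ->
    forall x : P, cder_mv D 2 eta (poisson_bivector P) x = 0.

Definition poisson_bracket {R : realType} {m : nat} {P : symplectic R m}
    (a b : dform P) : dform P :=
  fun x => lie1 (sharp a) b x - lie1 (sharp b) a x
    + dext (form_of_fun (fun y => pairing (wedge (a y) (b y)) (poisson_bivector P y))) x.

Definition torsion {R : realType} {m : nat} {P : symplectic R m} (D : contravariant P)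
    (a b : dform P) : dform P :=
  fun x => D a b x - D b a x - poisson_bracket a b x.

Definition torsion_free {R : realType} {m : nat} {P : symplectic R m}
    (D : contravariant P) : Prop :=
  forall a b, is_form 1 setT a -> is_form 1 setT b -> forall x : P, torsion D a b x = 0.

Definition is_frame {R : realType} {n : nat} {M : manifold R n} (U : set M)
    (e : 'I_n -> mvfield M) : Prop :=
  (forall i, is_mvfield 1 U (e i)) /\
  forall x, U x -> \matrix_(i, j) (e i x [set j]%SET : R) \in unitmx.

Definition is_dual_coframe {R : realType} {n : nat} {M : manifold R n} (U : set M)
    (e : 'I_n -> mvfield M) (theta : 'I_n -> dform M) : Prop :=
  (forall i, is_form 1 U (theta i)) /\
  forall x, U x -> forall i j, pairing (theta i x) (e j x) = (i == j)%:R.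

(* Main.v *)
(* With nabla_X = D_{flat X}, the vanishing of the torsion together with D Pi = 0
   makes nabla symmetric and omega parallel, hence also mu parallel.  Writing
   d = sum_q e^q /\ nabla_q and using alpha /\ i(B) mu = i(i(alpha) B) mu for a top
   form mu, one gets d (i(A) mu) = i(sum_q i(e^q) nabla_q A) mu, which is the claim
   in coordinates; the two sums over a frame and its dual coframe then absorb
   omega and its inverse.  The definition of D_eta A quantifies over global
   1-forms, so local coordinate forms are cut off with smooth bump functions in
   order to show that D is a first-order operator given by Christoffel symbols. *)

From HB Require Import structures.
Require Import Defs.
From mathcomp Require Import all_boot all_order all_algebra.
From mathcomp Require Import all_classical all_reals all_analysis.
From mathcomp Require Import ring.
Set Implicit Arguments.
Unset Strict Implicit.
Unset Printing Implicit Defensive.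
Import Order.TTheory GRing.Theory Num.Theory.
Import numFieldNormedType.Exports.
Local Open Scope ring_scope.

(** * Exterior algebra *)

(** A field is stored at each point [y] in the basis of [chart_at y], which may jump with [y], so it
    cannot be differentiated as it stands. Around a point [x0] everything is first moved to the
    single chart [chart_at x0] by the algebra morphisms of the Jacobians ([pull], [push]), which are
    the identity at [x0] itself. [sharp], the Poisson bivector, [msharp], [cder_mv] and [cder_loc]
    are choices by [xget]: each is computed from an explicit witness and a uniqueness argument. The
    torsion of [D] involves the derivatives of the inverse matrix of omega, and D Pi = 0 is what
    expresses these through the Christoffel symbols. Only the two together yield the symmetry of
    nabla, by the argument that makes the Levi-Civita connection unique. In d (i(A) mu) two traces
    cancel: one from differentiating mu, one from moving a derivation across the contraction. The
    sign of the formula is the antisymmetry of the matrix of omega, met when omega is moved from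
    flat(e_i) onto the derivative. *)

Section ExteriorAlgebra.
Import mathcomp.boot.fintype mathcomp.boot.finset.
Variables (R : realType) (n : nat).
Implicit Types (a b c v w A B eta xi tau : ext R n) (S T U : {set 'I_n}) (i j : 'I_n) (r : R).

Lemma extD a b S : (a + b) S = a S + b S. Proof. by rewrite ffunE. Qed.
Lemma extZ r a S : (r *: a) S = r * a S. Proof. by rewrite ffunE. Qed.
Lemma extN a S : (- a) S = - a S. Proof. by rewrite ffunE. Qed.
Lemma ext0 S : (0 : ext R n) S = 0. Proof. by rewrite ffunE. Qed.
Lemma ext_sum (I : Type) (s : seq I) (P : pred I) (F : I -> ext R n) S :
  (\sum_(i <- s | P i) F i) S = \sum_(i <- s | P i) F i S.
Proof. by apply: (big_morph (fun a : ext R n => a S)) => [x y|]; rewrite ffunE. Qed.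

Lemma ext_decomp a : a = \sum_S a S *: ebase S.
Proof.
apply/ffunP=> S; rewrite ext_sum (bigD1 S) //= big1 => [|T nTS].
  by rewrite extZ ffunE eqxx mulr1 addr0.
by rewrite extZ ffunE eq_sym (negPf nTS) mulr0.
Qed.

Lemma ext_ind (Q : ext R n -> Prop) :
  (forall r a b, Q a -> Q b -> Q (r *: a + b)) -> (forall S, Q (ebase S)) ->
  forall a, Q a.
Proof.
move=> QD Qe a; have Q0 : Q 0.
  by have := QD (-1) _ _ (Qe set0) (Qe set0); rewrite scaleN1r addNr.
by rewrite (ext_decomp a); elim/big_rec: _ => // S b _; apply: QD.
Qed.

Lemma wedge_is_linear a : linear (wedge a : ext R n -> ext R n).
Proof.
move=> r b c; apply/ffunP => U; rewrite extD extZ !ffunE mulr_sumr -big_split /=.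
by apply: eq_bigr => S _; rewrite extD extZ mulrDr mulrCA.
Qed.
HB.instance Definition _ a :=
  GRing.isLinear.Build R (ext R n) (ext R n) _ (wedge a) (wedge_is_linear a).

(** Swapped arguments, so that linearity in the left factor can be registered as an instance as
    well. *)
Definition wedger b a := wedge a b.
Lemma wedger_is_linear b : linear (wedger b).
Proof.
move=> r a c; apply/ffunP => U; rewrite extD extZ !ffunE mulr_sumr -big_split /=.
by apply: eq_bigr => S _; rewrite extD extZ mulrDr mulrDl; congr (_ + _); ring.
Qed.
HB.instance Definition _ b :=
  GRing.isLinear.Build R (ext R n) (ext R n) _ (wedger b) (wedger_is_linear b).

Lemma wedgeDr a b c : wedge a (b + c) = wedge a b + wedge a c.
Proof. exact: linearD. Qed.
Lemma wedgeZr r a b : wedge a (r *: b) = r *: wedge a b.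
Proof. exact: linearZ. Qed.
Lemma wedge_sumr (I : Type) (s : seq I) (P : pred I) (F : I -> ext R n) b :
  wedge b (\sum_(i <- s | P i) F i) = \sum_(i <- s | P i) wedge b (F i).
Proof. exact: linear_sum. Qed.
Lemma wedgeDl a b c : wedge (a + b) c = wedge a c + wedge b c.
Proof. exact: (linearD (wedger c)). Qed.
Lemma wedgeZl r a b : wedge (r *: a) b = r *: wedge a b.
Proof. exact: (linearZ_LR (wedger b)). Qed.
Lemma wedgeNl a b : wedge (- a) b = - wedge a b.
Proof. exact: (linearN (wedger b)). Qed.
Lemma wedge0l a : wedge 0 a = 0.
Proof. exact: (linear0 (wedger a)). Qed.
Lemma wedge_suml (I : Type) (s : seq I) (P : pred I) (F : I -> ext R n) b :
  wedge (\sum_(i <- s | P i) F i) b = \sum_(i <- s | P i) wedge (F i) b.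
Proof. exact: (linear_sum (wedger b)). Qed.

Lemma pairing_is_scalar a : scalar (pairing a : ext R n -> R).
Proof.
move=> r b c; rewrite /pairing mulr_sumr -big_split /=.
by apply: eq_bigr => S _; rewrite extD extZ mulrDr mulrCA.
Qed.
HB.instance Definition _ a :=
  GRing.isLinear.Build R (ext R n) R _ (pairing a) (pairing_is_scalar a).

Lemma pairingC a b : pairing a b = pairing b a.
Proof. by apply: eq_bigr => S _; rewrite mulrC. Qed.
Lemma pairingDr a b c : pairing a (b + c) = pairing a b + pairing a c.
Proof. exact: linearD. Qed.
Lemma pairingDl a b c : pairing (a + b) c = pairing a c + pairing b c.
Proof. by rewrite pairingC pairingDr !(pairingC c). Qed.
Lemma pairingZr r a b : pairing a (r *: b) = r * pairing a b.
Proof. exact: linearZ. Qed.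
Lemma pairingZl r a b : pairing (r *: a) b = r * pairing a b.
Proof. by rewrite pairingC pairingZr pairingC. Qed.
Lemma pairing0l a : pairing 0 a = 0.
Proof. by rewrite pairingC linear0. Qed.
Lemma pairing_suml (I : Type) (s : seq I) (P : pred I) (F : I -> ext R n) b :
  pairing (\sum_(i <- s | P i) F i) b = \sum_(i <- s | P i) pairing (F i) b.
Proof. by rewrite pairingC linear_sum; apply: eq_bigr => i _; rewrite pairingC. Qed.

Lemma pairing_ebasel S a : pairing (ebase S) a = a S.
Proof.
rewrite /pairing (bigD1 S) //= big1 => [|T nTS].
  by rewrite ffunE eqxx mul1r addr0.
by rewrite ffunE (negPf nTS) mul0r.
Qed.
Lemma pairing_ebaser S a : pairing a (ebase S) = a S.
Proof. by rewrite pairingC pairing_ebasel. Qed.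

Lemma pairing_injl a b : (forall c, pairing c a = pairing c b) -> a = b.
Proof. by move=> h; apply/ffunP => S; rewrite -!pairing_ebasel. Qed.

Lemma iprodlE A eta B : pairing (iprodl A eta) B = pairing eta (wedge A B) :> R.
Proof.
rewrite {2}(ext_decomp B) !linear_sum; apply: eq_bigr => S _.
by rewrite !linearZ /= ffunE mulrC.
Qed.
Lemma iprodrE tau eta A : pairing tau (iprodr eta A) = pairing (wedge tau eta) A :> R.
Proof.
rewrite {2}(ext_decomp tau) wedge_suml pairing_suml; apply: eq_bigr => S _.
by rewrite wedgeZl pairingZl ffunE.
Qed.

Lemma iprodl_is_linear A : linear (iprodl A : ext R n -> ext R n).
Proof.
by move=> r eta xi; apply: pairing_injl => c;
  rewrite !(pairingC c) pairingDl pairingZl !iprodlE pairingDl pairingZl.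
Qed.
HB.instance Definition _ A :=
  GRing.isLinear.Build R (ext R n) (ext R n) _ (iprodl A) (iprodl_is_linear A).
Definition iprodlr (eta A : ext R n) := iprodl A eta.
Lemma iprodlr_is_linear eta : linear (iprodlr eta).
Proof.
by move=> r A B; apply: pairing_injl => c;
  rewrite !(pairingC c) pairingDl pairingZl !iprodlE wedgeDl wedgeZl pairingDr pairingZr.
Qed.
HB.instance Definition _ eta :=
  GRing.isLinear.Build R (ext R n) (ext R n) _ (iprodlr eta) (iprodlr_is_linear eta).
Lemma iprodlDr A a b : iprodl A (a + b) = iprodl A a + iprodl A b.
Proof. exact: linearD. Qed.
Lemma iprodlZr r A a : iprodl A (r *: a) = r *: iprodl A a.
Proof. exact: linearZ. Qed.
Lemma iprodlDl A B eta : iprodl (A + B) eta = iprodl A eta + iprodl B eta :> ext R n.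
Proof. exact: (linearD (iprodlr eta)). Qed.
Lemma iprodlZl r A eta : iprodl (r *: A) eta = r *: iprodl A eta :> ext R n.
Proof. exact: (linearZ_LR (iprodlr eta)). Qed.
Lemma iprodlNl A eta : iprodl (- A) eta = - iprodl A eta :> ext R n.
Proof. exact: (linearN (iprodlr eta)). Qed.
Lemma iprodl_suml (I : Type) (s : seq I) (P : pred I) (F : I -> ext R n) b :
  iprodl (\sum_(i <- s | P i) F i) b = \sum_(i <- s | P i) iprodl (F i) b.
Proof. exact: (linear_sum (iprodlr b)). Qed.

Lemma iprodr_is_linear eta : linear (iprodr eta : ext R n -> ext R n).
Proof.
by move=> r A B; apply: pairing_injl => c;
  rewrite pairingDr pairingZr !iprodrE pairingDr pairingZr.
Qed.
HB.instance Definition _ eta :=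
  GRing.isLinear.Build R (ext R n) (ext R n) _ (iprodr eta) (iprodr_is_linear eta).
Definition iprodrr (A eta : ext R n) := iprodr eta A.
Lemma iprodrr_is_linear A : linear (iprodrr A).
Proof.
by move=> r a b; apply: pairing_injl => c;
  rewrite pairingDr pairingZr !iprodrE linearP /= pairingDl pairingZl.
Qed.
HB.instance Definition _ A :=
  GRing.isLinear.Build R (ext R n) (ext R n) _ (iprodrr A) (iprodrr_is_linear A).

Lemma iprodrZl r a A : iprodr (r *: a) A = r *: iprodr a A.
Proof. exact: (linearZ_LR (iprodrr A)). Qed.
Lemma iprodr_suml (I : Type) (s : seq I) (P : pred I) (F : I -> ext R n) A :
  iprodr (\sum_(x <- s | P x) F x) A = \sum_(x <- s | P x) iprodr (F x) A.
Proof. exact: (linear_sum (iprodrr A)). Qed.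
Lemma iprodrZr r a A : iprodr a (r *: A) = r *: iprodr a A.
Proof. exact: linearZ. Qed.
Lemma iprodr_sumr (I : Type) (s : seq I) (P : pred I) (F : I -> ext R n) a :
  iprodr a (\sum_(x <- s | P x) F x) = \sum_(x <- s | P x) iprodr a (F x).
Proof. exact: linear_sum. Qed.

(** Inversions against a disjoint union are counted separately in the two pieces. With [wsignUl]
    this gives the cocycle identity behind the associativity of [wedge]. *)
Lemma wsignUr S T U : [disjoint T & U] ->
  wsign S (T :|: U)%SET = wsign S T * wsign S U :> R.
Proof.
move=> dTU; rewrite /wsign -exprD -cardsUI.
set X := (X in (#|X :|: _| + _)%N); set Y := (Y in (#|_ :|: Y| + _)%N).
have -> : #|X :&: Y|%SET = 0%N.
  apply/eqP; rewrite cards_eq0; apply/eqP/setP => p; rewrite !inE.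
  apply/negP => /andP[/and3P[_ pT _] /and3P[_ pU _]].
  by have := disjointFr dTU pT; rewrite pU.
rewrite addn0; congr (_ ^+ #|pred_of_set _|); apply/setP => p; rewrite !inE.
by case: (p.1 \in S); case: (p.2 \in T); case: (p.2 \in U); case: (p.2 < p.1)%N.
Qed.

Lemma wsignUl S T U : [disjoint S & T] ->
  wsign (S :|: T)%SET U = wsign S U * wsign T U :> R.
Proof.
move=> dTU; rewrite /wsign -exprD -cardsUI.
set X := (X in (#|X :|: _| + _)%N); set Y := (Y in (#|_ :|: Y| + _)%N).
have -> : #|X :&: Y|%SET = 0%N.
  apply/eqP; rewrite cards_eq0; apply/eqP/setP => p; rewrite !inE.
  apply/negP => /andP[/and3P[pT _ _] /and3P[pU _ _]].
  by have := disjointFr dTU pT; rewrite pU.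
rewrite addn0; congr (_ ^+ #|pred_of_set _|); apply/setP => p; rewrite !inE.
by case: (p.1 \in S); case: (p.1 \in T); case: (p.2 \in U); case: (p.2 < p.1)%N.
Qed.


Lemma wedgeE a b U : wedge a b U =
  \sum_(S : {set 'I_n} | S \subset U) (wsign S (U :\: S)%SET * a S * b (U :\: S)%SET : R).
Proof. by rewrite /wedge ffunE. Qed.
Lemma ebaseE S T : ebase S T = (T == S)%:R :> R.
Proof. by rewrite ffunE. Qed.

Lemma wedge_ebase S T : wedge (ebase S) (ebase T) =
  (if [disjoint S & T] then wsign S T else 0) *: ebase (S :|: T)%SET :> ext R n.
Proof.
apply/ffunP => U; rewrite extZ wedgeE ebaseE.
have [->|nU] := eqVneq U (S :|: T)%SET.
  rewrite mulr1 (bigD1 S) ?subsetUl //= big1 => [|S' /andP[_ nS]]; last first.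
    by rewrite ebaseE (negPf nS) mulr0 mul0r.
  rewrite addr0 !ebaseE eqxx mulr1; case: ifPn => [dST|ndST].
    suff -> : ((S :|: T) :\: S)%SET = T by rewrite eqxx mulr1.
    apply/setP => x; rewrite !inE; case: (boolP (x \in S)) => //= xS.
    by rewrite (disjointFr dST xS).
  case: eqP => [E|]; last by rewrite mulr0.
  by case/negP: ndST; rewrite -E disjoint_sym disjoints_subset; apply/subsetP => x;
    rewrite !inE => /andP[].
rewrite mulr0 big1 // => S' sub; rewrite !ebaseE.
have [ES|] := eqVneq S' S; last by rewrite mulr0 mul0r.
case: eqP => [E|]; last by rewrite mulr0.
case/negP: nU; rewrite -E -ES; apply/eqP/setP => x; rewrite !inE.
by case xS: (x \in S') => //=; apply: (subsetP sub).
Qed.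

Lemma disjointU1 S T U : [disjoint (S :|: T)%SET & U] = [disjoint S & U] && [disjoint T & U].
Proof. by rewrite !disjoints_subset subUset. Qed.
Lemma disjointU2 S T U : [disjoint U & (S :|: T)%SET] = [disjoint U & S] && [disjoint U & T].
Proof. by rewrite disjoint_sym disjointU1 !(disjoint_sym U). Qed.

Lemma wedgeA a b c : wedge a (wedge b c) = wedge (wedge a b) c.
Proof.
elim/ext_ind: a => [r a a' IH IH'|S]; first by rewrite !(wedgeDl, wedgeZl) IH IH'.
elim/ext_ind: b => [r b b' IH IH'|T].
  by rewrite !(wedgeDl, wedgeZl, linearD, linearZ) /= IH IH'.
elim/ext_ind: c => [r b b' IH IH'|U].
  by rewrite !(linearD, linearZ) /= IH IH'.
rewrite !wedge_ebase !(linearZ, wedgeZl) /= !wedge_ebase !scalerA disjointU1 disjointU2.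
rewrite setUA; congr (_ *: _).
case dST : [disjoint S & T]; case dTU : [disjoint T & U]; case dSU : [disjoint S & U];
  rewrite ?mul0r ?mulr0 //= wsignUr // wsignUl //; ring.
Qed.

Lemma wedge1a a : wedge eone a = a.
Proof.
elim/ext_ind: a => [r a b IH IH'|S]; first by rewrite linearD linearZ /= IH IH'.
rewrite wedge_ebase set0U -setI_eq0 set0I eqxx /wsign.
by rewrite eq_card0 ?scale1r // => p; rewrite !inE.
Qed.
Lemma wedgea1 a : wedge a eone = a.
Proof.
elim/ext_ind: a => [r a b IH IH'|S]; first by rewrite wedgeDl wedgeZl IH IH'.
rewrite wedge_ebase setU0 -setI_eq0 setI0 eqxx /wsign.
by rewrite eq_card0 ?scale1r // => p; rewrite !inE andbF.
Qed.

HB.instance Definition _ := Monoid.isLaw.Build (ext R n) eone wedge wedgeA wedge1a wedgea1.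

(** The sign of sorting [e_i], put in front of [e_S], into its place. *)
Definition isgn i S : R := (-1) ^+ #|[set k in S | (k < i)%N]%SET|.

Lemma isgn2 i S : isgn i S * isgn i S = 1.
Proof. by rewrite -expr2 sqrr_sign. Qed.

Lemma wsign1 i S : wsign [set i]%SET S = isgn i S.
Proof.
rewrite /wsign /isgn; congr (_ ^+ _).
rewrite -(card_imset (mem [set k in S | (k < i)%N]%SET) (f := fun k => (i, k)));
  last by move=> ? ? [].
apply: eq_card => -[p q]; rewrite !inE /=; apply/and3P/imsetP => [[/eqP-> qS qi]|[k]].
  by exists q => //; rewrite !inE qS.
by rewrite !inE => /andP[kS ki] [-> ->].
Qed.

Lemma wedge_egen i S : wedge (egen i) (ebase S) =
  (if i \in S then 0 else isgn i S) *: ebase (i |: S)%SET :> ext R n.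
Proof.
by rewrite wedge_ebase wsign1 disjoints1; case: (i \in S).
Qed.

Lemma isgnU1 i j S : j \notin S -> isgn i (j |: S)%SET = (-1) ^+ (j < i)%N * isgn i S.
Proof.
move=> jS; rewrite /isgn -exprD; congr (_ ^+ _).
case: (boolP (j < i)%N) => ji; last first.
  apply: eq_card => k; rewrite !inE; case: (k =P j) => [->|] //=.
  by rewrite (negPf ji) andbF.
have := cardsU1 j [set k in S | (k < i)%N]%SET; rewrite inE (negPf jS) => <-.
by apply: eq_card => k; rewrite !inE; case: (k =P j) => [->|] //=.
Qed.

Lemma isgnD1 i j S : i \in S -> isgn j (S :\ i)%SET = (-1) ^+ (i < j)%N * isgn j S.
Proof.
move=> iS; rewrite -{2}(setD1K iS) isgnU1 ?inE ?eqxx //.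
by rewrite mulrA -expr2 sqrr_sign mul1r.
Qed.

Lemma iprodl_egen i S : iprodl (egen i) (ebase S) =
  (if i \in S then isgn i S else 0) *: ebase (S :\ i)%SET :> ext R n.
Proof.
apply/ffunP => T; rewrite extZ ebaseE -pairing_ebaser iprodlE pairing_ebasel.
rewrite wedge_egen extZ ebaseE.
have [->|nT] := eqVneq T (S :\ i)%SET.
  rewrite !inE eqxx /=; case: ifP => iS; last first.
    case: eqP => [ES|]; last by rewrite mul0r mulr0.
    by move: iS; rewrite ES !inE eqxx.
  by rewrite (setD1K iS) eqxx isgnD1 // ltnn mul1r.
case: ifPn => iT; first by rewrite mul0r mulr0.
case: eqP => [ES|]; last by rewrite !mulr0.
by move: nT; rewrite ES setU1K // eqxx.
Qed.

(** The Clifford relation between contraction and exterior multiplication. On a basis element it is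
    sign bookkeeping; for distinct [i] and [j] exactly one of [i < j] and [j < i] holds, and that
    supplies the minus sign. *)
Lemma iprodl_egen_wedge i j a : iprodl (egen i) (wedge (egen j) a) =
  (i == j)%:R *: a - wedge (egen j) (iprodl (egen i) a) :> ext R n.
Proof.
elim/ext_ind: a => [r a b IH IH'|S].
  rewrite !(wedgeDr, wedgeZr, iprodlDr, iprodlZr) IH IH'.
  by rewrite scalerBr scalerDr opprD addrACA !scalerA (mulrC r).
rewrite wedge_egen iprodlZr !iprodl_egen wedgeZr wedge_egen !scalerA.
have [->|ij] := eqVneq i j; rewrite !inE ?eqxx /= ?scale1r.
  case: ifPn => jS; last by rewrite mul0r scale0r subr0 setU1K // isgnU1 // ltnn mul1r isgn2
    scale1r.
  by rewrite mul0r scale0r setD1K // isgnD1 // ltnn mul1r isgn2 scale1r subrr.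
rewrite scale0r sub0r -scaleNr (eq_sym j i) (negPf ij) /=.
have -> : ((j |: S) :\ i = j |: S :\ i)%SET.
  by apply/setP => k; rewrite !inE; case: (k =P j) => [->|//]; rewrite eq_sym ij.
case: ifPn => jS; case: ifPn => iS; rewrite ?mul0r ?mulr0 ?oppr0 //.
congr (_ *: _); rewrite isgnU1 // isgnD1 //.
have := ij; rewrite -val_eqE /= neq_ltn.
by case: ltngtP => //= _ _; ring.
Qed.

Lemma homogD k a b : homog k a -> homog k b -> homog k (a + b).
Proof. by move=> ha hb S hS; rewrite extD ha // hb // addr0. Qed.
Lemma homogZ k r a : homog k a -> homog k (r *: a).
Proof. by move=> ha S hS; rewrite extZ ha // mulr0. Qed.
Lemma homogN k a : homog k a -> homog k (- a).
Proof. by move=> ha S hS; rewrite extN ha // oppr0. Qed.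
Lemma homog0 k : homog k (0 : ext R n).
Proof. by move=> S _; rewrite ext0. Qed.
Lemma homog_sum k (I : Type) (s : seq I) (P : pred I) (F : I -> ext R n) :
  (forall x, P x -> homog k (F x)) -> homog k (\sum_(i <- s | P i) F i).
Proof. by move=> h; elim/big_ind: _ => //; [exact: homog0|move=> ? ?; exact: homogD]. Qed.
Lemma homog_ebase S : homog #|S| (ebase S : ext R n).
Proof. by move=> T; rewrite ebaseE; case: (T =P S) => // ->; rewrite eqxx. Qed.
Lemma homog_egen i : homog 1 (egen i : ext R n).
Proof. by rewrite -(cards1 i); apply: homog_ebase. Qed.
Lemma homog_eone : homog 0 (eone : ext R n).
Proof. by rewrite -(@cards0 'I_n); apply: homog_ebase. Qed.

Lemma homog1E v : homog 1 v -> v = \sum_i v [set i]%SET *: egen i.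
Proof.
move=> hv; apply/ffunP => S; rewrite ext_sum.
have [/eqP/cards1P[i ->]|S1] := eqVneq #|S| 1%N; last first.
  rewrite hv // big1 // => i _; rewrite extZ (homog_egen i) ?mulr0 //.
rewrite (bigD1 i) //= big1 => [|j ji]; rewrite extZ ebaseE.
  by rewrite eqxx mulr1 addr0.
by rewrite (inj_eq set1_inj) eq_sym (negPf ji) mulr0.
Qed.

Lemma iprodl_sumr (I : Type) (s : seq I) (P : pred I) (F : I -> ext R n) b :
  iprodl b (\sum_(i <- s | P i) F i) = \sum_(i <- s | P i) iprodl b (F i).
Proof. exact: linear_sum. Qed.
Lemma pairing_sumr (I : Type) (s : seq I) (P : pred I) (F : I -> ext R n) b :
  pairing b (\sum_(i <- s | P i) F i) = \sum_(i <- s | P i) pairing b (F i).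
Proof. exact: linear_sum. Qed.

Lemma iprodl_wedge v w a : homog 1 v -> homog 1 w ->
  iprodl v (wedge w a) = pairing v w *: a - wedge w (iprodl v a).
Proof.
move=> hv hw.
have H i : iprodl (egen i) (wedge w a) =
    w [set i]%SET *: a - wedge w (iprodl (egen i) a).
  rewrite {1}(homog1E hw) {3}(homog1E hw) !wedge_suml iprodl_sumr.
  under eq_bigr do rewrite wedgeZl iprodlZr iprodl_egen_wedge scalerBr.
  rewrite sumrB; congr (_ - _); last by apply: eq_bigr => j _; rewrite wedgeZl.
  rewrite (bigD1 i) //= eqxx scale1r big1 ?addr0 // => j ji.
  by rewrite eq_sym (negPf ji) scale0r scaler0.
rewrite (homog1E hv) !iprodl_suml pairing_suml scaler_suml.
rewrite wedge_sumr -sumrB; apply: eq_bigr => i _.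
by rewrite !(iprodlZl, wedgeZr, pairingZl) H pairing_ebasel scalerBr !scalerA.
Qed.
End ExteriorAlgebra.

(** * Contractions, top forms and derivations of the exterior algebra *)

Section Derivations.
Import mathcomp.boot.fintype mathcomp.boot.finset.
Variables (R : realType) (n : nat).
Implicit Types (a b c v w A B eta xi tau mu : ext R n) (S T U : {set 'I_n}) (i j : 'I_n) (r : R).

(** A basis element is, up to sign, [e_i] times a shorter one for any [i] in its index set.
    Multiplicative identities can thus be checked on generators, without signs of permutations. *)
Lemma ext_ind_gen (Q : ext R n -> Prop) :
  (forall r a b, Q a -> Q b -> Q (r *: a + b)) -> Q eone ->
  (forall i a, Q a -> Q (wedge (egen i) a)) -> forall a, Q a.
Proof.
move=> QD Q1 Qw; apply: ext_ind => // S.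
have Q0 : Q 0 by have := QD (-1) _ _ Q1 Q1; rewrite scaleN1r addNr.
have QZ r a : Q a -> Q (r *: a) by move=> Qa; rewrite -[_ *: _]addr0; apply: QD.
move: {2}#|S| (erefl #|S|) => k; elim: k S => [|k IH] S /eqP.
  by rewrite cards_eq0 => /eqP->.
move=> Sk; have /card_gt0P[i iS] : (0 < #|S|)%N by rewrite (eqP Sk).
have -> : ebase S = isgn R i (S :\ i)%SET *: wedge (egen i) (ebase (S :\ i)%SET) :> ext R n.
  by rewrite wedge_egen !inE eqxx /= scalerA isgn2 scale1r setD1K.
apply: QZ; apply: Qw; apply: IH.
by move: Sk; rewrite (cardsD1 i) iS => /eqP[].
Qed.

Lemma egen_egen i j : wedge (egen i) (egen j) = - wedge (egen j) (egen i) :> ext R n.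
Proof.
rewrite !wedge_egen !inE eq_sym setUC -scaleNr; congr (_ *: _).
have sg k l : l != k -> isgn R k [set l]%SET = (-1) ^+ (l < k)%N.
  move=> lk; have := isgnU1 R k (j := l) (S := set0).
  rewrite setU0 => ->; rewrite ?inE //.
  by rewrite /isgn eq_card0 ?mulr1 // => x; rewrite !inE.
case: eqVneq => [|ij]; first by rewrite oppr0.
rewrite !sg //; last by rewrite eq_sym.
have := ij; rewrite -val_eqE /= neq_ltn.
by case: ltngtP => //= _ _; ring.
Qed.

Lemma egen_egenA i j a :
  wedge (egen i) (wedge (egen j) a) = - wedge (egen j) (wedge (egen i) a).
Proof. by rewrite !wedgeA egen_egen wedgeNl. Qed.

#[local] Hint Extern 0 (homog _ (egen _)) => exact: homog_egen : core.
Lemma wedgeNr a b : wedge a (- b) = - wedge a b. Proof. exact: linearN. Qed.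
Lemma wedge_a0 a : wedge a 0 = 0. Proof. exact: linear0. Qed.

Lemma wedgeC1 v w : homog 1 v -> homog 1 w -> wedge v w = - wedge w v.
Proof.
move=> hv hw; rewrite (homog1E hv) (homog1E hw) !wedge_suml -sumrN.
under eq_bigr do rewrite wedge_sumr.
under [RHS]eq_bigr do rewrite wedge_sumr -sumrN.
rewrite exchange_big; apply: eq_bigr => i _; apply: eq_bigr => j _ /=.
rewrite !wedgeZl !wedgeZr egen_egen !scalerN; congr (- _); rewrite !scalerA.
by rewrite mulrC.
Qed.

Lemma wedge_vv v : homog 1 v -> wedge v v = 0.
Proof.
move=> hv; have /eqP := wedgeC1 hv hv.
rewrite -addr_eq0 -mulr2n -scaler_nat scaler_eq0 pnatr_eq0 /=.
by move/eqP.
Qed.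

Lemma wedgeC1A v w a : homog 1 v -> homog 1 w ->
  wedge v (wedge w a) = - wedge w (wedge v a).
Proof. by move=> hv hw; rewrite !wedgeA (wedgeC1 hv hw) wedgeNl. Qed.
Lemma wedge_vvA v a : homog 1 v -> wedge v (wedge v a) = 0.
Proof. by move=> hv; rewrite wedgeA wedge_vv // wedge0l. Qed.

Lemma homog_wedge p q a b : homog p a -> homog q b -> homog (p + q) (wedge a b).
Proof.
move=> ha hb U hU; rewrite wedgeE big1 // => S SU.
have [Sp|] := eqVneq #|S| p; last by move=> /ha->; rewrite mulr0 mul0r.
rewrite hb ?mulr0 //; apply: contra hU => /eqP <-; rewrite -Sp.
by rewrite -(cardsID S U) (setIidPr SU).
Qed.

Lemma iprodl_homog p q v a : homog p v -> homog (p + q) a -> homog q (iprodl v a).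
Proof.
move=> hv ha S hS; rewrite -pairing_ebaser iprodlE /pairing big1 // => T _.
have [Tc|nT] := eqVneq #|T| (p + q)%N; last by rewrite ha // mul0r.
rewrite (homog_wedge hv (@homog_ebase _ _ S)) ?mulr0 // Tc eqn_add2l eq_sym //.
Qed.

Lemma iprodl_eone v : homog 1 v -> iprodl v eone = 0.
Proof.
move=> hv; apply/ffunP => S; rewrite ext0 -pairing_ebaser iprodlE pairing_ebasel.
by apply: (homog_wedge hv (@homog_ebase _ _ S)); rewrite cards0.
Qed.

(** The degree involution; it records the sign of moving a 1-vector past an arbitrary, possibly
    inhomogeneous, element. *)
Definition grade a : ext R n := [ffun S : {set 'I_n} => ((-1) ^+ #|S| * a S : R^o)].

Lemma gradeE a S : grade a S = (-1) ^+ #|S| * a S.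
Proof. by rewrite ffunE. Qed.
Lemma gradeD a b : grade (a + b) = grade a + grade b.
Proof. by apply/ffunP => S; rewrite extD !gradeE extD mulrDr. Qed.
Lemma gradeZ r a : grade (r *: a) = r *: grade a.
Proof. by apply/ffunP => S; rewrite extZ !gradeE extZ mulrCA. Qed.
Lemma grade_homog k a : homog k a -> grade a = (-1) ^+ k *: a.
Proof.
move=> ha; apply/ffunP => S; rewrite gradeE extZ.
by have [->//|/ha->] := eqVneq #|S| k; rewrite !mulr0.
Qed.
Lemma gradeK a : grade (grade a) = a.
Proof. by apply/ffunP => S; rewrite !gradeE mulrA -expr2 sqrr_sign mul1r. Qed.
Lemma pairing_grade a b : pairing (grade a) b = pairing a (grade b).
Proof. by apply: eq_bigr => S _; rewrite !gradeE; ring. Qed.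

Lemma grade_wedge1 v a : homog 1 v -> grade (wedge v a) = - wedge v (grade a).
Proof.
move=> hv; elim/ext_ind: a => [r a b IH IH'|S].
  by rewrite !(wedgeDr, wedgeZr, gradeD, gradeZ) IH IH' opprD scalerN.
have hS := @homog_ebase R n S.
rewrite (grade_homog hS) (grade_homog (homog_wedge hv hS)) wedgeZr exprD expr1.
by rewrite mulN1r scaleNr.
Qed.

Lemma wedge_grade v a : homog 1 v -> wedge a v = wedge v (grade a).
Proof.
move=> hv; elim/ext_ind_gen: a => [r a b IH IH'||i a IH].
- by rewrite wedgeDl wedgeZl IH IH' gradeD gradeZ wedgeDr wedgeZr.
- by rewrite (grade_homog (@homog_eone _ _)) expr0 scale1r wedge1a wedgea1.
- rewrite -wedgeA IH (wedgeC1A _ (@homog_egen _ _ i) hv) grade_wedge1 //.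
  by rewrite -scaleN1r -[in RHS]scaleN1r wedgeZr.
Qed.

Lemma iprodl_wedgeA v a b : homog 1 v ->
  iprodl v (wedge a b) = wedge (iprodl v a) b + wedge (grade a) (iprodl v b).
Proof.
move=> hv; elim/ext_ind_gen: a => [r a a' IH IH'||i a IH].
- rewrite !(wedgeDl, wedgeZl, iprodlDr, iprodlZr, gradeD, gradeZ) IH IH'.
  by rewrite scalerDr addrACA.
- rewrite (grade_homog (@homog_eone _ _)) expr0 scale1r !wedge1a iprodl_eone //.
  by rewrite wedge0l add0r.
- have hi := @homog_egen R n i.
  rewrite -wedgeA !(iprodl_wedge _ hv hi) IH grade_wedge1 // wedgeDl wedgeZl !wedgeNl wedgeDr.
  by rewrite opprD addrA !wedgeA.
Qed.

Lemma iprodl_grade v a : homog 1 v -> iprodl v (grade a) = - grade (iprodl v a).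
Proof.
move=> hv; apply: pairing_injl => c; rewrite pairingC iprodlE pairing_grade grade_wedge1 //.
rewrite -scaleN1r pairingZr -iprodlE pairingC -[in RHS]scaleN1r pairingZr.
by rewrite -!pairing_grade.
Qed.

(** The two contractions differ in the side on which [v] multiplies the test element, that is by a
    degree sign; the pairing moves this sign to the result. *)
Lemma iprodr1 v a : homog 1 v -> iprodr v a = grade (iprodl v a).
Proof.
move=> hv; apply: pairing_injl => c.
by rewrite iprodrE wedge_grade // pairingC -iprodlE pairingC pairing_grade.
Qed.

Lemma top_homogE mu : homog n mu -> mu = mu setT *: ebase setT.
Proof.
move=> hmu; apply/ffunP => S; rewrite extZ ebaseE.
have [->|nS] := eqVneq S setT; first by rewrite mulr1.
rewrite mulr0 hmu //; apply: contra nS => /eqP Sn.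
by rewrite eqEcard finset.subsetT cardsT card_ord Sn leqnn.
Qed.

Lemma wedge_top v mu : homog 1 v -> homog n mu -> wedge v mu = 0.
Proof.
move=> hv hmu; apply/ffunP => S; rewrite ext0.
apply: (homog_wedge hv hmu); rewrite neq_ltn add1n ltnS.
by rewrite -[X in (_ <= X)%N]card_ord max_card.
Qed.

(** The degree of v /\ mu is too high, so mu pairs to zero with every contraction by [v]. For the
    contraction of grade A /\ c the antiderivation rule splits this zero into the two sides. *)
Lemma wedge_iprodl_top v A mu : homog 1 v -> homog n mu ->
  wedge v (iprodl A mu) = iprodl (iprodr v A) mu.
Proof.
move=> hv hmu; apply: pairing_injl => c.
rewrite -iprodlE pairingC iprodlE [RHS]pairingC iprodlE.
have := iprodl_wedgeA (grade A) c hv; rewrite gradeK iprodl_grade // -iprodr1 // wedgeNl.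
move/(congr1 (pairing mu)); rewrite pairingC iprodlE pairingC wedge_top // pairing0l.
by rewrite pairingDr -scaleN1r pairingZr mulN1r => /esym/eqP; rewrite addrC subr_eq0 => /eqP.
Qed.

(** Pairing [iprodl A mu] with the basis element of the complement of [S] isolates the coefficient
    [A S], up to a sign and the factor [mu setT]. *)
Lemma iprodl_top_inj mu A : homog n mu -> mu != 0 -> iprodl A mu = 0 -> A = 0.
Proof.
move=> hmu mu0 iA; apply/ffunP => S; rewrite ext0.
have : pairing (iprodl A mu) (ebase (~: S)%SET) = 0 by rewrite iA pairing0l.
rewrite iprodlE (top_homogE hmu) pairingZl pairing_ebasel wedgeE.
rewrite (bigD1 S) ?finset.subsetT //= big1 => [|T /andP[_ nT]]; last first.
  by rewrite ebaseE !setTD (inj_eq (@setC_inj _)) (negPf nT) mulr0.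
rewrite addr0 ebaseE setTD eqxx mulr1 => /eqP; rewrite mulf_eq0.
have -> /= : (mu setT == 0) = false.
  by apply/negP => /eqP m0; move: mu0; rewrite (top_homogE hmu) m0 scale0r eqxx.
by rewrite mulf_eq0 signr_eq0 => /eqP.
Qed.

(* The derivation of the exterior algebra with e_j |-> sum_l G j l e_l. *)
Definition dlift (G : 'M[R]_n) a : ext R n :=
  \sum_j \sum_l G j l *: wedge (egen l) (iprodl (egen j) a).

Lemma dliftD G a b : dlift G (a + b) = dlift G a + dlift G b.
Proof.
rewrite -big_split; apply: eq_bigr => j _; rewrite -big_split; apply: eq_bigr => l _ /=.
by rewrite iprodlDr wedgeDr scalerDr.
Qed.
Lemma dliftZ G r a : dlift G (r *: a) = r *: dlift G a.
Proof.
rewrite scaler_sumr; apply: eq_bigr => j _; rewrite scaler_sumr; apply: eq_bigr => l _.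
by rewrite iprodlZr wedgeZr !scalerA mulrC.
Qed.

Lemma dlift_a0 G : dlift G 0 = 0.
Proof. by have := dliftZ G 0 0; rewrite !scale0r. Qed.
Lemma dlift_sumr G (I : Type) (s : seq I) (P : pred I) (F : I -> ext R n) :
  dlift G (\sum_(x <- s | P x) F x) = \sum_(x <- s | P x) dlift G (F x).
Proof. by apply: (big_morph (dlift G)) => [x y|]; rewrite ?dlift_a0 ?dliftD. Qed.

Lemma dlift_mul G r a : dlift (r *: G) a = r *: dlift G a.
Proof.
rewrite scaler_sumr; apply: eq_bigr => j _; rewrite scaler_sumr; apply: eq_bigr => l _.
by rewrite mxE scalerA.
Qed.
Lemma dlift_add G H a : dlift (G + H) a = dlift G a + dlift H a.
Proof.
rewrite -big_split; apply: eq_bigr => j _; rewrite -big_split; apply: eq_bigr => l _ /=.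
by rewrite mxE scalerDl.
Qed.
Lemma dlift_0 a : dlift 0 a = 0.
Proof. by rewrite -(scale0r 0) dlift_mul scale0r. Qed.
Lemma dlift_sum (I : Type) (s : seq I) (P : pred I) (F : I -> 'M[R]_n) a :
  dlift (\sum_(x <- s | P x) F x) a = \sum_(x <- s | P x) dlift (F x) a.
Proof. by apply: (big_morph (fun G => dlift G a)) => [x y|]; rewrite ?dlift_0 ?dlift_add. Qed.

Lemma pairing_wedgel v a b : pairing (wedge v a) b = pairing a (iprodl v b).
Proof. by rewrite pairingC -iprodlE pairingC. Qed.

Lemma pairing_dlift G a b : pairing (dlift G a) b = pairing a (dlift G^T b).
Proof.
rewrite pairing_suml.
under eq_bigr do rewrite pairing_suml; rewrite exchange_big pairing_sumr.
apply: eq_bigr => j _; rewrite pairing_sumr; apply: eq_bigr => l _.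
by rewrite mxE pairingZr pairingZl pairing_wedgel iprodlE.
Qed.

Lemma dlift_eone G : dlift G eone = 0.
Proof.
by rewrite /dlift big1 // => j _; rewrite big1 // => l _; rewrite iprodl_eone // wedge_a0 scaler0.
Qed.

Lemma dlift_egen G j : dlift G (egen j) = \sum_l G j l *: egen l.
Proof.
have E l : iprodl (egen l) (egen j) = (l == j)%:R *: eone :> ext R n.
  by rewrite -[egen j]wedgea1 iprodl_egen_wedge iprodl_eone // wedge_a0 subr0.
rewrite /dlift (bigD1 j) //= [X in _ + X]big1 ?addr0 => [|i ij].
  by apply: eq_bigr => l _; rewrite E eqxx scale1r wedgea1.
by rewrite big1 // => l _; rewrite E (negPf ij) scale0r wedge_a0 scaler0.
Qed.

Lemma dlift_wedge G a b : dlift G (wedge a b) = wedge (dlift G a) b + wedge a (dlift G b).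
Proof.
elim/ext_ind_gen: a => [r a a' IH IH'||i a IH].
- by rewrite !(wedgeDl, wedgeZl, dliftD, dliftZ) IH IH' scalerDr addrACA.
- by rewrite dlift_eone wedge0l add0r !wedge1a.
have step c : dlift G (wedge (egen i) c) =
  wedge (dlift G (egen i)) c + wedge (egen i) (dlift G c).
  rewrite dlift_egen wedge_suml wedge_sumr /dlift.
  have -> : \sum_l wedge (G i l *: egen l) c =
     \sum_j (j == i)%:R *: \sum_l G j l *: wedge (egen l) c.
    rewrite [RHS](bigD1 i) //= eqxx scale1r [X in _ + X]big1 ?addr0 => [|j ji];
      last by rewrite (negPf ji) scale0r.
    by apply: eq_bigr => l _; rewrite wedgeZl.
  rewrite -big_split; apply: eq_bigr => j _; rewrite wedge_sumr scaler_sumr -big_split /=.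
  apply: eq_bigr => l _; rewrite iprodl_egen_wedge wedgeDr wedgeNr egen_egenA opprK.
  by rewrite scalerDr !wedgeZr !scalerA mulrC.
by rewrite -wedgeA step IH step !wedgeDl wedgeDr !wedgeA addrA.
Qed.

(** Once [e_j] is removed from the top element, only [e_j] can be multiplied back, so the diagonal
    of [G] alone contributes. *)
Lemma dlift_top G mu : homog n mu -> dlift G mu = \tr G *: mu.
Proof.
move=> hmu; rewrite (top_homogE hmu) dliftZ scalerA mulrC -scalerA; congr (_ *: _).
rewrite /dlift /mxtrace scaler_suml; apply: eq_bigr => j _.
rewrite (bigD1 j) //= big1 ?addr0 => [|l lj].
  by rewrite iprodl_egen inE wedgeZr wedge_egen !inE eqxx setD1K ?inE // isgnD1 ?inE // ltnn
    mul1r !scalerA -mulrA isgn2 mulr1.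
by rewrite iprodl_egen inE wedgeZr wedge_egen !inE lj scale0r !scaler0.
Qed.

Lemma dlift_homog G k a : homog k a -> homog k (dlift G a).
Proof.
move=> ha; apply: homog_sum => j _; apply: homog_sum => l _; apply: homogZ.
case: k ha => [|k] ha; last first.
  rewrite -add1n; apply: homog_wedge.
    exact: homog_egen.
  by apply: (@iprodl_homog 1) => //; exact: homog_egen.
have -> : a = a set0 *: eone.
  apply/ffunP => S; rewrite extZ ebaseE.
  have [->|nS] := eqVneq S set0; first by rewrite mulr1.
  by rewrite mulr0 ha // cards_eq0.
by rewrite iprodlZr iprodl_eone // scaler0 wedge_a0; exact: homog0.
Qed.

(** Pair mu with [dlift G^T] of A /\ c: the product rule gives two terms, while the adjoint acts on
    mu by the trace. This trace later cancels the one coming from the derivative of mu. *)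
Lemma iprodl_dlift_top G A mu : homog n mu ->
  iprodl (dlift G^T A) mu = \tr G *: iprodl A mu - dlift G (iprodl A mu).
Proof.
move=> hmu; apply: pairing_injl => c; rewrite !(pairingC c) pairingDl -scaleN1r !pairingZl.
rewrite pairing_dlift !iprodlE -pairingZl -dlift_top // pairing_dlift dlift_wedge pairingDr.
by rewrite mulN1r addrK.
Qed.

(** A symmetric coefficient meets the antisymmetric e_q /\ e_l. For a symmetric connection this is
    why d equals the sum of the e^q /\ nabla_q. *)
Lemma dlift_sym (G : 'I_n -> 'M[R]_n) a : (forall q l j, G q j l = G l j q) ->
  \sum_q wedge (egen q) (dlift (G q) a) = 0.
Proof.
move=> Gs; under eq_bigr do rewrite /dlift wedge_sumr; rewrite exchange_big big1 //= => j _.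
set X := (X in X = 0); suff /eqP : X = - X.
  by rewrite -addr_eq0 -mulr2n -scaler_nat scaler_eq0 pnatr_eq0 /= => /eqP.
rewrite /X; under eq_bigr do rewrite wedge_sumr; rewrite {2}exchange_big -sumrN.
apply: eq_bigr => q _; rewrite -sumrN; apply: eq_bigr => l _ /=.
by rewrite !wedgeZr egen_egenA scalerN Gs.
Qed.
End Derivations.

(** * Algebra morphisms induced by matrices *)

Section InducedMaps.
Import mathcomp.boot.fintype mathcomp.boot.finset.
Variables (R : realType) (n : nat).
Implicit Types (a b c v w A B eta xi tau mu : ext R n) (S T U : {set 'I_n}) (i j : 'I_n) (r : R).
Implicit Types (M N : 'M[R]_n) (u : 'rV[R]_n).
#[local] Hint Extern 0 (homog _ (egen _)) => exact: homog_egen : core.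

Definition rowv u : ext R n := \sum_j u 0 j *: egen j.

Lemma rowv_homog u : homog 1 (rowv u).
Proof. by apply: homog_sum => j _; apply: homogZ. Qed.
#[local] Hint Extern 0 (homog _ (rowv _)) => exact: rowv_homog : core.

Lemma sum_egen_comp (f : 'I_n -> R) j : (\sum_i f i *: egen i : ext R n) [set j]%SET = f j.
Proof.
rewrite ext_sum (bigD1 j) //= big1 => [|k kj]; rewrite extZ ebaseE.
  by rewrite eqxx mulr1 addr0.
by rewrite (inj_eq set1_inj) eq_sym (negPf kj) mulr0.
Qed.

Lemma rowv_comp u j : rowv u [set j]%SET = u 0 j.
Proof. exact: sum_egen_comp. Qed.

Lemma rowvK v : homog 1 v -> rowv (\row_j v [set j]%SET) = v.
Proof. by move=> hv; rewrite [RHS]homog1E //; apply: eq_bigr => j _; rewrite mxE. Qed.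

Lemma homog1P a b : homog 1 a -> homog 1 b -> (forall j, a [set j]%SET = b [set j]%SET) -> a = b.
Proof. by move=> ha hb h; rewrite (homog1E ha) (homog1E hb); apply: eq_bigr => j _;
  rewrite h. Qed.

Lemma pairing_rowv u w : homog 1 w -> pairing (rowv u) w = \sum_j u 0 j * w [set j]%SET.
Proof. by move=> hw; rewrite pairing_suml; apply: eq_bigr => j _;
  rewrite pairingZl pairing_ebasel. Qed.

Lemma rowvM u M : rowv (u *m M) = \sum_i u 0 i *: rowv (row i M).
Proof.
apply: homog1P => //; first by apply: homog_sum => i _; apply: homogZ.
move=> j; rewrite rowv_comp ext_sum mxE; apply: eq_bigr => i _.
by rewrite extZ rowv_comp mxE.
Qed.

(* The algebra morphism induced by e_i |-> (row i of M). *)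
Definition lmap M a : ext R n :=
  \sum_S a S *: \big[wedge/eone]_(i <- enum S) rowv (row i M).

Lemma lmapD M a b : lmap M (a + b) = lmap M a + lmap M b.
Proof. by rewrite -big_split; apply: eq_bigr => S _; rewrite extD scalerDl. Qed.
Lemma lmapZ M r a : lmap M (r *: a) = r *: lmap M a.
Proof. by rewrite scaler_sumr; apply: eq_bigr => S _; rewrite extZ scalerA. Qed.
Lemma lmap0 M : lmap M 0 = 0.
Proof. by have := lmapZ M 0 0; rewrite !scale0r. Qed.
Lemma lmapN M a : lmap M (- a) = - lmap M a.
Proof. by rewrite -scaleN1r lmapZ scaleN1r. Qed.
Lemma lmap_sum M (I : Type) (s : seq I) (P : pred I) (F : I -> ext R n) :
  lmap M (\sum_(x <- s | P x) F x) = \sum_(x <- s | P x) lmap M (F x).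
Proof. by apply: (big_morph (lmap M)) => [x y|]; rewrite ?lmap0 ?lmapD. Qed.

Lemma lmap_ebase M S : lmap M (ebase S) = \big[wedge/eone]_(i <- enum S) rowv (row i M).
Proof.
rewrite /lmap (bigD1 S) //= ebaseE eqxx scale1r [X in _ + X]big1 ?addr0 // => T TS.
by rewrite ebaseE (negPf TS) scale0r.
Qed.
Lemma lmap_eone M : lmap M eone = eone.
Proof. by rewrite lmap_ebase enum_set0 big_nil. Qed.

(** Basis elements are increasing products and [lmap] follows [enum], so a generator can be split
    off directly only when it is the least one. *)
Lemma enum_minU i S : (forall k, k \in S -> (i < k)%N) -> enum (i |: S)%SET = i :: enum S.
Proof.
move=> imin; pose r : rel 'I_n := relpre val ltn.
have rt : transitive r by move=> x y z; apply: ltn_trans.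
have rs U : sorted r (enum U).
  rewrite /enum_mem; apply: sorted_filter => //; rewrite -enumT.
  by rewrite -sorted_map val_enum_ord iota_ltn_sorted.
apply: (irr_sorted_eq rt) => // [x||x]; first exact: ltnn.
  rewrite /= path_min_sorted //; apply/allP => k; rewrite mem_enum; exact: imin.
by rewrite inE !mem_enum !inE.
Qed.

(** Multiplicativity for one generator, from which [lmap_wedge] follows by induction. As [lmap] is
    given on sorted products only, [i] is compared with the least element of [S]. *)
Lemma lmap_egen_wedge M i a : lmap M (wedge (egen i) a) = wedge (rowv (row i M)) (lmap M a).
Proof.
elim/ext_ind: a => [r a b IH IH'|S].
  by rewrite !(wedgeDr, wedgeZr, lmapD, lmapZ) IH IH'.
move: {2}#|S| (leqnn #|S|) => k; elim: k S i => [|k IH] S i.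
  rewrite leqn0 cards_eq0 => /eqP->; rewrite wedgea1 lmap_eone wedgea1 lmap_ebase.
  by rewrite enum_set1 big_seq1.
move=> Sk; have [->|[j0 j0S]] := set_0Vmem S.
  by rewrite wedgea1 lmap_eone wedgea1 lmap_ebase enum_set1 big_seq1.
pose j := [arg min_(k < j0 in S) (k : nat)].
have [jS jmin] : j \in S /\ forall k, k \in S -> (j <= k)%N by rewrite /j; case: arg_minnP.
pose S' := (S :\ j)%SET.
have S'k : (#|S'| <= k)%N by move: Sk; rewrite (cardsD1 j) jS.
have S'min l : l \in S' -> (j < l)%N.
  by rewrite !inE => /andP[lj /jmin]; rewrite leq_eqVlt eq_sym -val_eqE in lj *;
    rewrite (negPf lj).
have mn (l : 'I_n) (T : {set 'I_n}) : (forall x, x \in T -> (l < x)%N) ->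
    lmap M (wedge (egen l) (ebase T)) = wedge (rowv (row l M)) (lmap M (ebase T)).
  move=> lmin; have lT : l \notin T by apply/negP => /lmin; rewrite ltnn.
  rewrite wedge_egen (negPf lT) lmapZ !lmap_ebase enum_minU // big_cons.
  rewrite /isgn eq_card0 ?scale1r // => x; rewrite !inE.
  by apply/negP => /andP[/lmin lx xl]; have := ltn_trans lx xl; rewrite ltnn.
have eS : ebase S = wedge (egen j) (ebase S') :> ext R n.
  rewrite wedge_egen !inE eqxx /= /isgn eq_card0 ?scale1r ?setD1K // => x; rewrite !inE.
  by apply/negP => /andP[xS xj]; have := S'min x;
    rewrite !inE xS => /(_ isT) /(ltn_trans xj); rewrite ltnn.
(* A smaller [i] is already in sorted position; a larger one is swapped past [e_j], which leaves the
   shorter set [S'] for the induction; if they coincide, both sides contain a square and vanish. *)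
have [ij|ji|/val_inj ij] := ltngtP i j.
- apply: mn => x /jmin; exact: leq_trans.
- rewrite eS egen_egenA lmapN (mn j S') //.
  have -> : lmap M (wedge (egen j) (wedge (egen i) (ebase S'))) =
     wedge (rowv (row j M)) (lmap M (wedge (egen i) (ebase S'))).
    rewrite wedge_egen !(lmapZ, wedgeZr); congr (_ *: _).
    by apply: mn => x; rewrite in_setU1 => /orP[/eqP->//|]; exact: S'min.
  by rewrite IH // (wedgeC1A _ (@rowv_homog (row j M)) (@rowv_homog (row i M))) opprK.
- rewrite -ij in eS S'min *; rewrite eS wedge_vvA // lmap0 (mn _ S') //.
  by rewrite wedge_vvA.
Qed.

Lemma lmap_wedge M a b : lmap M (wedge a b) = wedge (lmap M a) (lmap M b).
Proof.
elim/ext_ind_gen: a => [r a a' IH IH'||i a IH].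
- by rewrite !(wedgeDl, wedgeZl, lmapD, lmapZ) IH IH'.
- by rewrite lmap_eone !wedge1a.
- by rewrite -wedgeA !lmap_egen_wedge IH wedgeA.
Qed.

Lemma lmap_wedge_pow M k a : lmap M (wedge_pow k a) = wedge_pow k (lmap M a).
Proof. by elim: k => [|k IH]; rewrite ?lmap_eone //= [LHS]lmap_wedge IH. Qed.

Lemma lmap_egen M i : lmap M (egen i) = rowv (row i M).
Proof. by rewrite -[egen i]wedgea1 lmap_egen_wedge lmap_eone wedgea1. Qed.

Lemma lmap_rowv M u : lmap M (rowv u) = rowv (u *m M).
Proof. by rewrite rowvM lmap_sum; apply: eq_bigr => j _; rewrite lmapZ lmap_egen. Qed.

Lemma lmap_lmap M N a : lmap M (lmap N a) = lmap (N *m M) a.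
Proof.
elim/ext_ind_gen: a => [r a a' IH IH'||i a IH].
- by rewrite !(lmapD, lmapZ) IH IH'.
- by rewrite !lmap_eone.
- by rewrite !lmap_wedge IH !lmap_egen lmap_rowv row_mul.
Qed.

Lemma rowv_egen i : rowv (delta_mx 0 i) = egen i.
Proof.
apply: homog1P => // j; rewrite rowv_comp mxE ebaseE eqxx /=.
by rewrite (inj_eq set1_inj).
Qed.

Lemma lmap1 a : lmap 1%:M a = a.
Proof.
elim/ext_ind_gen: a => [r a a' IH IH'||i a IH].
- by rewrite !(lmapD, lmapZ) IH IH'.
- by rewrite lmap_eone.
- by rewrite lmap_egen_wedge IH row1 rowv_egen.
Qed.

Lemma iprodl_lmap M u a : iprodl (rowv u) (lmap M a) = lmap M (iprodl (rowv (u *m M^T)) a).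
Proof.
elim/ext_ind_gen: a => [r a a' IH IH'||i a IH].
- by rewrite !(lmapD, lmapZ, iprodlDr, iprodlZr) IH IH'.
- by rewrite lmap_eone !iprodl_eone // lmap0.
rewrite lmap_egen_wedge !iprodl_wedge // lmapD lmapN lmap_egen_wedge IH lmapZ.
congr (_ *: _ - _); rewrite pairing_rowv // pairing_ebaser rowv_comp mxE.
by apply: eq_bigr => j _; rewrite rowv_comp !mxE.
Qed.

Lemma pairing_lmap M a b : pairing (lmap M a) b = pairing a (lmap M^T b).
Proof.
elim/ext_ind_gen: a b => [r a a' IH IH' b|b|i a IH b].
- by rewrite !(lmapD, lmapZ, pairingDl, pairingZl) IH IH'.
- rewrite lmap_eone; elim/ext_ind_gen: b => [r a a' IH IH'||i a IH].
  + by rewrite !(lmapD, lmapZ, pairingDr, pairingZr) IH IH'.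
  + by rewrite lmap_eone.
  + by rewrite lmap_egen_wedge pairingC [RHS]pairingC !pairing_wedgel !iprodl_eone // !linear0.
- by rewrite lmap_egen_wedge !pairing_wedgel IH -rowv_egen iprodl_lmap trmxK -rowE.
Qed.

Lemma homog_big_wedge (I : Type) (s : seq I) (F : I -> ext R n) :
  (forall x, homog 1 (F x)) -> homog (size s) (\big[wedge/eone]_(x <- s) F x).
Proof.
move=> h; elim: s => [|x s IH]; first by rewrite big_nil; exact: homog_eone.
by rewrite big_cons /= -add1n; apply: homog_wedge.
Qed.

Lemma lmap_homog M k a : homog k a -> homog k (lmap M a).
Proof.
move=> ha; apply: homog_sum => S _.
have [<-|nS] := eqVneq #|S| k; last by rewrite ha // scale0r; exact: homog0.
by apply: homogZ; rewrite cardE; apply: homog_big_wedge.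
Qed.

(** Vectors move by [M] and forms by the contragredient [N^T]; contraction is natural for this pair
    because the pairing is preserved. *)
Lemma lmap_iprodl M N A eta : M *m N = 1%:M ->
  lmap N^T (iprodl A eta) = iprodl (lmap M A) (lmap N^T eta).
Proof.
move=> MN; apply: pairing_injl => c; rewrite !(pairingC c).
rewrite iprodlE !pairing_lmap iprodlE !trmxK lmap_wedge.
by rewrite lmap_lmap MN lmap1.
Qed.

Lemma pairing_lmap2 M N A eta : M *m N = 1%:M ->
  pairing (lmap N^T eta) (lmap M A) = pairing eta A.
Proof. by move=> MN; rewrite pairing_lmap trmxK lmap_lmap MN lmap1. Qed.

Section Leibniz.
Variables (I : eqType).
Implicit Types (F dF : I -> ext R n) (s : seq I).
(** The Leibniz sum, in the shape used by the definition of [cder_mv]. Factors are told apart by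
    their index, whence the [uniq] hypotheses below. *)
Definition wleib F dF s :=
  \sum_(x <- s) \big[wedge/eone]_(y <- s) (if y == x then dF y else F y).

Lemma wleib_cons F dF x s : x \notin s ->
  wleib F dF (x :: s) = wedge (dF x) (\big[wedge/eone]_(y <- s) F y) + wedge (F x) (wleib F dF s).
Proof.
move=> xs; rewrite /wleib !big_cons eqxx; congr (wedge _ _ + _).
  by apply: eq_big_seq => y ys; case: eqP => // E; rewrite -E ys in xs.
rewrite wedge_sumr; apply: eq_big_seq => y ys; rewrite big_cons.
by case: eqP => // E; rewrite E ys in xs.
Qed.

Lemma dlift_big_wedge G F s : uniq s ->
  dlift G (\big[wedge/eone]_(y <- s) F y) = wleib F (fun x => dlift G (F x)) s.
Proof.
elim: s => [_|x s IH /= /andP[xs us]]; first by rewrite /wleib !big_nil dlift_eone.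
by rewrite big_cons dlift_wedge wleib_cons // IH.
Qed.

Lemma wleibD F dF dF' s : uniq s ->
  wleib F (fun x => dF x + dF' x) s = wleib F dF s + wleib F dF' s.
Proof.
elim: s => [_|x s IH /= /andP[xs us]]; first by rewrite /wleib !big_nil addr0.
by rewrite !wleib_cons // IH // wedgeDl wedgeDr addrACA.
Qed.
Lemma wleibZ r F dF s : uniq s -> wleib F (fun x => r *: dF x) s = r *: wleib F dF s.
Proof.
elim: s => [_|x s IH /= /andP[xs us]]; first by rewrite /wleib !big_nil scaler0.
by rewrite !wleib_cons // IH // wedgeZl wedgeZr scalerDr.
Qed.

Lemma wleib_sum (J : Type) (t : seq J) F (dF : J -> I -> ext R n) s : uniq s ->
  wleib F (fun x => \sum_(y <- t) dF y x) s = \sum_(y <- t) wleib F (dF y) s.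
Proof.
move=> us; elim: t => [|y t IH].
  rewrite big_nil (_ : (fun x => _) = fun x => 0 *: F x); first by rewrite wleibZ // scale0r.
  by apply/funext => x; rewrite big_nil scale0r.
rewrite big_cons -IH -wleibD //; congr (wleib _ _ _).
by apply/funext => x; rewrite big_cons.
Qed.
End Leibniz.

(** * A nondegenerate 2-form on one vector space *)

Section Nondegenerate.
Variable om : ext R n.
Hypotheses (hom2 : homog 2 om) (nd : forall v, homog 1 v -> iprodl v om = 0 -> v = 0).

Definition omx : 'M[R]_n := \matrix_(i, j) pairing om (wedge (egen i) (egen j)).

Lemma omx_antisym : omx^T = - omx.
Proof. by apply/matrixP => i j; rewrite !mxE egen_egen -scaleN1r pairingZr mulN1r. Qed.

Lemma iprodl_omx u : iprodl (rowv u) om = rowv (u *m omx).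
Proof.
apply: homog1P => // [|j]; first by apply: (@iprodl_homog _ _ 1).
rewrite -pairing_ebaser iprodlE rowv_comp mxE wedge_suml pairing_sumr.
by apply: eq_bigr => i _; rewrite wedgeZl pairingZr mxE.
Qed.

Lemma rowv0 : rowv 0 = 0.
Proof. by rewrite /rowv big1 // => i _; rewrite mxE scale0r. Qed.

Lemma omx_unit : omx \in unitmx.
Proof.
rewrite -row_free_unit -kermx_eq0; apply/eqP/row_matrixP => i; rewrite row0.
apply/rowP => j; rewrite -rowv_comp [RHS]mxE.
rewrite (nd (v := rowv (row i (kermx omx)))) ?ext0 //.
by rewrite iprodl_omx -row_mul mulmx_ker row0 rowv0.
Qed.

(** On row vectors flat is right multiplication by [omx] ([iprodl_omx]), so its inverse is right
    multiplication by [invmx omx]. *)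
Definition om_sharp a := rowv ((\row_j a [set j]%SET) *m invmx omx).

Lemma om_sharp_homog a : homog 1 (om_sharp a).
Proof. exact: rowv_homog. Qed.
#[local] Hint Extern 0 (homog _ (om_sharp _)) => exact: om_sharp_homog : core.

Lemma om_sharpK a : homog 1 a -> iprodl (om_sharp a) om = a.
Proof. by move=> ha; rewrite iprodl_omx mulmxKV ?omx_unit // rowvK. Qed.

Lemma om_sharp_uniq a v : homog 1 v -> iprodl v om = a -> v = om_sharp a.
Proof.
move=> hv va; apply/eqP; rewrite -subr_eq0; apply/eqP/nd.
  by apply: homogD => //; apply/homogN/om_sharp_homog.
have ha : homog 1 a by rewrite -va; apply: (@iprodl_homog _ _ 1).
by rewrite iprodlDl iprodlNl (om_sharpK ha) va subrr.
Qed.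

Lemma wedge_powS k : wedge_pow k.+1 om = wedge om (wedge_pow k om). Proof. by []. Qed.

Lemma wedge_pow_homog k : homog (2 * k) (wedge_pow k om).
Proof.
elim: k => [|k IH]; first by rewrite muln0; exact: homog_eone.
by rewrite wedge_powS mulnS; apply: homog_wedge.
Qed.

Lemma grade_om : grade om = om.
Proof. by rewrite (grade_homog hom2) sqrrN expr1n scale1r. Qed.

(** A 2-form is even: contraction obeys the ordinary product rule on its powers, and it commutes
    with 1-forms, so the terms are all equal. *)
Lemma iprodl_wedge_pow v k : homog 1 v ->
  iprodl v (wedge_pow k.+1 om) = k.+1%:R *: wedge (iprodl v om) (wedge_pow k om).
Proof.
move=> hv; elim: k => [|k IH].
  by rewrite wedge_powS /wedge_pow /= !wedgea1 scale1r.
rewrite wedge_powS iprodl_wedgeA // grade_om IH wedgeZr wedgeA.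
have hiv : homog 1 (iprodl v om) by apply: (@iprodl_homog _ _ 1).
rewrite (wedge_grade om hiv) grade_om -wedgeA -wedge_powS.
by rewrite -[in RHS]natr1 scalerDl scale1r addrC.
Qed.

(** For [i] outside [S], the coefficient of e_i /\ a on [i |: S] is that of [a] on [S], up to
    sign. *)
Lemma wedge_egen_inj a : (forall i, wedge (egen i) a = 0) -> forall S, S != setT -> a S = 0.
Proof.
move=> h S; rewrite -subTset => /subsetPn[i _ iS].
have : pairing (wedge (egen i) a) (ebase (i |: S)%SET) = 0 by rewrite h pairing0l.
rewrite pairing_wedgel iprodl_egen !inE eqxx /= setU1K // pairingZr pairing_ebaser.
by move/eqP; rewrite mulf_eq0 signr_eq0 => /eqP.
Qed.

(* If k is minimal with om^k = 0, contracting with v gives i(v)om /\ om^(k-1) = 0;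
   i(v)om is an arbitrary 1-form, so om^(k-1) would be a top form. *)
Lemma wedge_pow_neq0 k : (2 * k <= n)%N -> wedge_pow k om != 0.
Proof.
elim: k => [_|k IH kn].
  by apply/negP => /eqP /(congr1 (fun a : ext R n => a set0));
    rewrite ext0 ebaseE eqxx => /eqP; rewrite oner_eq0.
have /IH : (2 * k <= n)%N by apply: leq_trans kn; rewrite leq_mul2l leqnSn orbT.
apply: contra => /eqP ok; apply/eqP/ffunP => S; rewrite ext0.
have [Sk|nSk] := eqVneq #|S| (2 * k)%N; last exact: wedge_pow_homog.
apply: wedge_egen_inj => [i|]; last first.
  by apply/negP => /eqP ST; move: kn; rewrite -[n]card_ord -cardsT -ST Sk; rewrite leq_mul2l ltnn.
have := iprodl_wedge_pow k (@rowv_homog ((\row_j egen i [set j]%SET) *m invmx omx)).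
rewrite ok iprodl_omx mulmxKV ?omx_unit // rowvK // linear0 => /esym/eqP.
by rewrite scaler_eq0 pnatr_eq0 /= => /eqP.
Qed.

Lemma om_sharp_anti a b : homog 1 a -> homog 1 b ->
  pairing b (om_sharp a) = - pairing a (om_sharp b).
Proof.
move=> ha hb; rewrite -{1}(om_sharpK hb) -{2}(om_sharpK ha) !iprodlE.
by rewrite [X in pairing om X]wedgeC1 // -scaleN1r pairingZr mulN1r.
Qed.

(** Pairing the sum with b /\ a gives two equal terms, each of them [- pairing b (om_sharp a)];
    hence the factor -1/2. *)
Definition om_bivector : ext R n := - 2%:R^-1 *: \sum_i wedge (egen i) (om_sharp (egen i)).

Lemma om_bivector_homog : homog 2 om_bivector.
Proof.
apply: homogZ; apply: homog_sum => i _; rewrite -[2%N]/(1 + 1)%N.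
by apply: homog_wedge.
Qed.

Lemma pairing_sum_egen a b : homog 1 b ->
  \sum_i pairing a (egen i) * pairing b (egen i) = pairing a b.
Proof.
move=> hb; rewrite {2}(homog1E hb) pairing_sumr; apply: eq_bigr => i _.
by rewrite pairingZr mulrC [pairing b _]pairing_ebaser.
Qed.

Lemma iprodl_homog1 v w : homog 1 v -> homog 1 w -> iprodl v w = pairing v w *: eone.
Proof.
by move=> hv hw; rewrite -[w in LHS]wedgea1 iprodl_wedge // iprodl_eone // wedge_a0 subr0.
Qed.

Lemma pairing_wedge2 a b v w : homog 1 a -> homog 1 b -> homog 1 v -> homog 1 w ->
  pairing (wedge a b) (wedge v w) = pairing a v * pairing b w - pairing a w * pairing b v.
Proof.
move=> ha hb hv hw; rewrite pairing_wedgel iprodl_wedge // iprodl_homog1 // wedgeZr wedgea1.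
by rewrite pairingDr -scaleN1r !pairingZr mulN1r.
Qed.

Lemma om_bivectorE a b : homog 1 a -> homog 1 b ->
  pairing (wedge b a) om_bivector = pairing b (om_sharp a).
Proof.
move=> ha hb; rewrite /om_bivector pairingZr pairing_sumr.
have -> : \sum_i pairing (wedge b a) (wedge (egen i) (om_sharp (egen i))) =
    \sum_i - (pairing b (egen i) * pairing (om_sharp a) (egen i))
    + \sum_i pairing a (egen i) * pairing (om_sharp b) (egen i).
  rewrite -big_split; apply: eq_bigr => i _ /=.
  rewrite pairing_wedge2 // (@om_sharp_anti (egen i) a) // (@om_sharp_anti (egen i) b) //.
  by rewrite !(pairingC (om_sharp _)); ring.
rewrite sumrN !pairing_sum_egen // [pairing a _]om_sharp_anti //.
by field.
Qed.

End Nondegenerate.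
End InducedMaps.

(** * Symmetry of the Christoffel symbols *)

Section Christoffel.
Variables (R : realType) (n : nat) (V W : 'M[R]_n) (Ga dV : 'I_n -> 'M[R]_n).
Hypotheses (VW : V *m W = 1%:M) (WV : W *m V = 1%:M) (Vanti : V^T = - V).
Hypothesis parallel : forall a, \sum_q V a q *: dV q = V *m (Ga a)^T + Ga a *m V.
Hypothesis torsion0 : forall a j q, Ga a j q - Ga j a q = dV q a j.

(* The coefficients of nabla_q, obtained by lowering the first index of Ga. *)
Definition lower_christoffel q : 'M[R]_n := \sum_a W q a *: Ga a.
Local Notation G := lower_christoffel.

Lemma christoffel_lower a : Ga a = \sum_q V a q *: G q.
Proof.
under eq_bigr do rewrite scaler_sumr; rewrite exchange_big /=.
rewrite (bigD1 a) //= [X in _ + X]big1 ?addr0 => [|b ba].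
  under eq_bigr do rewrite scalerA.
  by rewrite -scaler_suml; have := congr1 (fun M : 'M[R]_n => M a a) VW;
    rewrite !mxE eqxx => ->; rewrite scale1r.
under eq_bigr do rewrite scalerA.
rewrite -scaler_suml; have := congr1 (fun M : 'M[R]_n => M a b) VW;
  rewrite !mxE eq_sym (negPf ba) => ->.
by rewrite scale0r.
Qed.

(** The hypothesis [parallel] controls [dV] along the sharp directions, the rows of [V]; these span
    because [V] is invertible, so it can be solved for each [dV r]. *)
Lemma lower_parallel r : dV r = V *m (G r)^T + G r *m V.
Proof.
have -> : dV r = \sum_a W r a *: \sum_q V a q *: dV q.
  under eq_bigr do rewrite scaler_sumr; rewrite exchange_big /=.
  rewrite (bigD1 r) //= [X in _ + X]big1 ?addr0 => [|b br].
    under eq_bigr do rewrite scalerA.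
    by rewrite -scaler_suml; have := congr1 (fun M : 'M[R]_n => M r r) WV;
      rewrite !mxE eqxx => ->; rewrite scale1r.
  under eq_bigr do rewrite scalerA.
  rewrite -scaler_suml; have := congr1 (fun M : 'M[R]_n => M r b) WV;
    rewrite !mxE eq_sym (negPf br) => ->.
  by rewrite scale0r.
rewrite /lower_christoffel raddf_sum mulmx_sumr mulmx_suml -big_split.
apply: eq_bigr => a _; rewrite parallel scalerDr /=; congr (_ + _).
  by rewrite linearZ /= -scalemxAr.
by rewrite -scalemxAl.
Qed.

Lemma Wanti : W^T = - W.
Proof.
have := congr1 trmx VW; rewrite trmx_mul trmx1 Vanti mulmxN => h.
rewrite -[W^T]mulmx1 -VW mulmxA -[W^T *m V]opprK h.
by rewrite mulNmx mul1mx.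
Qed.

(* The torsion of G with its upper index lowered is antisymmetric in two indices,
   and the hypotheses make it symmetric in another pair, so it vanishes. *)
Lemma lower_christoffel_sym q j l : G q j l = G l j q.
Proof.
pose S r : 'M[R]_n := \matrix_(p, i) (G p i r - G r i p).
(* The torsion hypothesis with [dV] replaced by its value under parallelism: the derivatives of [V]
   are gone, and a linear relation on the torsion [S] of [G] is left. *)
have VS r : V *m S r + (S r)^T *m V = 0.
  apply/matrixP => a i.
  have := torsion0 a i r; rewrite lower_parallel {1}(christoffel_lower a) (christoffel_lower i).
  rewrite !mxE !summxE.
  have E1 : (\sum_k V a k * S r k i = \sum_k (V a k *: G k) i r - \sum_k V a k * (G r)^T k i)%R.
    by rewrite -sumrB; apply: eq_bigr => k _; rewrite !mxE mulrBr.
  have E2 : (\sum_k (S r)^T a k * V k i = - \sum_k (V i k *: G k) a r - \sum_k G r a k * V k i)%R.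
    rewrite -sumrN -sumrB; apply: eq_bigr => k _; rewrite !mxE.
    have -> : V k i = - V i k by have := congr1 (fun M : 'M[R]_n => M i k) Vanti; rewrite !mxE.
    by ring.
  by rewrite E1 E2 => h; rewrite addrACA -opprD -h; ring.
pose s (c p r : 'I_n) := (W *m (S r)^T) c p.
have ss c p r : s c p r = s p c r.
  have := congr1 (fun M => W *m M *m W) (VS r).
  rewrite mulmxDr mulmxDl mulmx0 mul0mx !mulmxA WV mul1mx -[W *m _ *m V *m W]mulmxA VW mulmx1.
  move/(congr1 (fun M : 'M[R]_n => M c p)); rewrite mxE [RHS]mxE => /eqP.
  rewrite addrC addr_eq0 => /eqP; rewrite -/(s c p r) => ->.
  rewrite /s; have -> : S r *m W = - (W *m (S r)^T)^T.
    by rewrite trmx_mul trmxK Wanti mulmxN opprK.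
  by rewrite !mxE opprK.
have sa c p r : s c p r = - s c r p.
  by rewrite /s !mxE -sumrN; apply: eq_bigr => k _; rewrite !mxE; ring.
(* Alternating the two swaps, three times each, returns to the same indices with three minus
   signs. *)
have s0 c p r : s c p r = 0.
  have : s c p r = - s c p r.
    by rewrite {1}sa ss sa opprK ss sa ss.
  by move/eqP; rewrite -addr_eq0 -mulr2n -mulr_natr mulf_eq0 pnatr_eq0 orbF => /eqP.
have : S q = 0.
  apply: trmx_inj; rewrite trmx0 -[_^T]mul1mx -VW -mulmxA.
  rewrite (_ : W *m _ = 0) ?mulmx0 //; apply/matrixP => c p; rewrite [RHS]mxE; exact: s0.
move/(congr1 (fun M : 'M[R]_n => M l j)); rewrite !mxE => /eqP; rewrite subr_eq0 => /eqP.
by move=> ->.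
Qed.
End Christoffel.

Lemma dlift_tr_sum (R : realType) (n : nat) (f : 'I_n -> R) (M : 'I_n -> 'M[R]_n) (a : ext R n) :
  dlift (\sum_i f i *: M i)^T a = \sum_i f i *: dlift (M i)^T a.
Proof.
have -> : (\sum_i f i *: M i)^T = \sum_i f i *: (M i)^T.
  by apply/matrixP => r s; rewrite mxE !summxE; apply: eq_bigr => i _; rewrite !mxE.
by rewrite dlift_sum; apply: eq_bigr => i _; rewrite dlift_mul.
Qed.

Section Degree2.
Import mathcomp.boot.fintype mathcomp.boot.finset.
Variables (R : realType) (n : nat).
Lemma homog2P (B B' : ext R n) : homog 2 B -> homog 2 B' ->
  (forall i j, pairing (wedge (egen i) (egen j)) B = pairing (wedge (egen i) (egen j)) B') ->
    B = B'.
Proof.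
move=> hB hB' h; apply/ffunP => S.
have [S2|nS] := eqVneq #|S| 2%N; last by rewrite (hB S nS) (hB' S nS).
move: S2 => /eqP/cards2P[i [j [ij ->]]].
have /eqP := h i j; rewrite !wedge_egen inE (negPf ij) !pairingZl !pairing_ebasel.
by rewrite -subr_eq0 -mulrBr mulf_eq0 signr_eq0 subr_eq0 => /eqP.
Qed.

Lemma dlift_wedge2 G i j (B : ext R n) :
  pairing (dlift G (wedge (egen i) (egen j))) B =
  \sum_l (G i l * pairing (wedge (egen l) (egen j)) B +
    G j l * pairing (wedge (egen i) (egen l)) B).
Proof.
rewrite dlift_wedge !dlift_egen wedge_suml wedge_sumr -big_split pairing_suml.
by apply: eq_bigr => l _; rewrite /= wedgeZl wedgeZr pairingDl !pairingZl.
Qed.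
End Degree2.

(** * A nondegenerate 2-form under a change of basis *)

Section ChangeOfBasis.
Variables (R : realType) (n : nat) (om B : ext R n) (T T' : 'M[R]_n).
Hypotheses (hom2 : homog 2 om) (nd : forall v, homog 1 v -> iprodl v om = 0 -> v = 0).
Hypotheses (TT : T *m T' = 1%:M) (TT' : T' *m T = 1%:M).

Lemma lmap_cancel a : lmap T' (lmap T a) = a.
Proof. by rewrite lmap_lmap TT lmap1. Qed.
Lemma lmap_trcancel a : lmap T^T (lmap T'^T a) = a.
Proof. by rewrite lmap_lmap -trmx_mul TT trmx1 lmap1. Qed.
Lemma lmap_trcancel' a : lmap T'^T (lmap T^T a) = a.
Proof. by rewrite lmap_lmap -trmx_mul TT' trmx1 lmap1. Qed.

Lemma lmap_nondegenerate v : homog 1 v -> iprodl v (lmap T^T om) = 0 -> v = 0.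
Proof.
move=> hv iv; have := lmap_iprodl (lmap T v) om TT'; rewrite lmap_cancel iv.
move/(congr1 (lmap T'^T)); rewrite lmap0 lmap_trcancel' => /nd.
by move=> /(_ (lmap_homog _ hv)) Tv; rewrite -[v]lmap_cancel Tv lmap0.
Qed.

Lemma om_sharp_lmap b : homog 1 b ->
  lmap T' (om_sharp om b) = om_sharp (lmap T^T om) (lmap T^T b).
Proof.
move=> hb; apply: (om_sharp_uniq (lmap_homog _ hom2) lmap_nondegenerate).
  exact/lmap_homog/om_sharp_homog.
by rewrite -lmap_iprodl // om_sharpK.
Qed.

Hypothesis B_spec : forall a b, homog 1 a -> homog 1 b ->
  pairing (wedge b a) B = pairing b (om_sharp om a).

Lemma bivector_lmap a b : homog 1 a -> homog 1 b ->
  pairing (wedge b a) (lmap T' B) = pairing b (om_sharp (lmap T^T om) a).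
Proof.
move=> ha hb; rewrite -[lmap T' B]/(lmap T' B) -[T']trmxK -pairing_lmap lmap_wedge.
rewrite B_spec; try exact: lmap_homog.
rewrite pairing_lmap trmxK om_sharp_lmap; last exact: lmap_homog.
by rewrite lmap_trcancel.
Qed.
End ChangeOfBasis.

(** * Differentiation of multilinear expressions *)

Section ScalarDerive.
Variables (R : realType) (V : normedModType R) (u0 v : V).
Implicit Types (f g : V -> R).

Lemma is_derive_bigsum (I : Type) (s : seq I) (P : pred I) (F : I -> V -> R) dF :
  (forall x, P x -> is_derive u0 v (F x) (dF x)) ->
  is_derive u0 v (fun u => \sum_(x <- s | P x) F x u) (\sum_(x <- s | P x) dF x).
Proof.
move=> h; elim: s => [|x s IH].
  rewrite big_nil (_ : (fun u => _) = cst 0); first exact: is_derive_cst.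
  by apply/funext => u; rewrite big_nil.
rewrite big_cons (_ : (fun u => _) = if P x then F x + (fun u => \sum_(x <- s | P x) F x u)
   else (fun u => \sum_(x <- s | P x) F x u)); last first.
  by apply/funext => u; rewrite big_cons; case: ifP.
by case: ifP => // Px; apply: is_deriveD; exact: h.
Qed.

Lemma is_derive_mul f g df dg : is_derive u0 v f df -> is_derive u0 v g dg ->
  is_derive u0 v (fun u => f u * g u) (df * g u0 + f u0 * dg).
Proof.
move=> hf hg; apply: (is_derive_eq (is_deriveM hf hg)).
by rewrite /GRing.scale /= addrC [df * _]mulrC.
Qed.

Lemma is_derive_scal (r : R) f df : is_derive u0 v f df -> is_derive u0 v (fun u =>
  r * f u) (r * df).
Proof. by move=> hf; apply: is_deriveZ. Qed.

Lemma derivable_bigprod (I : Type) (s : seq I) (F : I -> V -> R) :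
  (forall x, derivable (F x) u0 v) -> derivable (fun u => \prod_(x <- s) F x u) u0 v.
Proof.
move=> h; elim: s => [|x s IH].
  rewrite (_ : (fun u => _) = cst 1); first exact: derivable_cst.
  by apply/funext => u; rewrite big_nil.
rewrite (_ : (fun u => _) = F x * (fun u => \prod_(x <- s) F x u)); first exact: derivableM.
by apply/funext => u; rewrite big_cons.
Qed.

Lemma derivable_bigsum (I : Type) (s : seq I) (F : I -> V -> R) :
  (forall x, derivable (F x) u0 v) -> derivable (fun u => \sum_(x <- s) F x u) u0 v.
Proof.
move=> h; have /(_ s) := @is_derive_bigsum I _ xpredT F (fun x => 'D_v (F x) u0).
by case=> // x _; exact: derivableP.
Qed.

Lemma derivable_det n (M : V -> 'M[R]_n) :
  (forall i j, derivable (fun u => M u i j) u0 v) -> derivable (fun u => \det (M u)) u0 v.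
Proof.
move=> h; apply: derivable_bigsum => s; apply: derivableM; first exact: derivable_cst.
exact: derivable_bigprod.
Qed.

(** By the cofactor formula. [invmx] returns a singular matrix unchanged, so the formula is
    available only where [M u] is invertible, and this has to be a neighbourhood of [u0]. *)
Lemma derivable_invmx n (M : V -> 'M[R]_n) : M u0 \in unitmx ->
  (forall i j, derivable (fun u => M u i j) u0 v) ->
  (\forall u \near u0, M u \in unitmx) ->
  forall i j, derivable (fun u => invmx (M u) i j) u0 v.
Proof.
move=> M0 h nM i j.
apply: (@near_eq_derivable _ _ _ (fun u => (\det (M u))^-1 * (\adj (M u)) i j)).
  by apply: filterS nM => u Mu; rewrite /invmx Mu [RHS]mxE.
apply: derivableM.
  by apply: derivableV; [move: M0; rewrite unitmxE unitfE|exact: derivable_det].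
rewrite (_ : (fun u => _) = (fun u => (-1) ^+ (j + i) * \det (row' j (col' i (M u)))));
  last first.
  by apply/funext => u; rewrite mxE.
apply: derivableM; first exact: derivable_cst.
apply: derivable_det => k l.
rewrite (_ : (fun u => _) = fun u => M u (lift j k) (lift i l)); first exact: h.
by apply/funext => u; rewrite !mxE.
Qed.
End ScalarDerive.

Section ExtDerive.
Variables (R : realType) (V : normedModType R) (n : nat) (u0 v : V).
Implicit Types (F G : V -> ext R n) (dF dG : ext R n).

Definition ext_derive F dF := forall S, is_derive u0 v (fun u => F u S : R) (dF S).

Lemma ext_derive_near F G dF : (\forall u \near u0, F u = G u) -> ext_derive F dF ->
  ext_derive G dF.
Proof.
move=> FG h S; apply: near_eq_is_derive (h S).
by apply: filterS FG => u ->.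
Qed.

Lemma ext_derive_cst a : ext_derive (fun _ => a) 0.
Proof. by move=> S; rewrite ext0; exact: is_derive_cst. Qed.

Lemma ext_deriveZ (r : R) F dF : ext_derive F dF -> ext_derive (fun u => r *: F u) (r *: dF).
Proof.
move=> hF S; rewrite extZ (_ : (fun u => _) = fun u => r * F u S); first exact: is_derive_scal.
by apply/funext => u; rewrite extZ.
Qed.

Lemma ext_derive_sum (I : Type) (s : seq I) (F : I -> V -> ext R n) (dF : I -> ext R n) :
  (forall x, ext_derive (F x) (dF x)) -> ext_derive (fun u =>
    \sum_(x <- s) F x u) (\sum_(x <- s) dF x).
Proof.
move=> h S; rewrite ext_sum (_ : (fun u => _) = fun u => \sum_(x <- s) (F x u S : R)).
  by apply: is_derive_bigsum => x _; exact: h.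
by apply/funext => u; rewrite ext_sum.
Qed.

Lemma is_derive_pairing F G dF dG : ext_derive F dF -> ext_derive G dG ->
  is_derive u0 v (fun u => pairing (F u) (G u)) (pairing dF (G u0) + pairing (F u0) dG).
Proof.
move=> hF hG; rewrite /pairing -big_split /=.
apply: (@is_derive_bigsum _ _ _ _ _ _ xpredT (fun S u => F u S * G u S)) => S _.
by apply: is_derive_mul; [exact: hF|exact: hG].
Qed.

Lemma ext_derive_wedge F G dF dG : ext_derive F dF -> ext_derive G dG ->
  ext_derive (fun u => wedge (F u) (G u)) (wedge dF (G u0) + wedge (F u0) dG).
Proof.
move=> hF hG U; rewrite extD !wedgeE -big_split /=.
rewrite (_ : (fun u => _) = fun u => \sum_(S : {set 'I_n} | S \subset U)
  (wsign S (U :\: S)%SET * F u S * G u (U :\: S)%SET : R)); last first.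
  by apply/funext => u; rewrite wedgeE.
apply: is_derive_bigsum => S _; apply: is_derive_mul (hG _).
by apply: is_derive_scal; exact: hF.
Qed.

Lemma ext_derive_iprodl F G dF dG : ext_derive F dF -> ext_derive G dG ->
  ext_derive (fun u => iprodl (F u) (G u)) (iprodl dF (G u0) + iprodl (F u0) dG).
Proof.
move=> hF hG S; rewrite (_ : (fun u => _) = fun u => pairing (G u) (wedge (F u) (ebase S))).
  apply: (is_derive_eq (is_derive_pairing hG (ext_derive_wedge hF (ext_derive_cst (ebase S))))).
  by rewrite linear0 addr0 -!iprodlE !pairing_ebaser extD addrC.
by apply/funext => u; rewrite -iprodlE pairing_ebaser.
Qed.

Lemma ext_derive_big_wedge (I : eqType) (s : seq I) (F : I -> V -> ext R n) (dF : I ->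
  ext R n) : uniq s ->
  (forall x, ext_derive (F x) (dF x)) ->
  ext_derive (fun u => \big[wedge/eone]_(x <- s) F x u) (wleib (fun x => F x u0) dF s).
Proof.
move=> us h; elim: s us => [_|x s IH /= /andP[xs us]].
  rewrite /wleib big_nil (_ : (fun u => _) = fun _ => eone); first exact: ext_derive_cst.
  by apply/funext => u; rewrite big_nil.
rewrite wleib_cons // (_ : (fun u => _) = fun u =>
  wedge (F x u) (\big[wedge/eone]_(x <- s) F x u)).
  by apply: ext_derive_wedge => //; exact: IH.
by apply/funext => u; rewrite big_cons.
Qed.

(** The derivative and [dlift G] obey the same product rule. In this way mu inherits parallelism
    from omega. *)
Lemma ext_derive_wedge_pow F (G : 'M[R]_n) k : ext_derive F (dlift G (F u0)) ->
  ext_derive (fun u => wedge_pow k (F u)) (dlift G (wedge_pow k (F u0))).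
Proof.
move=> hF; elim: k => [|k IH]; first by rewrite dlift_eone; exact: ext_derive_cst.
by rewrite [wedge_pow _ _]wedge_powS dlift_wedge; exact: ext_derive_wedge.
Qed.

Lemma ext_derive_homog F dF k : ext_derive F dF -> (\forall u \near u0, homog k (F u)) ->
  homog k dF.
Proof.
move=> hF Fk S nS; case: (hF S) => _ <-.
rewrite (@near_eq_derive _ _ _ _ (cst 0)); first exact: derive_cst.
by apply: filterS Fk => u Fu; exact: Fu.
Qed.

Lemma ext_derive_rowv (w : V -> 'rV[R]_n) (dw : 'rV[R]_n) :
  (forall j, is_derive u0 v (fun u => w u 0 j) (dw 0 j)) ->
  ext_derive (fun u => rowv (w u)) (rowv dw).
Proof.
move=> h; apply: (@ext_derive_sum _ _ (fun j u => w u 0 j *: egen j) (fun j =>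
  dw 0 j *: egen j)) => j S.
rewrite extZ mulrC (_ : (fun u => _) = fun u => egen j S * w u 0 j); first exact: is_derive_scal.
by apply/funext => u; rewrite extZ mulrC.
Qed.
End ExtDerive.

Local Open Scope classical_set_scope.
Local Open Scope ring_scope.

(** * Smooth functions and bump functions *)

(** The difference [d] vanishes near [u], so the zero map satisfies the expansion that characterizes
    a differential of [d]; by uniqueness it is the differential. *)
Lemma near_eq_differentiable (R : realType) (V W : normedModType R) (f g : V -> W) u :
  (\forall v \near u, f v = g v) -> differentiable f u -> differentiable g u.
Proof.
move=> fg df; have -> : g = f + (g - f) by rewrite addrC subrK.
apply: differentiableD => //; set d := g - f.
have d0 : \forall v \near u, d v = 0.
  by apply: filterS fg => v fgv; rewrite /d !fctE fgv subrr.
have du : d u = 0 := nbhs_singleton d0.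
have d1 : \forall h \near (0 : V), d (h + u) = 0.
  by move: d0; rewrite (near_shift 0) /= subr0.
have E : d \o shift u = cst (d u) + (\0 : {linear V -> W}) +o_ (0 : V) id.
  apply/eqaddoP => e e0; near=> h.
  have dh : d (h + u) = 0 by near: h.
  rewrite [X in `|X|](_ : _ = d (h + u) - (d u + 0)) //.
  by rewrite dh du addr0 subrr normr0 mulr_ge0 // ltW.
have c0 : continuous (\0 : {linear V -> W}) by move=> x; exact: cst_continuous.
have D0 := diff_unique c0 E.
by apply/diff_locallyP; rewrite D0.
Unshelve. all: by end_near. Qed.

Section Ck.
Variables (R : realType) (n : nat).
Implicit Types (f g : 'rV[R]_n -> R) (u : 'rV[R]_n) (V : set 'rV[R]_n).

(** Every clause of [Ck] concerns one point of [V] at a time. Together with [Ck_near] this makes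
    smoothness a property of germs, as gluing over covers demands. *)
Lemma CkP k V f : Ck k V f <-> forall u, V u -> Ck k [set u] f.
Proof.
elim: k f => [|k IH] f /=; first by split=> h u Vu; [move=> _ ->; exact: h|exact: (h u)].
split=> [[h1 h2] u Vu|h].
  split=> [_ ->|i]; first exact: h1.
  by have /IH := h2 i; exact.
split=> [u Vu|i]; first by case: (h u Vu) => + _; exact.
by apply/IH => u /h[_].
Qed.

Lemma Ck_near k u f g : (\forall v \near u, f v = g v) -> Ck k [set u] f -> Ck k [set u] g.
Proof.
elim: k f g => [|k IH] f g fg /=.
  move=> fc _ ->; have {}fc : f @ u --> f u := fc u erefl.
  rewrite [f u](nbhs_singleton fg) in fc; apply: cvg_trans fc.
  exact: (@near_eq_cvg _ _ (nbhs u) _ f g fg).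
move=> [h1 h2]; split=> [_ ->|i]; first by apply: near_eq_differentiable fg _; exact: h1.
(* A partial derivative at [v] sees a neighbourhood of [v], so the equality is first spread to
   neighbourhoods of all nearby points. *)
apply: IH (h2 i); have := near_join fg; apply: filterS => v fgv.
exact: near_eq_derive.
Qed.

Lemma Ck_ext k V f g : open V -> (forall u, V u -> f u = g u) -> Ck k V f -> Ck k V g.
Proof.
move=> oV fg /CkP h; apply/CkP => u Vu; apply: Ck_near (h u Vu).
by apply: filterS (open_nbhs_nbhs (conj oV Vu)).
Qed.

Lemma CkS k V f : Ck k.+1 V f -> Ck k V f.
Proof.
elim: k f => [|k IH] f; last by move=> [h1 h2]; split=> // i; apply: IH.
by move=> [h _] u /h; apply: differentiable_continuous.
Qed.

Lemma Ck_sub k V V' f : V `<=` V' -> Ck k V' f -> Ck k V f.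
Proof. by move=> VV' /CkP h; apply/CkP => u /VV'; exact: h. Qed.

Lemma Ck_cst k V (r : R) : Ck k V (fun _ => r).
Proof.
elim: k V r => [|k IH] V r /=; first by move=> u _; exact: cst_continuous.
split=> [u _|i]; first exact: differentiable_cst.
have -> : 'D_(delta_mx 0 i) (fun=> r) = fun _ : 'rV[R]_n => 0 by apply/funext => u;
  exact: derive_cst.
exact: IH.
Qed.

Lemma CkD k V f g : open V -> Ck k V f -> Ck k V g -> Ck k V (fun u => f u + g u).
Proof.
move=> oV; elim: k f g => [|k IH] f g /=.
  by move=> hf hg u Vu; apply: continuousD; [exact: hf|exact: hg].
move=> [df hf] [dg hg]; split=> [u Vu|i]; first by apply: differentiableD; [exact: df|exact: dg].
apply: Ck_ext oV _ (IH _ _ (hf i) (hg i)) => u Vu.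
by rewrite deriveD //; apply: diff_derivable; [exact: df|exact: dg].
Qed.

Lemma CkM k V f g : open V -> Ck k V f -> Ck k V g -> Ck k V (fun u => f u * g u).
Proof.
move=> oV; elim: k f g => [|k IH] f g /=.
  by move=> hf hg u Vu; apply: continuousM; [exact: hf|exact: hg].
move=> [df hf] [dg hg]; split=> [u Vu|i]; first by apply: differentiableM; [exact: df|exact: dg].
have cf : Ck k V f by apply: CkS; split.
have cg : Ck k V g by apply: CkS; split.
apply: Ck_ext oV _ (CkD oV (IH _ _ cf (hg i)) (IH _ _ cg (hf i))) => u Vu.
by rewrite deriveM //; apply: diff_derivable; [exact: df|exact: dg].
Qed.

Lemma Ck_sum k V (I : Type) (s : seq I) (F : I -> 'rV[R]_n -> R) : open V ->
  (forall x, Ck k V (F x)) -> Ck k V (fun u => \sum_(x <- s) F x u).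
Proof.
move=> oV h; elim: s => [|x s IH].
  by rewrite (_ : (fun u => _) = fun=> 0); [exact: Ck_cst|apply/funext => u; rewrite big_nil].
rewrite (_ : (fun u => _) = fun u => F x u + \sum_(x <- s) F x u); first exact: CkD.
by apply/funext => u; rewrite big_cons.
Qed.

Lemma CkV k V f : open V -> (forall u, V u -> f u != 0) -> Ck k V f -> Ck k V (fun u => (f u)^-1).
Proof.
move=> oV f0; elim: k => [|k IH] hf.
  by move=> u Vu; apply: continuousV; [exact: f0|exact: hf].
have cf := IH (CkS hf); move: hf => [df hf]; split=> [u Vu|i].
  by apply: differentiableV; [exact: df|exact: f0].
apply: Ck_ext oV _ (CkM oV (Ck_cst k V (-1)) (CkM oV (CkM oV cf cf) (hf i))) => u Vu.
rewrite deriveV; [|exact: f0|by apply/diff_derivable/df].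
by rewrite -invfM -expr2 scaleNr mulN1r.
Qed.

Lemma Ck_coord k V i : Ck k V (fun u => u 0 i).
Proof.
case: k => [|k] /=; first by move=> u _; exact: coord_continuous.
split=> [u _|j]; first exact: differentiable_coord.
have -> : 'D_(delta_mx 0 j) (fun u => u 0 i) = fun _ : 'rV[R]_n => (delta_mx 0 j : 'rV[R]_n) 0 i.
  apply/funext => u.
  have dj : derivable id u (delta_mx 0 j : 'rV[R]_n) by exact: derivable_id.
  have := derive_mx dj; rewrite derive_id.
  by move=> /(congr1 (fun w : 'rV[R]_n => w 0 i)); rewrite !mxE => ->.
exact: Ck_cst.
Qed.

Lemma differentiable_rV m (G : 'rV[R]_n -> 'rV[R]_m) u :
  (forall j, differentiable (fun v => G v 0 j) u) -> differentiable G u.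
Proof.
move=> h; rewrite (_ : G = \sum_(j < m) (fun v => G v 0 j *: delta_mx 0 j)); last first.
  by apply/funext => v; rewrite fct_sumE [LHS]row_sum_delta.
by apply: differentiable_sum => j; apply: differentiableZl.
Qed.
End Ck.

Section Comp.
Variables (R : realType) (n m : nat).
Implicit Types (V : set 'rV[R]_n) (W : set 'rV[R]_m) (f : 'rV[R]_m -> R) (G : 'rV[R]_n ->
  'rV[R]_m).

Lemma derive_comp_rV f G u v : differentiable f (G u) ->
  (forall j, differentiable (fun v => G v 0 j) u) ->
  'D_v (fun x => f (G x)) u = \sum_(j < m) 'D_(delta_mx 0 j) f (G u) * 'D_v (fun x => G x 0 j) u.
Proof.
move=> df dG; have dG' := differentiable_rV dG.
rewrite (_ : (fun x => f (G x)) = f \o G) // deriveE; last exact: differentiable_comp.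
rewrite diff_comp //= -(deriveE v dG') derive_mx; last exact: diff_derivable.
set w := \matrix_(_, _) _; rewrite (row_sum_delta w) linear_sum; apply: eq_bigr => j _.
by rewrite linearZ /= -deriveE // mulrC mxE.
Qed.

(** [G] is taken one order smoother than the conclusion: at order 0 its continuity as a
    vector-valued map is then read off from differentiable components. *)
Lemma Ck_comp k V W f G : open V -> (forall u, V u -> W (G u)) ->
  Ck k W f -> (forall j, Ck k.+1 V (fun u => G u 0 j)) -> Ck k V (fun u => f (G u)).
Proof.
move=> oV VW; elim: k f => [|k IH] f.
  move=> hf hG u Vu; apply: (@continuous_comp _ _ _ G f); last exact/hf/VW.
  by apply/differentiable_continuous/differentiable_rV => j; case: (hG j) => + _; exact.
move=> [df hf] hG; have dG u j : V u -> differentiable (fun u => G u 0 j) u.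
  by move=> Vu; case: (hG j) => + _; exact.
split=> [u Vu|i].
  apply: (@differentiable_comp _ _ _ _ G f); last exact/df/VW.
  by apply: differentiable_rV => j; exact: dG.
apply: (Ck_ext oV _ (Ck_sum _ oV (F := fun j u => 'D_(delta_mx 0 j) f (G u) *
    'D_(delta_mx 0 i) (fun x => G x 0 j) u) _)).
  by move=> u Vu; rewrite derive_comp_rV // => [|j]; [exact/df/VW|exact: dG].
move=> j; apply: CkM => //; last by apply: CkS; case: (hG j) => _; exact.
exact: (IH _ (hf j) (fun l => CkS (hG l))).
Qed.
End Comp.

(** * Functions flat at the origin *)

Section Flat.
Variable R : realType.
Implicit Types (p : {poly R}) (x y t h : R).

(** The polynomial factor makes the family stable under differentiation, so a single induction gives
    smoothness of every member; the classical exp(-1/x) is the case [p = 1]. *)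
Definition flatexp p x : R := if 0 < x then p.[x^-1] * expR (- x^-1) else 0.

Lemma horner_le p t : 1 <= t -> `|p.[t]| <= (\sum_(i < size p) `|p`_i|) * t ^+ size p.
Proof.
move=> t1; rewrite horner_coef; apply: le_trans (ler_norm_sum _ _ _) _.
rewrite mulr_suml; apply: ler_sum => i _; rewrite normrM ler_wpM2l //.
by rewrite ger0_norm ?exprn_ge0 ?(le_trans ler01) // ler_weXn2l // ltnW.
Qed.

(** A quadratic bound yields derivative 0 at the origin. With t = 1/x, exp t dominates t^N / N!;
    taking [N] two above the growth exponent [size p] of [horner_le] leaves x^2. The [+ 1] keeps the
    constant positive when [p = 0]. *)
Lemma flatexp_le p : exists2 C, 0 < C & forall x, x < 1 -> `|flatexp p x| <= C * x ^+ 2.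
Proof.
pose N := (size p).+2; pose S := \sum_(i < size p) `|p`_i|.
have S0 : 0 <= S by apply: sumr_ge0.
have N0 : 0 < N`!%:R :> R by rewrite ltr0n fact_gt0.
exists (S * N`!%:R + 1) => [|x x1]; first by rewrite ltr_wpDl // mulr_ge0 // ltW.
rewrite /flatexp; case: ifPn => x0; last first.
  by rewrite normr0 mulr_ge0 ?sqr_ge0 // addr_ge0 // mulr_ge0 // ltW.
set t := x^-1; have t0 : 0 < t by rewrite invr_gt0.
have t1 : 1 <= t by rewrite -invr1 lef_pV2 ?posrE // ltW.
rewrite normrM (ger0_norm (expR_ge0 _)) expRN.
have e1 : t ^+ N / N`!%:R <= expR t.
  by have := expR_ge1Dxn (size p).+1 (ltW t0); apply: le_trans; rewrite lerDr.
have e2 : (expR t)^-1 <= N`!%:R * x ^+ N.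
  have -> : N`!%:R * x ^+ N = (t ^+ N / N`!%:R)^-1.
    by rewrite invfM invrK mulrC /t exprVn invrK.
  by rewrite lef_pV2 // posrE ?expR_gt0 // divr_gt0 // exprn_gt0.
apply: le_trans (ler_pM _ _ (horner_le p t1) e2) _ => [||]; rewrite ?invr_ge0 ?expR_ge0 //.
rewrite -/S [leLHS](_ : _ = S * N`!%:R * x ^+ 2); last first.
  have -> : x ^+ N = x ^+ size p * x ^+ 2 by rewrite -exprD addn2.
  have := expf_neq0 (size p) (lt0r_neq0 x0); rewrite /t exprVn.
  by move: (x ^+ size p) => y y0; field.
by rewrite ler_wpM2r ?sqr_ge0 // lerDl.
Qed.

(* The derivative of p(1/x) exp(-1/x) is (flatstep p)(1/x) exp(-1/x). *)
Definition flatstep p := 'X^2 * (p - p^`()).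

Lemma is_derive_sqr_bound (f : R -> R) C : f 0 = 0 -> (\forall h \near 0, `|f h| <= C * h ^+ 2) ->
  is_derive (0 : R) 1 f 0.
Proof.
move=> f0 fC.
have cv : h^-1 *: ((f \o shift 0) (h *: 1) - f 0) @[h --> 0^'] --> (0 : R).
  apply/cvgrPdist_le => e e0; near=> h.
  rewrite /= addr0 f0 subr0 sub0r normrN normrM.
  have h0 : h != 0 by near: h; exact: nbhs_dnbhs_neq.
  have fh : `|f h| <= C * h ^+ 2 by near: h; exact: (nbhs_dnbhs fC).
  rewrite [_ *: 1]mulr1 normfV ler_pdivrMl ?normr_gt0 //; apply: le_trans fh _.
  have he : `|h| <= e / (`|C| + 1).
    by near: h; apply: dnbhs0_le; rewrite divr_gt0 // ltr_wpDl.
  rewrite -[h ^+ 2]real_normK ?num_real // expr2 mulrCA ler_wpM2l //.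
  move: he; rewrite ler_pdivlMr ?ltr_wpDl // => /(le_trans _); apply.
  rewrite mulrC ler_wpM2l //; apply: le_trans (ler_norm C) _; by rewrite lerDl.
split; last exact: cvg_lim.
by apply/cvg_ex; exists 0.
Unshelve. all: by end_near. Qed.

Lemma is_derive_flatexp p x : is_derive x 1 (flatexp p) (flatexp (flatstep p) x).
Proof.
have [x0|x0|->] := ltgtP x 0.
- rewrite [flatexp _ x]/flatexp ltNge ltW //=.
  apply: (near_eq_is_derive (f := cst 0)).
  near=> y; rewrite /flatexp ifF //; apply/negbTE; rewrite -leNgt ltW //.
  by near: y; exact: lt_nbhsl.
- pose f1 := fun y : R => y^-1.
  have d1 : is_derive x 1 f1 (- x ^- 2 *: 1) by apply: is_deriveV; rewrite ?gt_eqF.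
  have d2 : is_derive x 1 (horner p \o f1) (p^`().[x^-1] * (- x ^- 2 *: 1)).
    exact: is_derive1_comp.
  have d3 : is_derive x 1 (expR \o (- f1)) (expR (- x^-1) * (- (- x ^- 2 *: 1))).
    by apply: is_derive1_comp.
  have d4 := is_deriveM d2 d3.
  apply: (near_eq_is_derive (f := (horner p \o f1) * (expR \o (- f1)))).
    near=> y; rewrite /flatexp ifT //.
    by near: y; exact: lt_nbhsr.
  apply: (is_derive_eq d4).
  rewrite /flatexp x0 /= /flatstep !hornerE /= -exprVn /GRing.scale /=.
  by rewrite /f1 !fctE; ring.
rewrite [flatexp _ 0]/flatexp ltxx.
have [C C0 hC] := flatexp_le p.
apply: (@is_derive_sqr_bound _ C); first by rewrite /flatexp ltxx.
by near=> h; apply: hC; near: h; exact: lt_nbhsl.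
Unshelve. all: by end_near. Qed.

Lemma flatexp_gt0 x : (0 < flatexp 1 x) = (0 < x).
Proof. by rewrite /flatexp; case: ifP => //; rewrite ?ltxx // hornerC mul1r expR_gt0. Qed.
Lemma flatexp_ge0 x : 0 <= flatexp 1 x.
Proof. by rewrite /flatexp; case: ifP => // _; rewrite hornerC mul1r expR_ge0. Qed.
Lemma flatexp_le0 x : x <= 0 -> flatexp 1 x = 0.
Proof. by rewrite /flatexp ltNge => ->. Qed.
End Flat.

Lemma Ck_flatexp (R : realType) n (p : {poly R}) k (V : set 'rV[R]_n) (f : 'rV[R]_n -> R) :
  open V -> Ck k V f -> Ck k V (fun u => flatexp p (f u)).
Proof.
move=> oV; elim: k p f => [|k IH] p f /=.
  move=> hf u Vu; apply: (@continuous_comp _ _ _ f (flatexp p)); first exact: hf.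
  apply/differentiable_continuous/derivable1_diffP.
  by case: (is_derive_flatexp p (f u)).
move=> [df hf].
have dg y : differentiable (flatexp p) y.
  by apply/derivable1_diffP; case: (is_derive_flatexp p y).
split=> [u Vu|i].
  by apply: (@differentiable_comp _ _ _ _ f (flatexp p)) => //; exact: df.
have cf : Ck k V f by apply: CkS; split.
apply: (Ck_ext oV _ (CkM oV (IH (flatstep p) _ cf) (hf i))) => u Vu.
rewrite [RHS]deriveE; last by apply: (@differentiable_comp _ _ _ _ f (flatexp p)) => //;
  exact: df.
rewrite (@diff_comp _ _ _ _ f (flatexp p)) //; last exact: df.
rewrite /= -(deriveE _ (df u Vu)).
set w := 'D_ _ _ _.
rewrite -[w in RHS]mulr1 -[w * 1]/(w *: (1 : R)) linearZ /= -deriveE //.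
case: (is_derive_flatexp p (f u)) => _ ->; by rewrite mulrC.
Qed.

Section Bump.
Variables (R : realType) (n : nat) (u0 : 'rV[R]_n) (r : R).
Hypothesis r0 : 0 < r.

(** The squared Euclidean distance, since the norm on row vectors is the sup norm, which is not
    smooth. *)
Definition dist2 (u : 'rV[R]_n) : R := \sum_(i < n) (u 0 i - u0 0 i) * (u 0 i - u0 0 i).

(** [G] is positive for [dist2 u < r] and [H] for [dist2 u > r / 2]; these regions cover everything,
    so the denominator never vanishes. *)
Definition rbump (u : 'rV[R]_n) : R :=
  let G := flatexp 1 (r + - dist2 u) in let H := flatexp 1 (dist2 u + - (r / 2)) in
  G * (G + H)^-1.

Lemma Ck_dist2 k V : open V -> Ck k V dist2.
Proof.
move=> oV; apply: Ck_sum => // i; apply: CkM => //; apply: CkD => //;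
  by [exact: Ck_coord|exact: Ck_cst].
Qed.

Lemma Cinfty_rbump : Cinfty setT rbump.
Proof.
move=> k; have oT : open [set: 'rV[R]_n] by exact: openT.
have cd := Ck_dist2 k oT.
have cN : Ck k setT (fun u => - dist2 u).
  apply: (Ck_ext oT _ (CkM oT (Ck_cst k setT (-1)) cd)) => u _; exact: mulN1r.
have cG : Ck k setT (fun u => flatexp 1 (r + - dist2 u)).
  by apply: Ck_flatexp => //; apply: CkD => //; exact: Ck_cst.
have cH : Ck k setT (fun u => flatexp 1 (dist2 u + - (r / 2))).
  by apply: Ck_flatexp => //; apply: CkD => //; exact: Ck_cst.
apply: CkM => //; apply: CkV => //; last exact: CkD.
move=> u _; rewrite gt_eqF //.
have [h|h] := ltP (dist2 u) r.
  by rewrite ltr_pwDl ?flatexp_ge0 // flatexp_gt0; rewrite subr_gt0.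
rewrite ltr_wpDl ?flatexp_ge0 // flatexp_gt0 subr_gt0; apply: lt_le_trans h.
by rewrite ltr_pdivrMr // ltr_pMr // ltr1n.
Qed.

Lemma rbump1 u : dist2 u <= r / 2 -> rbump u = 1.
Proof.
move=> h; have e : flatexp 1 (dist2 u + - (r / 2)) = 0 by rewrite flatexp_le0 // subr_le0.
rewrite /rbump e addr0 divff //.
rewrite gt_eqF // flatexp_gt0 subr_gt0; apply: le_lt_trans h _.
by rewrite ltr_pdivrMr // ltr_pMr // ltr1n.
Qed.

Lemma rbump0 u : r <= dist2 u -> rbump u = 0.
Proof. by move=> h; rewrite /rbump flatexp_le0 ?subr_le0 // mul0r. Qed.

Lemma dist2_coord (u : 'rV[R]_n) i : (u 0 i - u0 0 i) ^+ 2 <= dist2 u.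
Proof.
rewrite /dist2 (bigD1 i) //= -expr2 lerDl sumr_ge0 // => j _.
by rewrite -expr2 sqr_ge0.
Qed.

Lemma dist2_continuous : continuous dist2.
Proof. by move=> u; apply: (@Ck_dist2 0 setT) => //; exact: openT. Qed.

Lemma rbump1_near : \forall u \near u0, rbump u = 1.
Proof.
have : \forall u \near u0, dist2 u < r / 2.
  have /(cvgr_lt (dist2 u0)) := @dist2_continuous u0; apply.
  by rewrite /dist2 big1 ?divr_gt0 // => i _; rewrite subrr mul0r.
by apply: filterS => u /ltW /rbump1.
Qed.
End Bump.

(** * Coordinates on a manifold *)

Section Charts.
Variables (R : realType) (n : nat) (T : topologicalType).
Implicit Types (c : chart R T n) (W : set T).

Lemma img_chartE c W : cmap c @` (W `&` cdom c) = (cmap c @` cdom c) `&` (cinv c @^-1` W).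
Proof.
apply/seteqP; split=> [_ [x [Wx cx] <-]|_ [[x cx <-]]]; first by split;
  [exists x|rewrite /= cmapK].
by rewrite /= cmapK // => Wx; exists x.
Qed.

Lemma open_img_chart c W : open W -> open (cmap c @` (W `&` cdom c)).
Proof.
move=> oW; rewrite img_chartE openE => u [cu Wu].
suff : nbhs u ((cmap c @` cdom c) `&` (cinv c @^-1` W)) by [].
apply: filterI.
  by apply: open_nbhs_nbhs; split; [exact: cimg_open|].
have /= := cinv_continuous cu; apply; exact: open_nbhs_nbhs.
Qed.

Lemma near_chart c x (Q : T -> Prop) : cdom c x -> (\forall y \near x, Q y) ->
  \forall u \near cmap c x, Q (cinv c u).
Proof.
move=> cx hQ; have cu : (cmap c @` cdom c) (cmap c x) by exists x.
have h : cinv c @ cmap c x --> cinv c (cmap c x) := cinv_continuous cu.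
by rewrite cmapK // in h; exact: (h _ hQ).
Qed.

Lemma near_dom c x : cdom c x -> \forall y \near x, cdom c y.
Proof. by move=> cx; apply: open_nbhs_nbhs (conj (cdom_open c) cx). Qed.

Lemma near_cimg c x : cdom c x -> \forall u \near cmap c x, (cmap c @` cdom c) u.
Proof. by move=> cx; apply: open_nbhs_nbhs; split; [exact: cimg_open|exists x]. Qed.

Lemma cinvK c u : (cmap c @` cdom c) u -> cmap c (cinv c u) = u.
Proof. by move=> [x cx <-]; rewrite cmapK. Qed.
End Charts.

Section Cinfty.
Variables (R : realType) (n : nat).
Implicit Types (V : set 'rV[R]_n) (f g : 'rV[R]_n -> R).

Lemma Cinfty_sub V V' f : V `<=` V' -> Cinfty V' f -> Cinfty V f.
Proof. by move=> VV' h k; apply: Ck_sub VV' (h k). Qed.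
Lemma Cinfty_ext V f g : open V -> (forall u, V u -> f u = g u) -> Cinfty V f -> Cinfty V g.
Proof. by move=> oV fg h k; apply: Ck_ext oV fg (h k). Qed.
Lemma Cinfty_cover V V1 V2 f : V `<=` V1 `|` V2 -> Cinfty V1 f -> Cinfty V2 f -> Cinfty V f.
Proof. by move=> VU h1 h2 k; apply/CkP => u /VU [] Vu; move: u Vu; apply/CkP. Qed.
Lemma CinftyM V f g : open V -> Cinfty V f -> Cinfty V g -> Cinfty V (fun u => f u * g u).
Proof. by move=> oV hf hg k; apply: CkM. Qed.
Lemma CinftyD V f g : open V -> Cinfty V f -> Cinfty V g -> Cinfty V (fun u => f u + g u).
Proof. by move=> oV hf hg k; apply: CkD. Qed.
Lemma Cinfty_cst V (r : R) : Cinfty V (fun _ => r).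
Proof. by move=> k; apply: Ck_cst. Qed.
Lemma Cinfty_derive V f i : Cinfty V f -> Cinfty V ('D_(delta_mx 0 i) f).
Proof. by move=> h k; case: (h k.+1) => _; exact. Qed.
Lemma Cinfty_differentiable V f u : Cinfty V f -> V u -> differentiable f u.
Proof. by move=> h; case: (h 1%N) => + _; exact. Qed.
End Cinfty.

Section Manifold.
Variables (R : realType) (n : nat) (M : manifold R n).
Implicit Types (c : chart R M n) (W N K : set M) (f g : M -> R) (x y : M).

Definition smooth_on W f := forall c, @atlas R n M c ->
  Cinfty (cmap c @` (W `&` cdom c)) (f \o cinv c).

Lemma smooth_onT f : smooth_on setT f <-> smooth_fun f.
Proof. by split=> h c /h; rewrite setTI. Qed.

Lemma smooth_on_ext W f g : open W -> (forall x, W x -> f x = g x) -> smooth_on W f ->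
  smooth_on W g.
Proof.
move=> oW fg h c ac; apply: Cinfty_ext (h c ac); first exact: open_img_chart.
by move=> _ [x [Wx cx] <-] /=; rewrite cmapK // fg.
Qed.

Lemma smooth_on_cover W W1 W2 f : W `<=` W1 `|` W2 -> smooth_on W1 f -> smooth_on W2 f ->
  smooth_on W f.
Proof.
move=> WU h1 h2 c ac; apply: Cinfty_cover (h1 c ac) (h2 c ac) => _ [x [/WU[] Wx cx] <-].
  by left; exists x.
by right; exists x.
Qed.

Lemma smooth_on_cst W (r : R) : smooth_on W (fun _ => r).
Proof. by move=> c _; exact: Cinfty_cst. Qed.

(** Any other chart of the atlas differs from [c0] by a smooth change of coordinates, so one chart
    suffices. *)
Lemma smooth_on_chart c0 W f : @atlas R n M c0 -> open W -> W `<=` cdom c0 ->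
  Cinfty (cmap c0 @` W) (f \o cinv c0) -> smooth_on W f.
Proof.
move=> a0 oW Wc0 hf c ac; have oV := @open_img_chart _ _ _ c _ oW.
set V := _ @` _ in oV *.
apply: (@Cinfty_ext _ _ _ (fun u => (f \o cinv c0) (cmap c0 (cinv c u)))) => //.
  by move=> _ [x [Wx cx] <-] /=; rewrite cmapK // cmapK //; exact: Wc0.
move=> k; apply: (@Ck_comp _ _ _ _ V (cmap c0 @` W)) => //.
  by move=> _ [x [Wx cx] <-]; rewrite cmapK //; exists x.
move=> j; apply: Ck_sub (atlas_compatible ac a0 j k.+1).
by apply: image_subset => x [Wx cx]; split => //; exact: Wc0.
Qed.

(** Extension by zero: [W] and the complement of [K] are open and cover the domain, and the product
    is smooth on each. *)
Lemma bump_mul c W K f chi : open W -> closed K -> K `<=` W ->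
  (forall x, ~ K x -> chi x = 0) ->
  Cinfty (cmap c @` (W `&` cdom c)) (f \o cinv c) ->
  Cinfty (cmap c @` cdom c) (chi \o cinv c) ->
  Cinfty (cmap c @` cdom c) ((fun x => chi x * f x) \o cinv c).
Proof.
move=> oW cK KW chi0 hf hchi.
apply: (@Cinfty_cover _ _ _ (cmap c @` (W `&` cdom c)) (cmap c @` (~` K `&` cdom c))).
- move=> _ [x cx <-]; have [Kx|nKx] := pselect (K x).
    by left; exists x => //; split => //; exact: KW.
  by right; exists x.
- apply: CinftyM => //; first exact: open_img_chart.
  by apply: Cinfty_sub hchi; apply: image_subset => x [].
- apply: (@Cinfty_ext _ _ _ (fun _ => 0)); last exact: Cinfty_cst.
    by apply/open_img_chart/closed_openC.
  by move=> _ [x [nKx cx] <-] /=; rewrite cmapK // chi0 // mul0r.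
Qed.

(** The bump on row vectors is carried over by the chart. [K] is the image of a compact ball, and
    the Hausdorff property makes it closed in the whole manifold, so the extension by zero is
    smooth. *)
Lemma exists_bump c0 N x0 : @atlas R n M c0 -> open N -> N `<=` cdom c0 -> N x0 ->
  exists (chi : M -> R) K, [/\ smooth_on setT chi, closed K, K `<=` N,
    (forall x, ~ K x -> chi x = 0) & \forall y \near x0, chi y = 1].
Proof.
move=> a0 oN Nc0 Nx0; set u0 := cmap c0 x0.
have oV : open (cmap c0 @` N).
  have -> : N = N `&` cdom c0 by apply/seteqP; split=> [x Nx|x []] //; split => //; exact: Nc0.
  exact: open_img_chart.
have Vu0 : (cmap c0 @` N) u0 by exists x0.
have /nbhs_ballP[e /= e0 be] := open_nbhs_nbhs (conj oV Vu0).
(* [dist2] is a square, so [dist2 u0 u <= r] bounds each coordinate difference by e/2, which keeps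
   the closed ball inside the sup-norm ball of radius [e]. *)
pose r : R := (e / 2) ^+ 2.
have r0 : 0 < r by rewrite exprn_gt0 // divr_gt0.
pose K0 := [set u | dist2 u0 u <= r].
have K0e u : K0 u -> `|u0 - u| <= e / 2.
  move=> Ku; rewrite /Num.Def.normr /= mx_normrE; apply: bigmax_le => [|[i j] _ /=].
    by rewrite ltW // divr_gt0.
  have e2 : e / 2 \is Num.nneg by rewrite nnegrE ltW // divr_gt0.
  rewrite !mxE ord1 distrC -(@ler_pXn2r _ 2) //.
  by rewrite real_normK ?num_real //; exact: (le_trans (dist2_coord u0 u j) Ku).
have K0V u : K0 u -> (cmap c0 @` N) u.
  move=> /K0e Ku; apply: be; rewrite -ball_normE /=; apply: le_lt_trans Ku _.
  by rewrite ltr_pdivrMr // ltr_pMr // ltr1n.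
have cK0 : compact K0.
  apply: bounded_closed_compact.
    exists (`|u0| + e / 2); split; first exact: num_real.
    move=> z hz u /K0e Ku; apply: le_trans (ltW hz); rewrite -[u](subKr u0).
    by apply: le_trans (ler_normB _ _) _; rewrite lerD2l.
  have -> : K0 = dist2 u0 @^-1` [set t | t <= r] by [].
  by apply: closed_comp => [u _|]; [exact: dist2_continuous|exact: closed_le].
pose K := cinv c0 @` K0.
have KN x : K x -> N x by move=> [u /K0V [y Ny <-] <-]; rewrite cmapK //; exact: Nc0.
have cK : closed K.
  apply: compact_closed; first exact: manifold_hausdorff.
  apply: continuous_compact cK0; apply: continuous_in_subspaceT => u.
  rewrite inE => /K0V [y Ny <-]; apply: cinv_continuous; exists y => //; exact: Nc0.
pose chi x := if pselect (N x) then rbump u0 r (cmap c0 x) else 0.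
have chi0 x : ~ K x -> chi x = 0.
  move=> nK; rewrite /chi; case: pselect => // Nx; apply: rbump0; rewrite leNgt.
  apply/negP => /ltW h; apply: nK; exists (cmap c0 x) => //; rewrite cmapK //; exact: Nc0.
exists chi, K; split => //.
- apply: (@smooth_on_cover _ N (~` K)).
  + by move=> x _; have [/KN|] := pselect (K x); [left|right].
  + apply: (smooth_on_chart a0) => //.
    apply: (@Cinfty_ext _ _ _ (rbump u0 r)) => //.
      by move=> _ [x Nx <-] /=; rewrite cmapK /chi; [case: pselect|exact: Nc0].
    by apply: Cinfty_sub (Cinfty_rbump u0 r0).
  + apply: (@smooth_on_ext _ (fun _ => 0)); [exact: closed_openC|by move=> x /chi0|].
    exact: smooth_on_cst.
- have Nn : \forall y \near x0, N y by apply: open_nbhs_nbhs.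
  have cb : \forall y \near x0, rbump u0 r (cmap c0 y) = 1.
    have h : cmap c0 @ x0 --> u0 := cmap_continuous (Nc0 _ Nx0).
    exact: (h _ (rbump1_near u0 r0)).
  near=> y; have Ny : N y by near: y.
  have cy : rbump u0 r (cmap c0 y) = 1 by near: y.
  by rewrite /chi; case: pselect.
Unshelve. all: by end_near. Qed.

End Manifold.

(** * Forms and multivector fields in a fixed chart *)

Section Components.
Variables (R : realType) (n : nat) (M : manifold R n).
Implicit Types (c : chart R M n) (W N K : set M) (f g : M -> R) (x y : M).
Implicit Types (eta : dform M) (A : mvfield M) (i j : 'I_n) (S : {set 'I_n}).
Notation at_ y := (@chart_at R n M y).
#[local] Hint Extern 0 (homog _ (rowv _)) => exact: rowv_homog : core.
#[local] Hint Extern 0 (homog _ (egen _)) => exact: homog_egen : core.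

Lemma chart_comp_diff c c' y j : @atlas R n M c -> @atlas R n M c' -> cdom c y -> cdom c' y ->
  differentiable (fun u => cmap c' (cinv c u) 0 j) (cmap c y).
Proof.
move=> ac ac' cy c'y; apply: (Cinfty_differentiable (atlas_compatible ac ac' j)).
by exists y.
Qed.

Lemma transitionE c c' y i j : @atlas R n M c -> @atlas R n M c' -> cdom c y -> cdom c' y ->
  transition c c' y i j = 'D_(delta_mx 0 i) (fun u => cmap c' (cinv c u) 0 j) (cmap c y).
Proof.
move=> ac ac' cy c'y.
have dG : differentiable (cmap c' \o cinv c) (cmap c y).
  by apply: differentiable_rV => l; exact: chart_comp_diff.
have := deriveEjacobian (delta_mx 0 i) dG; rewrite derive_mx; last exact: diff_derivable.
move/(congr1 (fun w : 'rV[R]_n => w 0 j)); rewrite -rowE mxE [RHS]mxE => E.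
by rewrite /transition -E.
Qed.

Lemma transition_id c y : @atlas R n M c -> cdom c y -> transition c c y = 1%:M.
Proof.
move=> ac cy; apply/matrixP => i j; rewrite transitionE //.
rewrite (@near_eq_derive _ _ _ _ (fun u : 'rV[R]_n => u 0 j)); last first.
  by apply: filterS (near_cimg cy) => u cu; rewrite cinvK.
have dj : derivable id (cmap c y) (delta_mx 0 i : 'rV[R]_n) by exact: derivable_id.
have := derive_mx dj; rewrite derive_id.
by move=> /(congr1 (fun w : 'rV[R]_n => w 0 j)); rewrite !mxE eqxx /= => <-; rewrite eq_sym.
Qed.

(** The chain rule; the factors come in this order because Jacobians act on row vectors. *)
Lemma transition_comp c c' c'' y : @atlas R n M c -> @atlas R n M c' -> @atlas R n M c'' ->
  cdom c y -> cdom c' y -> cdom c'' y ->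
  transition c c' y *m transition c' c'' y = transition c c'' y.
Proof.
move=> ac ac' ac'' cy cy' cy''; apply/matrixP => i j; rewrite mxE.
rewrite [RHS]transitionE //.
have nc : \forall u \near cmap c y, cmap c'' (cinv c u) 0 j =
    cmap c'' (cinv c' (cmap c' (cinv c u))) 0 j.
  apply: (@near_chart _ _ _ c y (fun z =>
    cmap c'' z 0 j = cmap c'' (cinv c' (cmap c' z)) 0 j)) => //.
  by apply: filterS (near_dom cy') => z cz; rewrite cmapK.
rewrite (near_eq_derive _ nc).
rewrite (@derive_comp_rV _ _ _ (fun v => cmap c'' (cinv c' v) 0 j) (fun u => cmap c' (cinv c u))).
- apply: eq_bigr => l _.
  have E1 := transitionE i l ac ac' cy cy'.
  have E2 := transitionE l j ac' ac'' cy' cy''.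
  by rewrite cmapK // [RHS]mulrC; congr (_ * _); [exact: E1|exact: E2].
- by rewrite cmapK //; exact: chart_comp_diff.
- by move=> l; exact: chart_comp_diff.
Qed.

Lemma transition_smooth c c' i j : @atlas R n M c -> @atlas R n M c' ->
  Cinfty (cmap c @` (cdom c' `&` cdom c)) ((fun y => transition c c' y i j) \o cinv c).
Proof.
move=> ac ac'; rewrite setIC; apply: (Cinfty_ext _ _ (Cinfty_derive i (atlas_compatible ac
  ac' j))).
  by rewrite setIC; apply: open_img_chart; exact: cdom_open.
by move=> _ [y [cy cy'] <-] /=; rewrite cmapK // transitionE.
Qed.

Opaque transition lmap.

(** All components in the chart [c] at once, as one element of the exterior algebra. Forms move by
    the transpose of the Jacobian from [c], vectors ([push]) by the Jacobian to [c]. *)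
Definition pull c eta y : ext R n := lmap (transition c (at_ y) y)^T (eta y).
Definition push c A y : ext R n := lmap (transition (at_ y) c y) (A y).

Lemma fcompE c eta S y : fcomp c eta S y = pull c eta y S.
Proof.
rewrite /fcomp /pull -[RHS]pairing_ebaser pairing_lmap trmxK lmap_ebase.
congr (pairing _ _); apply: eq_bigr => i _.
by rewrite /coordv /rowv; apply: eq_bigr => j _; rewrite [row _ _ _ _]mxE.
Qed.

Lemma mvcompE c A S y : mvcomp c A S y = push c A y S.
Proof.
rewrite /mvcomp /push -[RHS]pairing_ebaser pairing_lmap lmap_ebase pairingC.
congr (pairing _ _); apply: eq_bigr => i _.
by rewrite /coordf /rowv; apply: eq_bigr => j _; rewrite [row _ _ _ _]mxE [_^T _ _]mxE.
Qed.

Lemma transition_at c y : @atlas R n M c -> cdom c y ->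
  transition (at_ y) c y *m transition c (at_ y) y = 1%:M.
Proof.
move=> ac cy; have a' := @chart_at_atlas R n M y; have d' := @chart_at_dom R n M y.
by rewrite transition_comp // transition_id.
Qed.
Lemma transition_at' c y : @atlas R n M c -> cdom c y ->
  transition c (at_ y) y *m transition (at_ y) c y = 1%:M.
Proof.
move=> ac cy; have a' := @chart_at_atlas R n M y; have d' := @chart_at_dom R n M y.
by rewrite transition_comp // transition_id.
Qed.

Lemma pull_at eta x : pull (at_ x) eta x = eta x.
Proof.
rewrite /pull transition_id ?trmx1 ?lmap1 //; [exact: chart_at_atlas|exact: chart_at_dom].
Qed.
Lemma push_at A x : push (at_ x) A x = A x.
Proof.
rewrite /push transition_id ?trmx1 ?lmap1 //; [exact: chart_at_atlas|exact: chart_at_dom].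
Qed.

Lemma pairing_pull c eta A y : @atlas R n M c -> cdom c y ->
  pairing (pull c eta y) (push c A y) = pairing (eta y) (A y).
Proof. by move=> ac cy; rewrite /pull /push pairing_lmap2 ?(transition_at ac cy). Qed.

Lemma pull_inj c eta xi y : @atlas R n M c -> cdom c y ->
  pull c eta y = pull c xi y -> eta y = xi y.
Proof.
move=> ac cy E; have K z : lmap (transition (at_ y) c y)^T (lmap (transition c (at_ y) y)^T
  z) = z.
  by rewrite lmap_lmap -trmx_mul (transition_at ac cy) trmx1 lmap1.
exact: (etrans (esym (K (eta y))) (etrans (congr1 (lmap _) E) (K (xi y)))).
Qed.

Lemma pull_homog c eta k y : homog k (eta y) -> homog k (pull c eta y).
Proof. exact: lmap_homog. Qed.
Lemma push_homog c A k y : homog k (A y) -> homog k (push c A y).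
Proof. exact: lmap_homog. Qed.

Lemma pull_coordf c c' i y : @atlas R n M c -> @atlas R n M c' -> cdom c y -> cdom c' y ->
  pull c (coordf c' i) y = rowv (row i (transition c c' y)^T).
Proof.
move=> ac ac' cy cy'.
have -> : pull c (coordf c' i) y =
  lmap (transition c (at_ y) y)^T (rowv (row i (transition (at_ y) c' y)^T)).
  by rewrite /pull /coordf /rowv; congr (lmap _ _); apply: eq_bigr => j _;
    rewrite [row _ _ _ _]mxE [_^T _ _]mxE.
have a' := @chart_at_atlas R n M y; have d' := @chart_at_dom R n M y.
by rewrite lmap_rowv -row_mul -trmx_mul transition_comp.
Qed.

Lemma pull_coordf_id c i y : @atlas R n M c -> cdom c y -> pull c (coordf c i) y = egen i.
Proof. by move=> ac cy; rewrite pull_coordf // transition_id // trmx1 row1 rowv_egen. Qed.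

Lemma coordf_form c i : @atlas R n M c -> is_form 1 (cdom c) (coordf c i).
Proof.
move=> ac; split=> [x cx|c' S ac'].
  by apply: homog_sum => j _; apply: homogZ.
have [S1|nS] := eqVneq #|S| 1%N.
  have /cards1P[j ->] : #|S| == 1%N by rewrite S1.
  apply: (Cinfty_ext _ _ (transition_smooth j i ac' ac)).
    by apply: open_img_chart; exact: cdom_open.
  move=> _ [y [cy cy'] <-] /=; rewrite cmapK // fcompE pull_coordf //.
  by rewrite rowv_comp !mxE.
apply: (Cinfty_ext _ _ (Cinfty_cst _ 0)).
  by apply: open_img_chart; exact: cdom_open.
move=> _ [y [cy cy'] <-] /=; rewrite cmapK // fcompE pull_coordf //.
by rewrite (@rowv_homog _ _ _ S nS).
Qed.

Lemma fcomp_scale c eta f S y : fcomp c (fun y => f y *: eta y) S y = f y * fcomp c eta S y.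
Proof. by rewrite !fcompE /pull lmapZ extZ. Qed.
Lemma mvcomp_scale c A f S y : mvcomp c (fun y => f y *: A y) S y = f y * mvcomp c A S y.
Proof. by rewrite !mvcompE /push lmapZ extZ. Qed.

Lemma form_scale k f eta : smooth_fun f -> is_form k setT eta -> is_form k setT (fun y =>
  f y *: eta y).
Proof.
move=> hf [h1 h2]; split=> [x _|c S ac]; first exact/homogZ/h1.
rewrite (_ : _ \o _ = fun u => (f \o cinv c) u * (fcomp c eta S \o cinv c) u); last first.
  by apply/funext => u /=; rewrite fcomp_scale.
rewrite setTI; apply: CinftyM; [exact: cimg_open|exact: hf|].
by have := h2 c S ac; rewrite setTI.
Qed.

Lemma form_add k eta xi : is_form k setT eta -> is_form k setT xi -> is_form k setT (fun y =>
  eta y + xi y).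
Proof.
move=> [h1 h2] [h3 h4]; split=> [x _|c S ac]; first by apply: homogD; [exact: h1|exact: h3].
rewrite (_ : _ \o _ = fun u => (fcomp c eta S \o cinv c) u + (fcomp c xi S \o cinv c) u);
  last first.
  by apply/funext => u /=; rewrite !fcompE /pull lmapD extD.
by apply: CinftyD; [apply: open_img_chart openT|exact: h2|exact: h4].
Qed.

Lemma form0 k : is_form k setT (fun y : M => 0).
Proof.
split=> [x _|c S ac]; first exact: homog0.
rewrite (_ : _ \o _ = fun u => 0); first exact: Cinfty_cst.
by apply/funext => u /=; rewrite fcompE /pull lmap0 ext0.
Qed.

Lemma form_sum k (I : Type) (s : seq I) (F : I -> dform M) :
  (forall l, is_form k setT (F l)) -> is_form k setT (fun y => \sum_(l <- s) F l y).
Proof.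
move=> h; elim: s => [|l s IH].
  by rewrite (_ : (fun y => _) = fun y => 0); [exact: form0|apply/funext => y; rewrite big_nil].
rewrite (_ : (fun y => _) = fun y => F l y + \sum_(l <- s) F l y); first exact: form_add.
by apply/funext => y; rewrite big_cons.
Qed.

Lemma form_bump k W K chi eta : open W -> closed K -> K `<=` W -> (forall x, ~ K x ->
  chi x = 0) ->
  smooth_on setT chi -> is_form k W eta -> is_form k setT (fun y => chi y *: eta y).
Proof.
move=> oW cK KW chi0 /smooth_onT schi [h1 h2]; split=> [x _|c S ac].
  have [Kx|nK] := pselect (K x); first exact/homogZ/h1/KW.
  by rewrite chi0 // scale0r; exact: homog0.
rewrite setTI (_ : fcomp _ _ _ = fun y => chi y * fcomp c eta S y).
  exact: (bump_mul oW cK KW chi0 (h2 c S ac) (schi c ac)).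
by apply/funext => y; rewrite fcomp_scale.
Qed.

Lemma mvfield_bump k W K chi A : open W -> closed K -> K `<=` W -> (forall x, ~ K x ->
  chi x = 0) ->
  smooth_on setT chi -> is_mvfield k W A -> is_mvfield k setT (fun y => chi y *: A y).
Proof.
move=> oW cK KW chi0 /smooth_onT schi [h1 h2]; split=> [x _|c S ac].
  have [Kx|nK] := pselect (K x); first exact/homogZ/h1/KW.
  by rewrite chi0 // scale0r; exact: homog0.
rewrite setTI (_ : mvcomp _ _ _ = fun y => chi y * mvcomp c A S y).
  exact: (bump_mul oW cK KW chi0 (h2 c S ac) (schi c ac)).
by apply/funext => y; rewrite mvcomp_scale.
Qed.

Lemma form_sub k W W' eta : W `<=` W' -> is_form k W' eta -> is_form k W eta.
Proof.
move=> WW [h1 h2]; split=> [x /WW|c S ac]; first exact: h1.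
by apply: Cinfty_sub (h2 c S ac); apply: image_subset => x [/WW].
Qed.
Lemma bump_coef_smooth c0 W K chi a j : @atlas R n M c0 -> open W -> W `<=` cdom c0 -> closed K ->
  K `<=` W -> (forall x, ~ K x -> chi x = 0) ->
  smooth_on setT chi -> is_form 1 setT a -> smooth_fun (fun y =>
    chi y * fcomp c0 a [set j]%SET y).
Proof.
move=> a0 oW Wc cK KW chi0 /smooth_onT schi [h1 h2] c ac.
apply: (bump_mul oW cK KW chi0 _ (schi c ac)).
apply: (smooth_on_chart a0 oW Wc _ ac).
by apply: Cinfty_sub (h2 c0 [set j]%SET a0); apply: image_subset => x /Wc; rewrite setTI.
Qed.

Lemma form_coordf c a y : @atlas R n M c -> cdom c y -> homog 1 (a y) ->
  a y = \sum_j fcomp c a [set j]%SET y *: coordf c j y.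
Proof.
move=> ac cy ha; apply: (@pull_inj c a (fun y =>
  \sum_j fcomp c a [set j]%SET y *: coordf c j y)) => //.
rewrite [RHS]/pull lmap_sum [LHS]homog1E; last exact: pull_homog.
apply: eq_bigr => j _; rewrite lmapZ fcompE; congr (_ *: _).
by rewrite -[RHS]/(pull c (coordf c j) y) pull_coordf_id.
Qed.
End Components.

Opaque transition lmap dlift.

(** * First derivatives of components at a point *)

Section AtPoint.
Variables (R : realType) (n : nat) (M : manifold R n) (x0 : M).
Implicit Types (f : M -> R) (eta a : dform M) (A X : mvfield M) (i j l : 'I_n).
Let c0 := chart_at x0.
Let a0 : @atlas R n M c0 := chart_at_atlas x0.
Let d0 : cdom c0 x0 := chart_at_dom x0.
Let u0 := cmap c0 x0.

Definition dpull eta i : ext R n := [ffun S => (pderiv c0 i (fcomp c0 eta S) x0 : R^o)].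
Definition dpush A i : ext R n := [ffun S => (pderiv c0 i (mvcomp c0 A S) x0 : R^o)].

Lemma near_cinv (Q : M -> Prop) : (\forall y \near x0, Q y) -> \forall u \near u0, Q (cinv c0 u).
Proof. exact: near_chart. Qed.

Lemma cinv0 : cinv c0 u0 = x0. Proof. exact: cmapK. Qed.

Lemma pderiv_near f g i : (\forall y \near x0, f y = g y) -> pderiv c0 i f x0 = pderiv c0 i g x0.
Proof. by move=> /near_cinv; exact: near_eq_derive. Qed.

Lemma vderiv_near X f g : (\forall y \near x0, f y = g y) -> vderiv X f x0 = vderiv X g x0.
Proof. by move=> fg; apply: eq_bigr => i _; rewrite (pderiv_near i fg). Qed.

Lemma vderiv_cst X (r : R) : vderiv X (fun _ => r) x0 = 0.
Proof. by apply: big1 => i _; rewrite /pderiv derive_cst mulr0. Qed.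

Lemma form_derive k W eta i : open W -> W x0 -> is_form k W eta ->
  ext_derive u0 (delta_mx 0 i) (fun u => pull c0 eta (cinv c0 u)) (dpull eta i).
Proof.
move=> oW Wx [_ h2] S.
rewrite (_ : (fun u => _) = fcomp c0 eta S \o cinv c0); last by apply/funext => u /=;
  rewrite fcompE.
rewrite ffunE; apply/derivableP/diff_derivable/(Cinfty_differentiable (h2 c0 S a0)).
by exists x0.
Qed.

Lemma mvfield_derive k W A i : open W -> W x0 -> is_mvfield k W A ->
  ext_derive u0 (delta_mx 0 i) (fun u => push c0 A (cinv c0 u)) (dpush A i).
Proof.
move=> oW Wx [_ h2] S.
rewrite (_ : (fun u => _) = mvcomp c0 A S \o cinv c0); last by apply/funext => u /=;
  rewrite mvcompE.
rewrite ffunE; apply/derivableP/diff_derivable/(Cinfty_differentiable (h2 c0 S a0)).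
by exists x0.
Qed.

Lemma dextE eta : dext eta x0 = \sum_i wedge (egen i) (dpull eta i).
Proof. by []. Qed.

Lemma dpull_egen1 eta i : homog 1 (dpull eta i) ->
  dpull eta i = \sum_j pderiv c0 i (fcomp c0 eta [set j]%SET) x0 *: egen j.
Proof. by move=> h; rewrite [LHS]homog1E //; apply: eq_bigr => j _; rewrite ffunE. Qed.

End AtPoint.

(** * Contravariant derivatives in coordinates *)

Section Connection.
Variables (R : realType) (m : nat) (P : symplectic R m) (D : contravariant P) (x0 : P).
Local Notation n := (2 * m)%N.
Implicit Types (f : P -> R) (eta a : dform P) (A X : mvfield P) (i j l : 'I_n).
Let c0 := chart_at x0.
Let a0 : @atlas R n P c0 := chart_at_atlas x0.
Let d0 : cdom c0 x0 := chart_at_dom x0.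
Let u0 := cmap c0 x0.

Lemma cder0r eta x : is_form 1 setT eta -> D eta (fun _ => 0) x = 0.
Proof.
move=> he; have h := cder_linear D 1 he (form0 P 1) (form0 P 1) x.
move: h; rewrite (_ : (fun y => _) = fun _ => 0); last by apply/funext => y;
  rewrite scaler0 addr0.
by rewrite scale1r => /eqP; rewrite -{1}[D _ _ _]addr0 (inj_eq (addrI _)) eq_sym => /eqP.
Qed.

Lemma cder_sumr eta (I : Type) (s : seq I) (F : I -> dform P) x : is_form 1 setT eta ->
  (forall k, is_form 1 setT (F k)) ->
  D eta (fun y => \sum_(l <- s) F l y) x = \sum_(l <- s) D eta (F l) x.
Proof.
move=> he hF; elim: s => [|l s IH].
  rewrite big_nil (_ : (fun y => _) = fun _ => 0); first exact: cder0r.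
  by apply/funext => y; rewrite big_nil.
rewrite big_cons -IH -[D eta (F l) x]scale1r -cder_linear //; last exact: form_sum.
by congr (D eta _ x); apply/funext => y; rewrite big_cons scale1r.
Qed.

Lemma cder0l a x : is_form 1 setT a -> D (fun _ => 0) a x = 0.
Proof.
move=> ha.
have s1 : smooth_fun (fun _ : P => 1 : R) by move=> c _; exact: Cinfty_cst.
have h := cder_Cinfty_linear D s1 (form0 P 1) (form0 P 1) ha x.
move: h; rewrite (_ : (fun y => _) = fun _ => 0); last by apply/funext => y;
  rewrite scaler0 addr0.
by rewrite scale1r => /eqP; rewrite -{1}[D _ _ _]addr0 (inj_eq (addrI _)) eq_sym => /eqP.
Qed.

Lemma cder_scalel f eta a x : smooth_fun f -> is_form 1 setT eta -> is_form 1 setT a ->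
  D (fun y => f y *: eta y) a x = f x *: D eta a x.
Proof.
move=> hf he ha; have := cder_Cinfty_linear D hf he (form0 P 1) ha x.
rewrite cder0l // addr0 => <-; congr (D _ a x); apply/funext => y; by rewrite addr0.
Qed.

Lemma cder_suml a (I : Type) (s : seq I) (F : I -> dform P) x : is_form 1 setT a ->
  (forall k, is_form 1 setT (F k)) ->
  D (fun y => \sum_(l <- s) F l y) a x = \sum_(l <- s) D (F l) a x.
Proof.
move=> he hF; elim: s => [|l s IH].
  rewrite big_nil (_ : (fun y => _) = fun _ => 0); first exact: cder0l.
  by apply/funext => y; rewrite big_nil.
have s1 : smooth_fun (fun _ : P => 1 : R) by move=> c _; exact: Cinfty_cst.
rewrite big_cons -IH -[D (F l) a x]scale1r -(cder_Cinfty_linear D s1 (hF l)) //;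
  last exact: form_sum.
by congr (D _ a x); apply/funext => y; rewrite big_cons scale1r.
Qed.

Variables (N K : set P) (chi : P -> R).
Hypotheses (oN : open N) (N0 : N `<=` cdom c0) (cK : closed K) (KN : K `<=` N).
Hypotheses (chi0 : forall x, ~ K x -> chi x = 0) (schi : smooth_on setT chi).
Hypothesis (chi1 : \forall y \near x0, chi y = 1).

(** [D] acts on global forms only; near [x0] this one coincides with dx^i. *)
Definition gform i : dform P := fun y => chi y *: coordf c0 i y.

Lemma gform_form i : is_form 1 setT (gform i).
Proof. by apply: (form_bump oN cK KN chi0 schi); apply: form_sub N0 _; exact: coordf_form. Qed.

Lemma chi_x0 : chi x0 = 1. Proof. exact: (nbhs_singleton chi1). Qed.

Lemma pull_gform_near i : \forall y \near x0, pull c0 (gform i) y = egen i.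
Proof.
near=> y; have cy : cdom c0 y by near: y; exact: near_dom.
rewrite /pull /gform (near chi1 y) // scale1r; exact: pull_coordf_id.
Unshelve. all: by end_near. Qed.

Lemma gform_x0 i : gform i x0 = egen i.
Proof. by rewrite -pull_at (nbhs_singleton (pull_gform_near i)). Qed.

Definition fcoef a i : P -> R := fun y => chi y * fcomp c0 a [set i]%SET y.

Lemma fcoef_smooth a i : is_form 1 setT a -> smooth_fun (fcoef a i).
Proof. exact: (bump_coef_smooth i a0 oN N0 cK KN chi0 schi). Qed.

(** The square of [chi] appears because both factors on the right have to be global: one [chi]
    extends the coefficient, the other the coordinate form. *)
Lemma gform_decomp a : is_form 1 setT a ->
  (fun y => (chi y * chi y) *: a y) = (fun y => \sum_i fcoef a i y *: gform i y).
Proof.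
move=> [h1 _]; apply/funext => y.
have [Ky|nK] := pselect (K y); last first.
  by rewrite chi0 // mul0r scale0r big1 // => i _; rewrite /fcoef chi0 // mul0r scale0r.
have cy : cdom c0 y by apply/N0/KN.
rewrite {1}(form_coordf a0 cy (h1 y I)) scaler_sumr; apply: eq_bigr => i _.
by rewrite /fcoef /gform !scalerA; congr (_ *: _); ring.
Qed.

Lemma fcoef_x0 a i : fcoef a i x0 = a x0 [set i]%SET.
Proof. by rewrite /fcoef chi_x0 mul1r fcompE pull_at. Qed.

Lemma chi2_smooth : smooth_fun (fun y => chi y * chi y).
Proof. move=> c ac; have s := (smooth_onT _).1 schi c ac; apply: CinftyM => //;
  exact: cimg_open. Qed.

(* D_{dx^i} dx^j = sum_l (christoffel i j l) dx^l at x0. *)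
Definition christoffel i : 'M[R]_n := \matrix_(j, l) D (gform i) (gform j) x0 [set l]%SET.
Definition gamma eta : 'M[R]_n := \sum_i eta x0 [set i]%SET *: christoffel i.

Lemma cder_gform eta a : is_form 1 setT eta -> is_form 1 setT a ->
  D eta a x0 = \sum_i eta x0 [set i]%SET *: D (gform i) a x0.
Proof.
move=> he ha.
have := cder_scalel x0 chi2_smooth he ha; rewrite gform_decomp // chi_x0 mulr1 scale1r => <-.
rewrite cder_suml // => [|l]; last by apply: form_scale; [exact: fcoef_smooth|exact: gform_form].
apply: eq_bigr => i _; rewrite cder_scalel ?fcoef_x0 //; [exact: fcoef_smooth|exact: gform_form].
Qed.

Lemma cder_gform2 eta j : is_form 1 setT eta -> D eta (gform j) x0 = dlift (gamma eta) (egen j).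
Proof.
move=> he; rewrite cder_gform //; last exact: gform_form.
rewrite dlift_sum; apply: eq_bigr => i _; rewrite dlift_mul dlift_egen.
have [h _] := cder_form D (gform_form i) (gform_form j).
by congr (_ *: _); rewrite (homog1E (h x0 I)); apply: eq_bigr => l _; rewrite mxE.
Qed.

Lemma dpull_homog k W eta i : open W -> W x0 -> is_form k W eta -> homog k (dpull x0 eta i).
Proof.
move=> oW Wx he; apply: (ext_derive_homog (form_derive i oW Wx he)).
apply: (near_cinv (Q := fun y => homog k (pull c0 eta y))).
apply: filterS (open_nbhs_nbhs (conj oW Wx)) => y Wy.
by apply: pull_homog; case: he => h _; exact: h.
Qed.

(** By the Leibniz rule, multiplying [a] by the square of [chi], which is 1 near [x0], changes
    nothing at [x0]. The decomposition over the cut-off forms then reduces everything to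
    [christoffel]. *)
Lemma cderE eta a : is_form 1 setT eta -> is_form 1 setT a ->
  D eta a x0 = dlift (gamma eta) (a x0) + \sum_i sharp eta x0 [set i]%SET *: dpull x0 a i.
Proof.
move=> he ha; have [ha1 _] := ha.
have := cder_leibniz D chi2_smooth he ha x0; rewrite chi_x0 mulr1 scale1r.
rewrite (@vderiv_near _ _ _ _ _ _ (fun _ => 1)); last first.
  by apply: filterS chi1 => y ->; rewrite mulr1.
rewrite vderiv_cst scale0r addr0 gform_decomp // => <-.
rewrite cder_sumr // => [|l]; last by apply: form_scale; [exact: fcoef_smooth|exact: gform_form].
have E i : D eta (fun y => fcoef a i y *: gform i y) x0 =
  a x0 [set i]%SET *: dlift (gamma eta) (egen i) +
    vderiv (sharp eta) (fcomp c0 a [set i]%SET) x0 *: egen i.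
  rewrite cder_leibniz //; [|exact: fcoef_smooth|exact: gform_form].
  rewrite fcoef_x0 cder_gform2 // gform_x0; congr (_ + _ *: _).
  by apply: vderiv_near; apply: filterS chi1 => y; rewrite /fcoef => ->; rewrite mul1r.
under eq_bigr do rewrite E.
rewrite big_split /=; congr (_ + _).
  rewrite [in RHS](homog1E (ha1 x0 I)).
  by rewrite dlift_sumr; apply: eq_bigr => i _; rewrite dliftZ.
under [RHS]eq_bigr => i _.
  rewrite dpull_egen1; last by apply: dpull_homog openT I ha.
  rewrite scaler_sumr; over.
rewrite exchange_big; apply: eq_bigr => j _ /=; rewrite /vderiv scaler_suml.
by apply: eq_bigr => i _; rewrite scalerA.
Qed.

Lemma vderiv_pairing X eta A dE dA : (forall i, ext_derive u0 (delta_mx 0 i)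
      (fun u => pull c0 eta (cinv c0 u)) (dE i)) ->
  (forall i, ext_derive u0 (delta_mx 0 i) (fun u => push c0 A (cinv c0 u)) (dA i)) ->
  vderiv X (fun y => pairing (eta y) (A y)) x0 =
    pairing (\sum_i X x0 [set i]%SET *: dE i) (A x0)
    + pairing (eta x0) (\sum_i X x0 [set i]%SET *: dA i).
Proof.
move=> hE hA; rewrite pairing_suml pairing_sumr -big_split; apply: eq_bigr => i _ /=.
rewrite pairingZl pairingZr -mulrDr; congr (_ * _).
have := is_derive_pairing (hE i) (hA i).
rewrite cinv0 pull_at push_at => -[_ <-].
apply: near_eq_derive; apply: (near_cinv (Q := fun y =>
  pairing (eta y) (A y) = pairing (pull c0 eta y) (push c0 A y))).
by apply: filterS (near_dom d0) => y cy; rewrite pairing_pull.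
Qed.

Lemma pull_wedge_fam k (a : 'I_k -> dform P) y :
  pull c0 (fun y => wedge_fam (fun q =>
    a q y)) y = \big[wedge/eone]_(q <- enum 'I_k) pull c0 (a q) y.
Proof.
rewrite /pull /wedge_fam.
by apply: (big_morph (lmap _)) => [b b'|]; rewrite ?lmap_eone ?lmap_wedge.
Qed.

(** Global 1-forms thus reach every basis element and determine a k-vector by pairing; this is the
    uniqueness half of [cder_mvE]. *)
Lemma wedge_fam_gform k (S : {set 'I_n}) (Sk : #|S| = k) :
  wedge_fam (fun q : 'I_k => gform (enum_val (cast_ord (esym Sk) q)) x0) = ebase S.
Proof.
case: k / Sk; rewrite /wedge_fam (eq_bigr (fun q : 'I_#|S| => egen (enum_val q))) => [|q _];
  last first.
  by rewrite cast_ord_id gform_x0.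
rewrite -(big_map (fun q : 'I_#|S| => enum_val q) xpredT egen).
have -> : map (fun q : 'I_#|S| => enum_val q) (enum 'I_#|S|) = enum S.
  have [S0|[i0 i0S]] := set_0Vmem S.
    apply: (@etrans _ _ [::]); last by rewrite S0 enum_set0.
    by apply: size0nil; rewrite size_map size_enum_ord S0 cards0.
  apply: (@eq_from_nth _ i0) => [|k]; rewrite size_map size_enum_ord; first by rewrite cardE.
  move=> kS; rewrite (nth_map (Ordinal kS)) ?size_enum_ord // (enum_val_nth i0).
  by rewrite nth_enum_ord.
rewrite -[RHS]lmap1 lmap_ebase; apply: eq_bigr => i _.
by rewrite row1 rowv_egen.
Qed.

(** * The derivative of a multivector field *)

Section Multivector.
Variables (k : nat) (A : mvfield P) (dA : 'I_n -> ext R n).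
Hypothesis hk : \forall y \near x0, homog k (A y).
Hypothesis hA : forall i, ext_derive u0 (delta_mx 0 i) (fun u => push c0 A (cinv c0 u)) (dA i).

(** The derivative along [sharp eta], corrected by the negative transpose of [gamma], as duality
    with 1-forms dictates. Taking [dA] as data covers the Poisson bivector too, whose derivatives
    come from those of [vmx]. *)
Definition cder_val eta : ext R n :=
  \sum_i sharp eta x0 [set i]%SET *: dA i - dlift (gamma eta)^T (A x0).

Lemma dA_homog i : homog k (dA i).
Proof.
apply: (ext_derive_homog (hA i)).
apply: (near_cinv (Q := fun y => homog k (push c0 A y))).
by apply: filterS hk => y; exact: push_homog.
Qed.

Lemma cder_val_homog eta : homog k (cder_val eta).
Proof.
apply: homogD; first by apply: homog_sum => i _; apply/homogZ/dA_homog.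
by apply/homogN/dlift_homog/(nbhs_singleton hk).
Qed.

(** In each [D eta (a q)] the derivative part cancels against the product rule for the pairing; what
    remains is [dlift (gamma eta)], moved to [A] by adjunction. *)
Lemma cder_val_spec eta (a : 'I_k -> dform P) : is_form 1 setT eta ->
  (forall q, is_form 1 setT (a q)) ->
  pairing (wedge_fam (fun q => a q x0)) (cder_val eta)
  = vderiv (sharp eta) (fun y => pairing (wedge_fam (fun q => a q y)) (A y)) x0
    - \sum_(p < k)
        pairing (wedge_fam (fun q => if q == p then D eta (a q) x0 else a q x0)) (A x0).
Proof.
move=> he ha.
pose dE i := wleib (fun q => a q x0) (fun q => dpull x0 (a q) i) (enum 'I_k).
have hE i : ext_derive u0 (delta_mx 0 i)
    (fun u => pull c0 (fun y => wedge_fam (fun q => a q y)) (cinv c0 u)) (dE i).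
  rewrite (_ : (fun u => _) = fun u =>
    \big[wedge/eone]_(q <- enum 'I_k) pull c0 (a q) (cinv c0 u)); last first.
    by apply/funext => u; rewrite pull_wedge_fam.
  have := @ext_derive_big_wedge R _ n u0 (delta_mx 0 i) _ (enum 'I_k)
    (fun q u => pull c0 (a q) (cinv c0 u)) (fun q => dpull x0 (a q) i) (enum_uniq _).
  rewrite (_ : (fun x => _) = fun q => a q x0); last by apply/funext => q; rewrite cinv0 pull_at.
  by apply=> q; apply: form_derive openT I (ha q).
rewrite (vderiv_pairing _ hE hA) -pairing_suml.
have -> : \sum_(p < k) wedge_fam (fun q => if q == p then D eta (a q) x0 else a q x0)
   = wleib (fun q => a q x0) (fun q => D eta (a q) x0) (enum 'I_k).
  by rewrite /wleib big_enum.
rewrite (_ : (fun q => D eta (a q) x0) = fun q => dlift (gamma eta) (a q x0) +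
    \sum_i sharp eta x0 [set i]%SET *: dpull x0 (a q) i); last first.
  by apply/funext => q; rewrite cderE.
rewrite wleibD ?enum_uniq // -dlift_big_wedge ?enum_uniq // wleib_sum ?enum_uniq //.
have -> : \sum_i wleib (fun q => a q x0) (fun q =>
  sharp eta x0 [set i]%SET *: dpull x0 (a q) i) (enum 'I_k)
    = \sum_i sharp eta x0 [set i]%SET *: dE i.
  by apply: eq_bigr => i _; rewrite wleibZ ?enum_uniq.
rewrite /cder_val pairingDr -scaleN1r pairingZr pairingDl -pairing_dlift.
by rewrite /wedge_fam; ring.
Qed.

Lemma cder_mvE eta : is_form 1 setT eta -> cder_mv D k eta A x0 = cder_val eta.
Proof.
move=> he; rewrite /cder_mv; case: xgetP => [B -> [hB B_spec]|/(_ (cder_val eta)) []]; last first.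
  by split; [exact: cder_val_homog|move=> a ha; exact: cder_val_spec].
apply/ffunP => S; have [Sk|nS] := eqVneq #|S| k; last by rewrite hB // cder_val_homog.
rewrite -!pairing_ebasel -(wedge_fam_gform Sk).
have ga q : is_form 1 setT (gform (enum_val (cast_ord (esym Sk) q))) by exact: gform_form.
by rewrite (B_spec _ ga) -(cder_val_spec he ga).
Qed.
End Multivector.

(** All global extensions give the same value, because [cder_val] depends only on [eta] at [x0] and
    on the value and first derivatives of [A] there. Multiplying by [chi] provides an extension. *)
Lemma cder_locE k W eta A : open W -> W x0 -> N `<=` W -> is_form 1 W eta -> is_mvfield k W A ->
  cder_loc D k eta A x0 = cder_val A (dpush x0 A) eta.
Proof.
move=> oW Wx NW he hA.
have hk : \forall y \near x0, homog k (A y).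
  by apply: filterS (open_nbhs_nbhs (conj oW Wx)) => y; case: hA => h _; exact: h.
have dA i := mvfield_derive i oW Wx hA.
have loc eta' A' : is_form 1 setT eta' -> (\forall y \near x0, eta' y = eta y) ->
    (\forall y \near x0, A' y = A y) -> cder_mv D k eta' A' x0 = cder_val A (dpush x0 A) eta.
  move=> he' ee AA; have e0 := nbhs_singleton ee; have A0 := nbhs_singleton AA.
  rewrite (@cder_mvE k A' (dpush x0 A)) //.
  - by rewrite /cder_val /gamma /sharp e0 A0.
  - by near=> y; rewrite (near AA y) //; near: y.
  - move=> i; apply: ext_derive_near (dA i).
    apply: (near_cinv (Q := fun y => push c0 A y = push c0 A' y)).
    by apply: filterS AA => y Ay; rewrite /push Ay.
rewrite /cder_loc; case: xgetP =>
  [B -> [eta' [A' [he' hA' ee AA ->]]]|/(_ (cder_val A (dpush x0 A) eta)) []].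
  exact: loc.
have KW : K `<=` W by apply: subset_trans NW.
have ee : \forall y \near x0, chi y *: eta y = eta y by apply: filterS chi1 => y ->;
  rewrite scale1r.
have AA : \forall y \near x0, chi y *: A y = A y by apply: filterS chi1 => y ->; rewrite scale1r.
have hce := form_bump oW cK KW chi0 schi he.
exists (fun y => chi y *: eta y), (fun y => chi y *: A y); split => //.
  exact: (mvfield_bump oW cK KW chi0 schi hA).
by rewrite loc.
Unshelve. all: by end_near. Qed.

(** * The symplectic form and the Poisson bivector in coordinates *)

Definition wmx y : 'M[R]_n := omx (pull c0 (@omega R m P) y).
Definition vmx y : 'M[R]_n := invmx (wmx y).

Lemma omega_homog y : homog 2 (@omega R m P y).
Proof. by case: (omega_form P) => h _; exact: h. Qed.

Lemma pull_omega_homog y : homog 2 (pull c0 (@omega R m P) y).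
Proof. exact/pull_homog/omega_homog. Qed.

Lemma pull_iprodl X eta y : cdom c0 y ->
  pull c0 (fun z => iprodl (X z) (eta z)) y = iprodl (push c0 X y) (pull c0 eta y).
Proof. by move=> cy; rewrite /pull /push (lmap_iprodl _ _ (transition_at a0 cy)). Qed.

Lemma pull_nondegenerate y v : cdom c0 y -> homog 1 v ->
  iprodl v (pull c0 (@omega R m P) y) = 0 -> v = 0.
Proof.
move=> cy.
exact: (lmap_nondegenerate (@omega_nondegenerate _ _ P y) (transition_at' a0 cy)
  (transition_at a0 cy)).
Qed.

Lemma sharp_atE y b : homog 1 b -> sharp_at y b = om_sharp (@omega R m P y) b.
Proof.
move=> hb; rewrite /sharp_at; case: xgetP => [v -> [hv iv]|/(_ (om_sharp (@omega R m P y) b)) []].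
  exact: (om_sharp_uniq (omega_homog y) (@omega_nondegenerate _ _ P y)).
split; first exact: om_sharp_homog.
exact: (om_sharpK (omega_homog y) (@omega_nondegenerate _ _ P y)).
Qed.

Lemma push_sharp a y : cdom c0 y -> homog 1 (a y) ->
  push c0 (sharp a) y = om_sharp (pull c0 (@omega R m P) y) (pull c0 a y).
Proof.
move=> cy ha.
rewrite /push /sharp sharp_atE //.
exact: (om_sharp_lmap (omega_homog y) (@omega_nondegenerate _ _ P y) (transition_at' a0 cy)
  (transition_at a0 cy) ha).
Qed.

Lemma wmx_unit y : cdom c0 y -> wmx y \in unitmx.
Proof. by move=> cy; apply: (omx_unit (pull_omega_homog y)) => v; exact: pull_nondegenerate. Qed.

Lemma om_sharp_egen y i : om_sharp (pull c0 (@omega R m P) y) (egen i) = rowv (row i (vmx y)).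
Proof.
rewrite /om_sharp (_ : \row_j _ = delta_mx 0 i) -?rowE //.
by apply/rowP => j; rewrite !mxE ebaseE eqxx /= (inj_eq set1_inj).
Qed.

Lemma poisson_spec y : homog 2 (poisson_bivector P y) /\ forall a b : ext R n, homog 1 a ->
  homog 1 b ->
  pairing (wedge b a) (poisson_bivector P y) = pairing b (sharp_at y a).
Proof.
rewrite /poisson_bivector; case: xgetP => [B -> //|/(_ (om_bivector (@omega R m P y))) []].
split=> [|a b ha hb]; first exact: om_bivector_homog.
rewrite sharp_atE //.
exact: (om_bivectorE (omega_homog y) (@omega_nondegenerate _ _ P y)).
Qed.

Lemma poisson_pairing y i j : cdom c0 y ->
  pairing (wedge (egen i) (egen j)) (push c0 (poisson_bivector P) y) = vmx y j i.
Proof.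
move=> cy; have [_ spec] := poisson_spec y.
have spec' (a b : ext R n) : homog 1 a -> homog 1 b ->
    pairing (wedge b a) (poisson_bivector P y) = pairing b (om_sharp (@omega R m P y) a).
  by move=> ha hb; rewrite spec // sharp_atE.
have := bivector_lmap (omega_homog y) (@omega_nondegenerate _ _ P y) (transition_at' a0 cy)
  (transition_at a0 cy) spec' (@homog_egen _ _ j) (@homog_egen _ _ i).
by rewrite -/(pull c0 _ y) om_sharp_egen pairing_ebasel rowv_comp mxE.
Qed.

Definition dwmx i : 'M[R]_n := \matrix_(r, s)
  pairing (dpull x0 (@omega R m P) i) (wedge (egen r) (egen s)).
Definition dvmx i : 'M[R]_n := \matrix_(r, s)
  'D_(delta_mx 0 i) (fun u => vmx (cinv c0 u) r s) u0.

Lemma omega_derive i : ext_derive u0 (delta_mx 0 i)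
  (fun u => pull c0 (@omega R m P) (cinv c0 u)) (dpull x0 (@omega R m P) i).
Proof. exact: (form_derive i openT I (omega_form P)). Qed.

Lemma wmx_derive i r s : is_derive u0 (delta_mx 0 i) (fun u => wmx (cinv c0 u) r s) (dwmx i r s).
Proof.
rewrite (_ : (fun u => _) = fun u =>
  pairing (pull c0 (@omega R m P) (cinv c0 u)) (wedge (egen r) (egen s))).
  apply: (is_derive_eq (is_derive_pairing (omega_derive i) (ext_derive_cst u0 (delta_mx 0 i) _))).
  by rewrite linear0 addr0 mxE.
by apply/funext => u; rewrite mxE.
Qed.

Lemma vmx_derive i r s : is_derive u0 (delta_mx 0 i) (fun u => vmx (cinv c0 u) r s) (dvmx i r s).
Proof.
rewrite mxE; apply/derivableP/derivable_invmx.
- by rewrite cinv0; exact: wmx_unit.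
- by move=> k l; case: (wmx_derive i k l).
- apply: (near_cinv (Q := fun y => wmx y \in unitmx)).
  by apply: filterS (near_dom d0) => y; exact: wmx_unit.
Qed.

Lemma wmxV y : cdom c0 y -> wmx y *m vmx y = 1%:M.
Proof. by move=> cy; exact: (mulmxV (wmx_unit cy)). Qed.
Lemma Vwmx y : cdom c0 y -> vmx y *m wmx y = 1%:M.
Proof. by move=> cy; exact: (mulVmx (wmx_unit cy)). Qed.

(** Differentiate [wmx y *m vmx y = 1%:M], which holds throughout a neighbourhood of [x0]. *)
Lemma dwmxE i : dwmx i = - (wmx x0 *m dvmx i *m wmx x0).
Proof.
have E : dwmx i *m vmx x0 + wmx x0 *m dvmx i = 0.
  apply/matrixP => r s; rewrite !mxE -big_split /=.
  have h : is_derive u0 (delta_mx 0 i) (fun u => \sum_k wmx (cinv c0 u) r k * vmx (cinv c0 u) k s)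
      (\sum_k (dwmx i r k * vmx (cinv c0 u0) k s + wmx (cinv c0 u0) r k * dvmx i k s)).
    apply: (@is_derive_bigsum _ _ _ _ _ _ xpredT (fun k u =>
      wmx (cinv c0 u) r k * vmx (cinv c0 u) k s)) => k _.
    by apply: is_derive_mul; [exact: wmx_derive|exact: vmx_derive].
  rewrite cinv0 in h; case: h => _ <-.
  rewrite (@near_eq_derive _ _ _ _ (cst ((1%:M : 'M[R]_n) r s))); first exact: derive_cst.
  apply: (near_cinv (Q := fun y => \sum_k wmx y r k * vmx y k s = (1%:M : 'M[R]_n) r s)).
  by apply: filterS (near_dom d0) => y cy; rewrite -(wmxV cy) mxE.
move/eqP: E; rewrite addr_eq0 => /eqP /(congr1 (mulmx^~ (wmx x0))) /=.
by rewrite -mulmxA (Vwmx d0) mulmx1 mulNmx.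
Qed.

Lemma vmx_anti y : cdom c0 y -> (vmx y)^T = - vmx y.
Proof.
move=> cy; apply: (Wanti (wmxV cy)).
exact: omx_antisym.
Qed.

(** The formula of [om_bivector], differentiated through [vmx]. *)
Definition dpoisson i : ext R n := - 2%:R^-1 *: \sum_j wedge (egen j) (rowv (row j (dvmx i))).

Lemma poisson_bivectorE y : cdom c0 y ->
  push c0 (poisson_bivector P) y = - 2%:R^-1 *: \sum_j wedge (egen j) (rowv (row j (vmx y))).
Proof.
move=> cy; rewrite -[RHS](_ : om_bivector (pull c0 (@omega R m P) y) = _); last first.
  by rewrite /om_bivector; congr (_ *: _); apply: eq_bigr => j _; rewrite om_sharp_egen.
apply: homog2P; [apply/push_homog; by case: (poisson_spec y)|exact: om_bivector_homog|].
move=> i j; rewrite poisson_pairing //.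
rewrite (om_bivectorE (pull_omega_homog y) (fun v => @pull_nondegenerate y v cy));
  try exact: homog_egen.
by rewrite om_sharp_egen pairing_ebasel rowv_comp mxE.
Qed.

Lemma dpoisson_derive i : ext_derive u0 (delta_mx 0 i)
  (fun u => push c0 (poisson_bivector P) (cinv c0 u)) (dpoisson i).
Proof.
apply: (@ext_derive_near _ _ _ _ _ (fun u =>
  - 2%:R^-1 *: \sum_j wedge (egen j) (rowv (row j (vmx (cinv c0 u)))))).
  apply: (near_cinv (Q := fun y => - 2%:R^-1 *: (\sum_j wedge (egen j) (rowv (row j (vmx
    y)))) = push c0 (poisson_bivector P) y)).
  by apply: filterS (near_dom d0) => y cy; rewrite poisson_bivectorE.
apply: ext_deriveZ; apply: (@ext_derive_sum _ _ _ _ _ _ _ (fun j u =>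
  wedge (egen j) (rowv (row j (vmx (cinv c0 u)))))) => j.
have h := @ext_derive_rowv R _ n u0 (delta_mx 0 i) (fun u =>
  row j (vmx (cinv c0 u))) (row j (dvmx i)).
have hj : ext_derive u0 (delta_mx 0 i) (fun u =>
  rowv (row j (vmx (cinv c0 u)))) (rowv (row j (dvmx i))).
  apply: h => k; rewrite mxE (_ : (fun u => _) = fun u => vmx (cinv c0 u) j k);
    first exact: vmx_derive.
  by apply/funext => u; rewrite mxE.
have := ext_derive_wedge (ext_derive_cst u0 (delta_mx 0 i) (egen j)) hj.
by rewrite wedge0l add0r.
Qed.

Lemma dpoisson_pairing i j q : pairing (wedge (egen i) (egen j)) (dpoisson q) = dvmx q j i.
Proof.
have h := is_derive_pairing (ext_derive_cst u0 (delta_mx 0 q) (wedge (egen i) (egen j)))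
  (dpoisson_derive q).
rewrite pairing0l add0r in h; case: h => _ <-; case: (vmx_derive q j i) => _ <-.
apply: near_eq_derive.
apply: (near_cinv (Q := fun y => pairing (wedge (egen i) (egen j)) (push c0 (poisson_bivector
  P) y) = vmx y j i)).
by apply: filterS (near_dom d0) => y; exact: poisson_pairing.
Qed.

Lemma sharp_x0 b j : homog 1 b ->
  @sharp_at R m P x0 b [set j]%SET = \sum_i b [set i]%SET * vmx x0 i j.
Proof.
move=> hb; rewrite sharp_atE //.
have -> : @omega R m P x0 = pull c0 (@omega R m P) x0 by rewrite pull_at.
rewrite /om_sharp rowv_comp mxE; apply: eq_bigr => i _.
by rewrite mxE.
Qed.

Lemma sharp_gform i j : sharp (gform i) x0 [set j]%SET = vmx x0 i j.
Proof.
rewrite /sharp gform_x0 sharp_x0; last exact: homog_egen.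
rewrite (bigD1 i) //= big1 => [|k ki]; rewrite ebaseE.
  by rewrite eqxx mul1r addr0.
by rewrite (inj_eq set1_inj) (negPf ki) mul0r.
Qed.

Lemma gamma_gform i : gamma (gform i) = christoffel i.
Proof.
rewrite /gamma gform_x0 (bigD1 i) //= big1 => [|k ki]; rewrite ebaseE.
  by rewrite eqxx scale1r addr0.
by rewrite (inj_eq set1_inj) (negPf ki) scale0r.
Qed.

(** D Pi = 0 for the form dx^i, tested on e_s /\ e_r: Pi has coefficient [vmx x0 r s] there, and
    sharp(dx^i) is row [i] of [vmx x0]. *)
Lemma christoffel_parallel : poisson_connection D -> forall i,
  \sum_q vmx x0 i q *: dvmx q = vmx x0 *m (christoffel i)^T + christoffel i *m vmx x0.
Proof.
move=> pc i; have := pc _ (gform_form i) x0.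
have hk : \forall y \near x0, homog 2 (poisson_bivector P y).
  by apply: filterS (near_dom d0) => y _; case: (poisson_spec y).
rewrite (cder_mvE hk dpoisson_derive (gform_form i)) /cder_val gamma_gform => /eqP.
rewrite subr_eq0 => /eqP E; apply/matrixP => r s.
have := congr1 (pairing (wedge (egen s) (egen r))) E.
rewrite -pairing_dlift dlift_wedge2 pairing_sumr.
have pp k l : pairing (wedge (egen k) (egen l)) (poisson_bivector P x0) = vmx x0 l k.
  by rewrite -(poisson_pairing k l d0) push_at.
under eq_bigr do rewrite pairingZr dpoisson_pairing sharp_gform.
under [X in _ = X -> _]eq_bigr do rewrite !pp.
rewrite big_split /= summxE !mxE => h;
  rewrite (eq_bigr (fun q => vmx x0 i q * dvmx q r s)) => [|q _]; last by rewrite !mxE.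
rewrite h; congr (_ + _); apply: eq_bigr => l _; by rewrite !mxE // mulrC.
Qed.

Lemma fcomp_gform_near j (S : {set 'I_n}) : \forall y \near x0, fcomp c0 (gform j) S y = egen j S.
Proof. by apply: filterS (pull_gform_near j) => y e; rewrite fcompE e. Qed.

(** The components of dx^j are constant near [x0], so the Lie derivative reduces to the differential
    of the j-th component of sharp(dx^i). *)
Lemma lie1_gform i j q : lie1 (sharp (gform i)) (gform j) x0 [set q]%SET = dvmx q i j.
Proof.
rewrite /lie1 sum_egen_comp (@vderiv_near _ _ _ _ _ _ (fun _ => egen j [set q]%SET));
  last exact: fcomp_gform_near.
rewrite vderiv_cst add0r gform_x0 (bigD1 j) //= big1 ?addr0 => [|k kj]; rewrite ebaseE;
  last first.
  by rewrite (inj_eq set1_inj) (negPf kj) mul0r.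
rewrite eqxx mul1r; case: (vmx_derive q i j) => _ <-.
apply: near_eq_derive; apply: (near_cinv (Q := fun y =>
  mvcomp c0 (sharp (gform i)) [set j]%SET y = vmx y i j)).
near=> y; have cy : cdom c0 y by near: y; exact: near_dom.
have ey : pull c0 (gform i) y = egen i by near: y; exact: pull_gform_near.
have hy : homog 1 (gform i y) by case: (gform_form i) => h _; exact: h.
by rewrite mvcompE (push_sharp cy hy) ey om_sharp_egen rowv_comp mxE.
Unshelve. all: by end_near. Qed.

Lemma dext_fun (f : P -> R) q : dext (form_of_fun f) x0 [set q]%SET = pderiv c0 q f x0.
Proof.
have E i : dpull x0 (form_of_fun f) i = pderiv c0 i f x0 *: eone.
  apply/ffunP => S; rewrite ffunE extZ.
  have -> : fcomp c0 (form_of_fun f) S = (fun y => f y * eone S).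
    by apply/funext => y; rewrite fcompE /pull /form_of_fun lmapZ lmap_eone extZ.
  have [S0|nS] := eqVneq #|S| 0%N; last first.
    rewrite (@homog_eone R n S nS) mulr0 (_ : (fun y => _) = fun _ => 0) ?/pderiv ?derive_cst //.
    by apply/funext => y; rewrite mulr0.
  have -> : eone S = 1 :> R by rewrite ebaseE (cards0_eq S0) eqxx.
  by rewrite mulr1; congr (pderiv _ _ _ _); apply/funext => y; rewrite mulr1.
rewrite -[RHS](sum_egen_comp (fun i => pderiv c0 i f x0)) dextE.
by congr (fun_of_fin _ _); apply: eq_bigr => i _; rewrite E wedgeZr wedgea1.
Qed.

(** The two Lie derivatives in the bracket give the differentials of the (i, j) and (j, i) entries
    of [vmx]; the exact term cancels the second. *)
Lemma christoffel_torsion : torsion_free D -> forall i j q,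
  christoffel i j q - christoffel j i q = dvmx q i j.
Proof.
move=> tf i j q; have := tf _ _ (gform_form i) (gform_form j) x0.
rewrite /torsion => /eqP; rewrite subr_eq0 => /eqP.
move/(congr1 (fun b : ext R n => b [set q]%SET)).
rewrite extD extN => E; rewrite [christoffel i j q]mxE [christoffel j i q]mxE E.
pose f y := pairing (wedge (gform i y) (gform j y)) (poisson_bivector P y).
have L3 : dext (form_of_fun f) x0 [set q]%SET = dvmx q j i.
  rewrite dext_fun.
  case: (vmx_derive q j i) => _ <-; apply: near_eq_derive.
  apply: (near_cinv (Q := fun y => f y = vmx y j i)).
  near=> y; have cy : cdom c0 y by near: y; exact: near_dom.
  have ei : pull c0 (gform i) y = egen i by near: y; exact: pull_gform_near.
  have ej : pull c0 (gform j) y = egen j by near: y; exact: pull_gform_near.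
  apply: (etrans _ (poisson_pairing i j cy)); rewrite -ei -ej -lmap_wedge.
  exact/esym/(pairing_pull (fun z => wedge (gform i z) (gform j z)) (poisson_bivector P) a0 cy).
have ext3 (b1 b2 b3 : ext R n) S : (b1 - b2 + b3) S = b1 S - b2 S + b3 S by rewrite !extD extN.
apply: (etrans (ext3 _ _ _ _)).
apply: (etrans (congr2 +%R (congr2 (fun r s => r - s) (lie1_gform i j q) (lie1_gform j i q)) L3)).
by rewrite subrK.
Unshelve. all: by end_near. Qed.

Lemma dpull_eq eta i d : ext_derive u0 (delta_mx 0 i) (fun u => pull c0 eta (cinv c0 u)) d ->
  dpull x0 eta i = d.
Proof.
move=> h; apply/ffunP => S; rewrite ffunE; case: (h S) => _ <-; rewrite /pderiv.
by congr ('D_ _ _ _); apply/funext => u /=; rewrite fcompE.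
Qed.

(** * The exterior derivative of a contracted volume form *)

Section Divergence.
Hypotheses (pc : poisson_connection D) (tf : torsion_free D).

Definition nabla r : 'M[R]_n := lower_christoffel (wmx x0) christoffel r.

Lemma dvmxE r : dvmx r = vmx x0 *m (nabla r)^T + nabla r *m vmx x0.
Proof. exact: (lower_parallel (wmxV d0) (christoffel_parallel pc)). Qed.

Lemma nabla_sym q j l : nabla q j l = nabla l j q.
Proof.
exact: (lower_christoffel_sym (Vwmx d0) (wmxV d0) (vmx_anti d0) (christoffel_parallel pc)
  (christoffel_torsion tf)).
Qed.

(** nabla omega = 0: parallelism passes from the matrix [vmx] of Pi to its inverse [wmx] through
    [dwmxE]. *)
Lemma dpull_omega r : dpull x0 (@omega R m P) r = dlift (- nabla r) (@omega R m P x0).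
Proof.
apply: homog2P; first exact: (dpull_homog r openT I (omega_form P)).
  exact/dlift_homog/omega_homog.
move=> i j; rewrite -[X in dlift _ X](@pull_at R (2 * m) P).
rewrite pairingC -[LHS](_ : dwmx r i j = _); last by rewrite mxE.
rewrite pairingC pairing_dlift pairingC dlift_wedge2.
have -> : dwmx r = - (nabla r)^T *m wmx x0 - wmx x0 *m nabla r.
  rewrite dwmxE dvmxE mulmxDr mulmxDl !mulmxA (wmxV d0) mul1mx -[wmx x0 *m nabla r *m _ *m
    _]mulmxA (Vwmx d0) mulmx1.
  by rewrite opprD mulNmx.
rewrite !mxE -sumrN -big_split /=; apply: eq_bigr => l _; rewrite !mxE.
rewrite !(pairingC (wedge _ _)); ring.
Qed.

Lemma liouville_homog y : homog n (liouville P y).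
Proof. exact/homogZ/(wedge_pow_homog (omega_homog y)). Qed.

Lemma liouville_neq0 y : liouville P y != 0.
Proof.
rewrite scaler_eq0 invr_eq0 pnatr_eq0 negb_or -lt0n fact_gt0 /=.
exact: (wedge_pow_neq0 (omega_homog y) (@omega_nondegenerate _ _ P y)).
Qed.

(** mu is parallel because its factors are, and on a top form a derivation acts by its trace. *)
Lemma liouville_derive r : ext_derive u0 (delta_mx 0 r)
  (fun u => pull c0 (liouville P) (cinv c0 u)) (- \tr (nabla r) *: liouville P x0).
Proof.
have -> : - \tr (nabla r) *: liouville P x0 = dlift (- nabla r) (liouville P x0).
  by rewrite (dlift_top _ (liouville_homog x0)) linearN.
rewrite /liouville dliftZ (_ : (fun u => _) = fun u =>
  (m`!)%:R^-1 *: wedge_pow m (pull c0 (@omega R m P) (cinv c0 u))); last first.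
  by apply/funext => u; rewrite /pull lmapZ lmap_wedge_pow.
apply: ext_deriveZ.
have E : @omega R m P x0 = pull c0 (@omega R m P) (cinv c0 u0) by rewrite cinv0 pull_at.
rewrite E; apply: ext_derive_wedge_pow; rewrite -E -dpull_omega.
exact: omega_derive.
Qed.

Lemma dpull_mflat k W A r : open W -> W x0 -> is_mvfield k W A ->
  dpull x0 (mflat (liouville P) A) r =
  iprodl (dpush x0 A r) (liouville P x0) - \tr (nabla r) *: iprodl (A x0) (liouville P x0).
Proof.
move=> oW Wx hA; apply: dpull_eq.
have h := ext_derive_iprodl (mvfield_derive r oW Wx hA) (liouville_derive r).
rewrite cinv0 pull_at push_at [iprodl (A x0) (- _ *: _)]iprodlZr scaleNr in h;
  apply: (ext_derive_near _ h).
apply: (near_cinv (Q := fun y => iprodl (push c0 A y) (pull c0 (liouville P) y) =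
  pull c0 (mflat (liouville P) A) y)).
by apply: filterS (near_dom d0) => y cy; rewrite -pull_iprodl.
Qed.

Lemma dext_mflat k W A : open W -> W x0 -> is_mvfield k W A ->
  dext (mflat (liouville P) A) x0 =
  iprodl (\sum_q iprodr (egen q) (dpush x0 A q - dlift (nabla q)^T (A x0))) (liouville P x0).
Proof.
move=> oW Wx hA; have hmu := liouville_homog x0.
rewrite dextE iprodl_suml.
have -> : \sum_q iprodl (iprodr (egen q) (dpush x0 A q - dlift (nabla q)^T (A x0)))
  (liouville P x0) =
   \sum_q wedge (egen q) (dpull x0 (mflat (liouville P) A) q)
   + \sum_q wedge (egen q) (dlift (nabla q) (iprodl (A x0) (liouville P x0))).
  rewrite -big_split; apply: eq_bigr => q _ /=.
  rewrite -(wedge_iprodl_top _ (@homog_egen R n q) hmu) -wedgeDr; congr (wedge _ _).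
  by rewrite (dpull_mflat q oW Wx hA) iprodlDl iprodlNl (iprodl_dlift_top _ _ hmu) opprB
    addrA addrAC.
by rewrite (dlift_sym _ (fun q l j => nabla_sym q j l)) addr0.
Qed.

Lemma msharp_liouville B eta : iprodl B (liouville P x0) = eta x0 ->
  msharp (liouville P) eta x0 = B.
Proof.
move=> hB; rewrite /msharp; case: xgetP => [B' -> hB'|/(_ B) []//].
apply/eqP; rewrite -subr_eq0; apply/eqP.
apply: (iprodl_top_inj (liouville_homog x0) (liouville_neq0 x0)).
by rewrite iprodlDl iprodlNl hB hB' subrr.
Qed.

(** Duality turns the sum over frame and coframe into one over coordinates. There omega sits in
    flat; shifting it to the other factor turns D into nabla and transposes the antisymmetric
    [wmx]. *)
Lemma frame_sum k W A (e : 'I_n -> mvfield P) (theta : 'I_n -> dform P) :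
  open W -> W x0 -> is_mvfield k W A -> is_frame W e -> is_dual_coframe W e theta ->
  - (\sum_i iprodr (flat (e i) x0) (cder_val A (dpush x0 A) (theta i))) =
  \sum_q iprodr (egen q) (dpush x0 A q - dlift (nabla q)^T (A x0)).
Proof.
move=> oW Wx hA [he _] [ht dual].
have e1 i : homog 1 (e i x0) by case: (he i) => h _; exact: h.
have t1 i : homog 1 (theta i x0) by case: (ht i) => h _; exact: h.
pose ep : 'M[R]_n := \matrix_(i, p) e i x0 [set p]%SET.
pose t : 'M[R]_n := \matrix_(i, p) theta i x0 [set p]%SET.
have te : t *m ep^T = 1%:M.
  apply/matrixP => i j; rewrite -[RHS](_ : pairing (theta i x0) (e j x0) = _);
    last by rewrite dual // mxE.
  rewrite -(rowvK (t1 i)) pairing_rowv // mxE; apply: eq_bigr => p _.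
  by rewrite !mxE.
(* Duality is the product in the other order; summing over the frame index needs this one, and for
   square matrices a one-sided inverse is two-sided. *)
have et : ep^T *m t = 1%:M by rewrite (mulmx1C te).
(* [C p] is D_{dx^p} A at [x0], and [F p] is flat of the p-th coordinate vector. *)
pose C p := \sum_q vmx x0 p q *: dpush x0 A q - dlift (christoffel p)^T (A x0).
pose F p := rowv (row p (wmx x0)).
have fE i : flat (e i) x0 = \sum_p ep i p *: F p.
  rewrite /flat -(rowvK (e1 i)) -[omega x0](@pull_at R (2 * m) P).
  rewrite (iprodl_omx (pull_omega_homog x0)) rowvM; apply: eq_bigr => p _.
  by rewrite !mxE.
have cE i : cder_val A (dpush x0 A) (theta i) = \sum_p t i p *: C p.
  rewrite /cder_val /gamma; under [RHS]eq_bigr do rewrite /C scalerBr.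
  rewrite sumrB; congr (_ - _).
    under [RHS]eq_bigr do rewrite scaler_sumr.
    rewrite exchange_big; apply: eq_bigr => q _;
      rewrite /sharp (sharp_x0 _ (t1 i)) scaler_suml /=.
    by apply: eq_bigr => p _; rewrite scalerA mxE.
  by rewrite dlift_tr_sum; apply: eq_bigr => p _; rewrite mxE.
(* Contracting [C] with the matrix of omega gives nabla_b A: its derivative part because [wmx] and
   [vmx] are inverse, the other part by the definition of [nabla]. *)
have wC b : \sum_p wmx x0 b p *: C p = dpush x0 A b - dlift (nabla b)^T (A x0).
  under eq_bigr do rewrite /C scalerBr.
  rewrite sumrB; congr (_ - _).
    under eq_bigr do rewrite scaler_sumr.
    rewrite exchange_big /= (eq_bigr (fun q => (1%:M : 'M[R]_n) b q *: dpush x0 A q)) => [|q _].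
      rewrite (bigD1 b) //= big1 ?addr0 => [|q qb]; rewrite mxE ?eqxx ?scale1r //.
      by rewrite eq_sym (negPf qb) scale0r.
    by rewrite -(wmxV d0) mxE scaler_suml; apply: eq_bigr => p _; rewrite scalerA.
  by rewrite /nabla /lower_christoffel dlift_tr_sum.
have FC : \sum_i iprodr (flat (e i) x0) (cder_val A (dpush x0 A) (theta i)) =
  \sum_p iprodr (F p) (C p).
  under eq_bigr => i _.
    rewrite fE cE iprodr_suml.
    under eq_bigr => p _ do rewrite iprodrZl iprodr_sumr scaler_sumr.
    over.
  rewrite exchange_big; apply: eq_bigr => p _ /=; rewrite exchange_big /=.
  rewrite (eq_bigr (fun b => (1%:M : 'M[R]_n) p b *: iprodr (F p) (C b))) => [|b _].
    rewrite (bigD1 p) //= big1 ?addr0 => [|b ba]; rewrite mxE ?eqxx ?scale1r //.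
    by rewrite eq_sym (negPf ba) scale0r.
  rewrite -et mxE scaler_suml; apply: eq_bigr => i _.
  by rewrite iprodrZr scalerA [ep^T _ _]mxE.
rewrite FC; under [RHS]eq_bigr do rewrite -wC iprodr_sumr.
rewrite exchange_big -sumrN; apply: eq_bigr => p _ /=.
rewrite /F /rowv iprodr_suml -sumrN; apply: eq_bigr => b _.
rewrite iprodrZl iprodrZr -scaleNr mxE; congr (_ *: _).
(* The minus sign of the curl formula originates in this antisymmetry. *)
by have := congr1 (fun N : 'M[R]_n => N p b) (omx_antisym (pull c0 (@omega R m P) x0));
  rewrite !mxE.
Qed.
End Divergence.
End Connection.

(** * The curl operator in a local frame *)

Theorem theorem5p10 (R : realType) (m : nat) (P : symplectic R m)
    (D : contravariant P) (c : chart R P (2 * m))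
    (e : 'I_(2 * m) -> mvfield P) (theta : 'I_(2 * m) -> dform P) :
  poisson_connection D ->
  smooth_chart c ->
  is_frame (cdom c) e ->
  is_dual_coframe (cdom c) e theta ->
  torsion_free D ->
  forall (k : nat) (A : mvfield P), is_mvfield k (cdom c) A ->
  forall x : P, cdom c x ->
    curl (liouville P) A x
      = - \sum_(i < 2 * m) iprodr (flat (e i) x) (cder_loc D k (theta i) A x).
Proof.
move=> pc _ he ht tf k A hA x cx.
have oc := cdom_open c.
(* The cut-off has to live where the frame and [A] are smooth and where the coordinates of
   [chart_at x] are defined. *)
pose N := cdom c `&` cdom (chart_at x).
have oN : open N by apply: openI => //; exact: cdom_open.
have Nc : N `<=` cdom c by move=> y [].
have N0 : N `<=` cdom (chart_at x) by move=> y [].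
have Nx : N x by split => //; exact: chart_at_dom.
have [chi [K [schi cK KN chi0 chi1]]] := exists_bump (chart_at_atlas x) oN N0 Nx.
(* Contraction with mu is injective, so it suffices to compare d (i(A) mu) with the contraction of
   mu by the right-hand side. *)
apply: msharp_liouville; symmetry.
rewrite (dext_mflat oN N0 cK KN chi0 schi chi1 pc tf oc cx hA).
rewrite -(frame_sum D chi oc cx hA he ht).
congr (iprodl (- _) _); apply: eq_bigr => i _; congr (iprodr _ _).
exact: (esym (cder_locE D oN N0 cK KN chi0 schi chi1 oc cx Nc (ht.1 i) hA)).
Qed.
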